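(* Let $n\ge1$, and let $\tau_1,\tau_2,\tau_3$ and $a,b,\alpha,\beta,\gamma,\delta$ be real numbers, defining $G$-equivariant tensors $T_0:\Lambda^2V\to V$ and $\mathfrak I_0:V\to\mathfrak{gl}(V)/\mathfrak g$, for $G=\operatorname{U}(n)\times\{1\}$, by $$T_0(X,Y)=\tau_3\,\omega_0(X,Y)e,\quad T_0(X,e)=\tau_1X+\tau_2J_0X\quad(X,Y\in H_0)$$ (extended by skew-symmetry), and $\mathfrak I_0(X+se)=\lambda(X+se)+\mathfrak g$ with $$\lambda(X+se)=\begin{pmatrix}as\,\operatorname{Id}_{H_0}&\alpha X+\beta J_0X\\(\gamma X+\delta J_0X)^\flat&bs\end{pmatrix}.$$ Then $(T_0,\mathfrak I_0)$ are the torsion and inner torsion characteristic tensors of an infinitesimally homogeneous affine manifold with structure group $\operatorname{U}(n)\times\{1\}$ if and only if $$(2\delta-\tau_3)(\alpha-a-\tau_1)=0.$$ In that case, the curvature characteristic tensor $R_0$ is determined by these parameters together with a real number $\kappa$, which is arbitrary if $\alpha-a=\tau_1$ and vanishes otherwise, as follows. Put $$a^s=a+\tfrac{\tau_1}2,\quad b^s=b,\quad \alpha^s=\alpha-\tfrac{\tau_1}2,\quad \beta^s=\beta-\tfrac{\tau_2}2,\quad \gamma^s=\gamma,\quad \delta^s=\delta-\tfrac{\tau_3}2,\quad\kappa^s=\kappa,$$ $P(X)=\alpha X+\beta J_0X$ and $Q(X)=\gamma X+\delta J_0X$. If $\alpha-a=\tau_1$ (that is, $a^s=\alpha^s$), then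 $$c_1=a^s(b^s-a^s)+(\beta^s)^2+\tfrac12b^s\tau_1+\tfrac14(\tau_1^2-\tau_2^2),\qquad c_2=\beta^s(b^s-2a^s)+\tfrac12b^s\tau_2+\tfrac12\tau_1\tau_2,$$ $$c_3=(a^s-b^s)\gamma^s+\beta^s\delta^s-\tfrac12\gamma^s\tau_1-\tfrac12\delta^s\tau_2+\tfrac12\beta^s\tau_3-\tfrac14\tau_2\tau_3,$$ $$c_4=(a^s-b^s)\delta^s-\beta^s\gamma^s-\tfrac12\delta^s\tau_1+\tfrac12\gamma^s\tau_2+\tfrac12(a^s-b^s)\tau_3-\tfrac14\tau_1\tau_3,$$ $$c_0=2\bigl((a^s-b^s)\delta^s-\beta^s\gamma^s\bigr)+\delta^s\tau_1-\gamma^s\tau_2+a^s\tau_3+\tfrac12\tau_1\tau_3,$$ $$\begin{aligned}B(X,Y)Z={}&P(X)h_0(Q(Y),Z)-P(Y)h_0(Q(X),Z)-2a\delta^s\,\omega_0(X,Y)Z\\&+\delta^s(\tau_2-2\beta^s)\,\omega_0(X,Y)J_0Z+\kappa^sK_{X,Y}Z.\end{aligned}$$ If $\alpha-a\neq\tau_1$ (that is, $a^s\ne\alpha^s$), then $\delta^s=0$, $\kappa=0$ and $$c_1=-(\alpha^s)^2+b^s\alpha^s+(\beta^s)^2+\tfrac12b^s\tau_1+\tfrac14(\tau_1^2-\tau_2^2),\qquad c_2=\beta^s(b^s-2\alpha^s)+\tfrac12b^s\tau_2+\tfrac12\tau_1\tau_2,$$ $$c_3=(2a^s-\alpha^s-b^s)\gamma^s-\tfrac12\gamma^s\tau_1+\tfrac12\beta^s\tau_3-\tfrac14\tau_2\tau_3,$$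 $$c_4=-\beta^s\gamma^s+\tfrac12\gamma^s\tau_2+\Bigl(a^s-\tfrac{\alpha^s+b^s}2\Bigr)\tau_3-\tfrac14\tau_1\tau_3,$$ $$c_0=-2\beta^s\gamma^s-\gamma^s\tau_2+\alpha^s\tau_3+\tfrac12\tau_1\tau_3,$$ $$B(X,Y)Z=P(X)h_0(Q(Y),Z)-P(Y)h_0(Q(X),Z).$$
   Context: Let $V$ be a finite-dimensional real vector space and $G\subseteq\operatorname{GL}(V)$ a Lie subgroup with Lie algebra $\mathfrak g\subseteq\mathfrak{gl}(V)$. A $G$-structure on a smooth manifold $M$ with $\dim M=\dim V$ is a principal $G$-subbundle $P$ of the frame bundle $\operatorname{FR}(TM)$; elements $p\in P_x$ are linear isomorphisms $p:V\to T_xM$, and two frames in $P_x$ differ by right composition with an element of $G$. An affine manifold with $G$-structure is a triple $(M,\nabla,P)$ with $\nabla$ an affine connection on $M$ and $P$ a $G$-structure. Put $T(X,Y)=\nabla_XY-\nabla_YX-[X,Y]$ and $R(X,Y)=\nabla_X\nabla_Y-\nabla_Y\nabla_X-\nabla_{[X,Y]}$. Inner torsion: for a local section $s:U\to P$ define $\Lambda^s_x(u)\in\mathfrak{gl}(V)$ by $\nabla_{s(x)u}(s\,w)=s(x)(\Lambda^s_x(u)w)$ for $u,w\in V$, where $s\,w$ is the vector field $x\mapsto s(x)w$. With $\mathfrak g_x=\operatorname{Ad}_p(\mathfrak g)$ for any $p\in P_x$ and $\overline{\operatorname{Ad}}_p:\mathfrak{gl}(V)/\mathfrak g\to\mathfrak{gl}(T_xM)/\mathfrak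 g_x$ induced by conjugation by $p$, the inner torsion is $\mathfrak I^P_x:T_xM\to\mathfrak{gl}(T_xM)/\mathfrak g_x$, $\mathfrak I^P_x(s(x)u)=\overline{\operatorname{Ad}}_{s(x)}(\Lambda^s_x(u)+\mathfrak g)$ (independent of $s$). $(M,\nabla,P)$ is infinitesimally homogeneous if there are linear maps $T_0:\Lambda^2V\to V$, $R_0:\Lambda^2V\to\mathfrak{gl}(V)$, $\mathfrak I_0:V\to\mathfrak{gl}(V)/\mathfrak g$ (the characteristic tensors) with $T_x(pu,pv)=p\,T_0(u,v)$, $R_x(pu,pv)pw=p\,R_0(u,v)w$, $\mathfrak I^P_x(pu)=\overline{\operatorname{Ad}}_p(\mathfrak I_0(u))$ for all $x\in M$, $p\in P_x$, $u,v,w\in V$. Here $V=H_0\oplus\mathbb Re$, where $H_0\simeq\mathbb R^{2n}$ has its standard Euclidean metric $h_0$, standard complex structure $J_0$ and $\omega_0(X,Y)=h_0(J_0X,Y)$. $G=\operatorname{U}(n)\times\{1\}\subset\operatorname{GL}(V)$ acts on $H_0$ by the standard real representation of $\operatorname{U}(n)$ and fixes $e$; $\mathfrak g=\mathfrak u(n)\oplus\{0\}$. Write $Z^\flat=h_0(Z,\cdot)$; matrices are with respect to $V=H_0\oplus\mathbb Re$. The curvature characteristic tensor is written, with $c_0,\dots,c_4\in\mathbb R$ and $B\in\operatorname{Hom}_{\operatorname{U}(n)}(\Lambda^2H_0,\mathfrak{gl}(H_0))$, for $X,Y\in H_0$, as $$R_0(X,e)=\begin{pmatrix}0&c_1X+c_2J_0X\\(c_3X+c_4J_0X)^\flat&0\end{pmatrix},\qquad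 R_0(X,Y)=\begin{pmatrix}B(X,Y)&0\\0&c_0\,\omega_0(X,Y)\end{pmatrix}.$$ For $X,Y,Z\in H_0$, $$K_{X,Y}Z=\tfrac14\bigl(h_0(Y,Z)X-h_0(X,Z)Y+\omega_0(Y,Z)J_0X-\omega_0(X,Z)J_0Y-2\omega_0(X,Y)J_0Z\bigr).$$ *)

(* Defs.v *)
From HB Require Import structures.
From mathcomp Require Import all_boot all_order all_algebra.
From mathcomp Require Import all_classical all_reals all_analysis.

Set Implicit Arguments.
Unset Strict Implicit.
Unset Printing Implicit Defensive.

Import Order.TTheory GRing.Theory Num.Theory.
Import numFieldNormedType.Exports.

Local Open Scope classical_set_scope.
Local Open Scope ring_scope.

(* [C_k k U f] is meant for open [U]: all iterated directional derivatives of
   [f] of order at most [k] exist and are continuous on [U]. *)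
Fixpoint C_k (R : realType) (V W : normedModType R) (k : nat) (U : set V)
    (f : V -> W) : Prop :=
  (forall x, U x -> {for x, continuous f}) /\
  if k is k'.+1 then
    forall v : V, (forall x, U x -> derivable f x v) /\
                  C_k k' U (fun x => 'D_v f x)
  else True.

Definition C_infty (R : realType) (V W : normedModType R) (U : set V)
    (f : V -> W) : Prop := forall k, C_k k U f.

(* Both [coord] and [param] are total; only their values on [dom] and on
   [coord @` dom] are meaningful. *)
Record chart (R : realType) (m : nat) (M : topologicalType) := Chart {
  dom : set M;
  coord : M -> 'cV[R]_m;
  param : 'cV[R]_m -> M;
  open_dom : open dom;
  open_coord_dom : open (coord @` dom);
  coordK : {in dom, cancel coord param};
  coord_continuous : forall x, dom x -> {for x, continuous coord};
  param_continuous :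
    forall z, (coord @` dom) z -> {for z, continuous param} }.

(* A nonempty smooth manifold of dimension [m], given by an atlas.  The choice
   [at_ x] of one chart of the atlas around each point [x] is auxiliary data,
   used to identify the tangent space at [x] with the model space R^m. *)
Record manifold (R : realType) (m : nat) := Manifold {
  carrier :> topologicalType;
  carrier_nonempty : exists x : carrier, True;
  carrier_hausdorff : hausdorff_space carrier;
  carrier_second_countable : @second_countable carrier;
  index : Type;
  atlas : index -> chart R m carrier;
  at_ : carrier -> index;
  at_dom : forall x, dom (atlas (at_ x)) x;
  atlas_smooth : forall i j : index,
    C_infty (coord (atlas i) @` (dom (atlas i) `&` dom (atlas j)))
            (coord (atlas j) \o param (atlas i)) }.

Section Calculus.
Variables (R : realType) (m : nat) (M : manifold R m).

(* The vector [v : tangent x] has components [v] in the chart [at_ x], hence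
   components [tangent_coord i v] in any chart [i] around [x]. *)
Definition tangent (x : M) : Type := 'cV[R]_m.

Definition tangent_coord (i : index M) (x : M) (v : tangent x) : 'cV[R]_m :=
  'D_v (coord (atlas i) \o param (atlas (at_ x))) (coord (atlas (at_ x)) x).

Definition vfield : Type := forall x : M, tangent x.

Definition vfield_coord (X : vfield) (i : index M) (z : 'cV[R]_m) : 'cV[R]_m :=
  tangent_coord i (X (param (atlas i) z)).

Definition smooth_fun (U : set M) (f : M -> R) : Prop :=
  forall i, C_infty (V := 'cV[R]_m) (W := R^o)
    (coord (atlas i) @` (dom (atlas i) `&` U)) (f \o param (atlas i)).

Definition smooth_vfield (U : set M) (X : vfield) : Prop :=
  forall i, C_infty (coord (atlas i) @` (dom (atlas i) `&` U))
                    (vfield_coord X i).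

Definition smooth_vfield_at (x : M) (X : vfield) : Prop :=
  exists U, [/\ open U, U x & smooth_vfield U X].

Definition act_on_fun (x : M) (v : tangent x) (f : M -> R) : R :=
  'D_v (f \o param (atlas (at_ x)) : 'cV[R]_m -> R^o) (coord (atlas (at_ x)) x).

Definition bracket (X Y : vfield) : vfield := fun x =>
  'D_(X x) (vfield_coord Y (at_ x)) (coord (atlas (at_ x)) x)
  - 'D_(Y x) (vfield_coord X (at_ x)) (coord (atlas (at_ x)) x).

(* [nabla x v Y] is the covariant derivative at [x] of [Y] in the direction
   [v]; only its values on fields [Y] that are smooth near [x] matter. *)
Record is_connection (nabla : forall x : M, tangent x -> vfield -> tangent x)
    : Prop := {
  connection_linear : forall x (c : R) (u v : 'cV[R]_m) Y,
    smooth_vfield_at x Y ->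
    nabla x (c *: u + v) Y = c *: (nabla x u Y : 'cV[R]_m) + nabla x v Y;
  connection_add : forall x v Y Z,
    smooth_vfield_at x Y -> smooth_vfield_at x Z ->
    nabla x v (fun y => (Y y : 'cV[R]_m) + Z y)
      = (nabla x v Y : 'cV[R]_m) + nabla x v Z;
  connection_leibniz : forall x v (f : M -> R) Y (U : set M),
    open U -> U x -> smooth_fun U f -> smooth_vfield U Y ->
    nabla x v (fun y => f y *: (Y y : 'cV[R]_m))
      = act_on_fun v f *: (Y x : 'cV[R]_m) + f x *: (nabla x v Y : 'cV[R]_m);
  connection_local : forall x v Y Z (U : set M),
    open U -> U x -> smooth_vfield U Y -> (forall y, U y -> Y y = Z y) ->
    nabla x v Y = nabla x v Z;
  connection_smooth : forall X Y (U : set M),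
    open U -> smooth_vfield U X -> smooth_vfield U Y ->
    smooth_vfield U (fun y => nabla y (X y) Y) }.

(* A frame p : V -> T_xM with V = R^m is an invertible matrix, since T_xM is
   identified with R^m. *)
Definition local_section (P : M -> set 'M[R]_m) (U : set M) (s : M -> 'M[R]_m)
    : Prop :=
  [/\ open U, forall y, U y -> P y (s y)
    & forall w : 'cV[R]_m, smooth_vfield U (fun y => s y *m w)].

Record is_structure (G : set 'M[R]_m) (P : M -> set 'M[R]_m) : Prop := {
  structure_frame : forall x p, P x p -> p \in unitmx;
  structure_act : forall x p g, P x p -> G g -> P x (p *m g);
  structure_transitive : forall x p q,
    P x p -> P x q -> exists2 g, G g & q = p *m g;
  structure_section : forall x, exists U s, local_section P U s /\ U x }.

End Calculus.

(* The class of [A] in gl_m / g. *)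
Definition gl_class (R : realType) (m : nat) (g : set 'M[R]_m) (A : 'M[R]_m)
    : set 'M[R]_m := [set A + B | B in g].

(* Conjugation by [p], on subsets of gl_m: it computes both Ad_p(g) and the
   map induced by Ad_p from gl_m / g to gl_m / Ad_p(g). *)
Definition Ad_set (R : realType) (m : nat) (p : 'M[R]_m) (C : set 'M[R]_m)
    : set 'M[R]_m := [set p *m A *m invmx p | A in C].

Record affine_manifold (R : realType) (m : nat) (G : set 'M[R]_m) :=
  AffineManifold {
    base :> manifold R m;
    nabla : forall x : base, tangent x -> vfield base -> tangent x;
    structure : base -> set 'M[R]_m;
    nabla_connection : is_connection nabla;
    structureP : is_structure G structure }.

Arguments structure {R m G} _ _ _.

Section Homogeneity.
Variables (R : realType) (m : nat) (G g : set 'M[R]_m).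
Variable M : affine_manifold G.
Let V := 'cV[R]_m.

Definition torsion (X Y : vfield M) : vfield M := fun x =>
  (nabla (X x) Y : V) - nabla (Y x) X - bracket X Y x.

Definition curvature (X Y Z : vfield M) : vfield M := fun x =>
  (nabla (X x) (fun y => nabla (Y y) Z) : V)
  - nabla (Y x) (fun y => nabla (X y) Z)
  - nabla (bracket X Y x : tangent x) Z.

(* The matrix of Lambda^s_x(u): its j-th column is the image of e_j. *)
Definition Lambda (s : M -> 'M[R]_m) (x : M) (u : V) : 'M[R]_m :=
  \matrix_(i, j)
    (invmx (s x) *m
      (nabla (s x *m u : tangent x) (fun y => s y *m delta_mx j 0) : V)) i 0.

(* The class of s(x) Lambda^s_x(u) s(x)^-1 modulo g_x, where v = s(x) u; it
   does not depend on the local section s around x, so that the union over all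
   of them is that class. *)
Definition inner_torsion (x : M) (v : tangent x) : set 'M[R]_m :=
  [set A | exists U s, [/\ local_section (structure M) U s, U x
    & Ad_set (s x) (gl_class g (Lambda s x (invmx (s x) *m v))) A]].

End Homogeneity.

Definition alternating_bilinear (R : realType) (m : nat) (W : lmodType R)
    (F : 'cV[R]_m -> 'cV[R]_m -> W) : Prop :=
  (forall c u u' v, F (c *: u + u') v = c *: F u v + F u' v) /\
  (forall u v, F u v = - F v u).

Definition linear_to_quotient (R : realType) (m : nat) (g : set 'M[R]_m)
    (I0 : 'cV[R]_m -> set 'M[R]_m) : Prop :=
  (forall u, exists A, I0 u = gl_class g A) /\
  (forall c u v A B, I0 u = gl_class g A -> I0 v = gl_class g B ->
     I0 (c *: u + v) = gl_class g (c *: A + B)).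

(* [M] is infinitesimally homogeneous with characteristic tensors T0, R0, I0.
   The values T_x(v, w) and R_x(v, w)z are computed on arbitrary extensions of
   the tangent vectors to vector fields that are smooth near x. *)
Record characteristic_tensors (R : realType) (m : nat) (G g : set 'M[R]_m)
    (M : affine_manifold G) (T0 : 'cV[R]_m -> 'cV[R]_m -> 'cV[R]_m)
    (R0 : 'cV[R]_m -> 'cV[R]_m -> 'M[R]_m) (I0 : 'cV[R]_m -> set 'M[R]_m)
    : Prop := {
  T0_form : alternating_bilinear T0;
  R0_form : alternating_bilinear R0;
  I0_linear : linear_to_quotient g I0;
  torsionE : forall (x : M) p u v (X Y : vfield M), structure M x p ->
    smooth_vfield_at x X -> smooth_vfield_at x Y ->
    X x = p *m u -> Y x = p *m v ->
    torsion X Y x = p *m T0 u v;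
  curvatureE : forall (x : M) p u v w (X Y Z : vfield M), structure M x p ->
    smooth_vfield_at x X -> smooth_vfield_at x Y -> smooth_vfield_at x Z ->
    X x = p *m u -> Y x = p *m v -> Z x = p *m w ->
    curvature X Y Z x = p *m (R0 u v *m w);
  inner_torsionE : forall (x : M) p u, structure M x p ->
    inner_torsion g (p *m u : tangent x) = Ad_set p (I0 u) }.

Section Model.
Variables (R : realType) (n : nat).
Let H0 := 'cV[R]_(n + n).

Definition h0 (X Y : H0) : R := (X^T *m Y) 0 0.

(* R^2n = C^n with coordinates (Re z, Im z). *)
Definition J0 : 'M[R]_(n + n) := block_mx 0 (- 1%:M) 1%:M 0.

Definition omega0 (X Y : H0) : R := h0 (J0 *m X) Y.

Definition flat (Z : H0) : 'rV[R]_(n + n) := Z^T.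

Definition e : 'cV[R]_(n + n + 1) := col_mx 0 1%:M.

Definition inH (X : H0) : 'cV[R]_(n + n + 1) := col_mx X 0.

Definition Un : set 'M[R]_(n + n) :=
  [set A | A^T *m A = 1%:M /\ A *m J0 = J0 *m A].

Definition un : set 'M[R]_(n + n) :=
  [set A | A^T = - A /\ A *m J0 = J0 *m A].

Definition Un1 : set 'M[R]_(n + n + 1) := [set block_mx A 0 0 1%:M | A in Un].

Definition un0 : set 'M[R]_(n + n + 1) := [set block_mx A 0 0 0 | A in un].

Definition K (X Y Z : H0) : H0 :=
  4^-1 *: (h0 Y Z *: X - h0 X Z *: Y
           + omega0 Y Z *: (J0 *m X) - omega0 X Z *: (J0 *m Y)
           - (2 * omega0 X Y) *: (J0 *m Z)).

Definition has_curvature_form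
    (R0 : 'cV[R]_(n + n + 1) -> 'cV[R]_(n + n + 1) -> 'M[R]_(n + n + 1))
    (c0 c1 c2 c3 c4 : R) (B : H0 -> H0 -> 'M[R]_(n + n)) : Prop :=
  [/\ alternating_bilinear R0,
      forall X : H0, R0 (inH X) e =
        block_mx 0 (c1 *: X + c2 *: (J0 *m X))
                 (flat (c3 *: X + c4 *: (J0 *m X))) 0
    & forall X Y : H0, R0 (inH X) (inH Y) =
        block_mx (B X Y) 0 0 (c0 * omega0 X Y)%:M].

End Model.

Arguments J0 {R n}.
Arguments e {R n}.

(* Main.v *)
From HB Require Import structures.
Require Import Defs.
From mathcomp Require Import all_boot all_order all_algebra.
From mathcomp Require Import all_classical all_reals all_analysis.
From mathcomp Require Import ring lra.
Import Order.TTheory GRing.Theory Num.Theory.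
Import numFieldNormedType.Exports.
Set Implicit Arguments.
Unset Strict Implicit.
Unset Printing Implicit Defensive.
Local Open Scope classical_set_scope.
Local Open Scope ring_scope.

(** Put mu = tau1 - alpha + a, nu = tau2 - beta and sig = tau3 - 2 delta; the
    condition of the theorem is sig * mu = 0.  The linear lift lam of I0 is
    equivariant under G = U(n) x 1, and T0 u v = Tm u v + lam u v - lam v u, where
    Tm is the equivariant torsion with parameters mu, nu, sig ([Tm_of_T0]).
    Subtracting the tensor lam from the connection therefore yields a connection
    that preserves the G-structure, has torsion Tm, and has curvature
    R1 u v = R0 u v - lam (Tm u v) - [lam u, lam v].  Everything rests on the
    following classification ([realizedP]): R0 occurs if and only if sig * mu = 0
    and R1 = Rm1, where Rm1 (X, Y) = k K(X, Y) - sig nu omega0(X, Y) J0 on H0,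
    Rm1 (X, e) = 0, and k is a real number with k * mu = 0.  The formulas of the
    theorem are then the blocks of Rm1 + lam o Tm + [lam, lam] ([Rm_inH_e],
    [Rm_inH]).

    Necessity.  In a chart and a local section of the structure, the connection
    becomes a matrix S of frame fields and a family A of u(n)-valued coefficients
    that satisfy the structure equations ([structure_equations], [local_model]).
    The curvature R1 takes its values in u(n), is U(n)-equivariant, and satisfies
    the algebraic first Bianchi identity R1 = Tm o Tm summed cyclically, because
    Tm is parallel ([first_bianchi]).  Equivariance under -1 in U(n) gives
    R1 (X, e) = 0, and the Bianchi identity on (X, J0 X, e) gives sig * mu = 0
    ([sig_mu]).  On H0, R1 + sig nu omega0 J0 is a U(n)-invariant curvature tensor
    of Kahler type, hence a multiple k of K, since U(n) is transitive on spheres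
    ([invariant_kahler_curvature]).  Finally the 1-form tr (J A) has exterior
    derivative tr (J R1), a multiple of omega0; this 2-form is closed
    ([closed_two_form]), and evaluating its differential on (X, J0 X, e) gives
    k * mu = 0 ([necessity]).

    Sufficiency.  It is enough to exhibit S and A on an open subset of V: the
    connection with coefficients lam + A in the frame S, and the structure S U(n),
    then have the required tensors ([model_tensors], [model_from_frame]).  If
    mu = 0 the model is a line bundle over a complex space form of curvature
    governed by k, with connection form proportional to sig
    ([sf_frame_torsion], [sf_conn_curvature]); if mu <> 0 then sig = k = 0 and a
    frame that is a scalar multiple of the constant one works
    ([cone_frame_torsion], [cone_conn_curvature]). *)

(** * Smooth maps between normed spaces *)

Lemma nbhs_open {T : topologicalType} (U : set T) x : open U -> U x -> nbhs x U.
Proof. by move=> oU Ux; apply: open_nbhs_nbhs. Qed.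

Section Smooth.
Context {R : realType} {V W : normedModType R}.
Implicit Types (U : set V) (f g : V -> W).

Lemma derive_eq_on U f g v x : open U -> U x -> {in U, f =1 g} ->
  'D_v f x = 'D_v g x.
Proof.
move=> oU Ux fg; apply: near_eq_derive.
by apply: filterS (nbhs_open oU Ux) => y Uy; apply: fg; rewrite inE.
Qed.

Lemma derivable_eq_on U f g v x : open U -> U x -> {in U, f =1 g} ->
  derivable f x v -> derivable g x v.
Proof.
move=> oU Ux fg; apply: near_eq_derivable.
by apply: filterS (nbhs_open oU Ux) => y Uy; apply: fg; rewrite inE.
Qed.

Lemma C_k_eq_on k U f g : open U -> {in U, f =1 g} -> C_k k U f -> C_k k U g.
Proof.
move=> oU; elim: k f g => [|k IH] f g fg [cf df]; split.
- move=> x Ux; have fxg : \forall y \near x, f y = g y.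
    by apply: filterS (nbhs_open oU Ux) => y Uy; apply: fg; rewrite inE.
  have E := nbhs_singleton fxg.
  by apply: cvg_trans (near_eq_cvg fxg) _; rewrite -E; exact: cf.
- by [].
- move=> x Ux; have fxg : \forall y \near x, f y = g y.
    by apply: filterS (nbhs_open oU Ux) => y Uy; apply: fg; rewrite inE.
  have E := nbhs_singleton fxg.
  by apply: cvg_trans (near_eq_cvg fxg) _; rewrite -E; exact: cf.
- move=> v; have [dfv cfv] := df v; split.
    by move=> x Ux; apply: (derivable_eq_on oU Ux fg); apply: dfv.
  apply: IH cfv => x; rewrite inE => Ux; exact: derive_eq_on fg.
Qed.

Lemma C_infty_eq_on U f g : open U -> {in U, f =1 g} ->
  C_infty U f -> C_infty U g.
Proof. by move=> oU fg sf k; apply: C_k_eq_on (sf k). Qed.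

Lemma C_k_sub k U U' f : U' `<=` U -> C_k k U f -> C_k k U' f.
Proof.
move=> sU; elim: k f => [|k IH] f [cf df]; split=> //; try by move=> x /sU /cf.
by move=> v; have [dv cv] := df v; split; [move=> x /sU /dv | apply: IH].
Qed.

Lemma C_infty_sub U U' f : U' `<=` U -> C_infty U f -> C_infty U' f.
Proof. by move=> sU sf k; apply: C_k_sub (sf k). Qed.

Lemma C_infty_continuous U f x : C_infty U f -> U x -> {for x, continuous f}.
Proof. by move=> /(_ 0%N) [cf _]; apply: cf. Qed.

Lemma C_infty_derivable U f x v : C_infty U f -> U x -> derivable f x v.
Proof. by move=> /(_ 1%N) [_ /(_ v) [df _]]; apply: df. Qed.

Lemma C_infty_derive U f v : C_infty U f -> C_infty U (fun x => 'D_v f x).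
Proof. by move=> sf k; have [_ /(_ v) []] := sf k.+1. Qed.

(** Coinduction principle: a class of continuous functions that is stable under
    directional derivatives consists of smooth functions.  It replaces inductions on
    the order of differentiability below. *)
Lemma C_infty_coind (P : (V -> W) -> Prop) U : open U ->
  (forall f, P f -> (forall x, U x -> {for x, continuous f}) /\
    forall v, (forall x, U x -> derivable f x v) /\
      exists2 g, P g & {in U, g =1 fun x => 'D_v f x}) ->
  forall f, P f -> C_infty U f.
Proof.
move=> oU HP f Pf k; elim: k f Pf => [|k IH] f /HP [cf df]; split=> // v.
have [dfv [g Pg gE]] := df v; split=> //.
exact: C_k_eq_on gE (IH _ Pg).
Qed.

Lemma C_infty_cst U (c : W) : open U -> C_infty U (cst c).
Proof.
move=> oU; apply: (C_infty_coind (P := fun f => exists c, f = cst c)) => //; last by exists c.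
move=> _ [{}c ->]; split=> [x _|v]; first exact: cst_continuous.
split=> [x _|]; first exact: derivable_cst.
exists (cst 0); first by exists 0.
by move=> x _; rewrite derive_cst.
Qed.

End Smooth.

Section SmoothScalar.
Context {R : realType} {V : normedModType R}.
Implicit Types (U : set V) (f g : V -> R).

(** Functions obtained from smooth ones by field operations.  By the rules for
    derivatives this class is closed under differentiation, so that
    [C_infty_coind] applies to it. *)
Inductive field_closure U : (V -> R^o) -> Prop :=
| FcBase f : C_infty U (f : V -> R^o) -> field_closure U f
| FcAdd f g : field_closure U f -> field_closure U g ->
    field_closure U (fun x => f x + g x)
| FcMul f g : field_closure U f -> field_closure U g ->
    field_closure U (fun x => f x * g x)
| FcInv f : field_closure U f -> (forall x, U x -> f x != 0) ->
    field_closure U (fun x => (f x)^-1).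

Lemma field_closure_smooth U f : open U -> field_closure U f ->
  C_infty U (f : V -> R^o).
Proof.
move=> oU; apply: C_infty_coind => // {}f; elim=> {f}.
- move=> f sf; split=> [x Ux|v]; first exact: C_infty_continuous Ux.
  split=> [x Ux|]; first exact: C_infty_derivable Ux.
  by exists (fun x => 'D_v f x) => //; apply: FcBase; apply: C_infty_derive.
- move=> f g Pf [cf df] Pg [cg dg]; split=> [x Ux|v].
    by apply: cvgD; [exact: cf|exact: cg].
  have [dfv [f' Pf' Ef]] := df v; have [dgv [g' Pg' Eg]] := dg v.
  split=> [x Ux|]; first by apply: derivableD; [exact: dfv|exact: dgv].
  exists (fun x => f' x + g' x); first exact: FcAdd.
  move=> x; move=> xU; rewrite Ef // Eg //; move: xU; rewrite inE => Ux.
  by rewrite deriveD //; [exact: dfv|exact: dgv].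
- move=> f g Pf [cf df] Pg [cg dg]; split=> [x Ux|v].
    by apply: cvgM; [exact: cf|exact: cg].
  have [dfv [f' Pf' Ef]] := df v; have [dgv [g' Pg' Eg]] := dg v.
  split=> [x Ux|]; first by apply: derivableM; [exact: dfv|exact: dgv].
  exists (fun x => f x * g' x + g x * f' x).
    by apply: FcAdd; apply: FcMul.
  move=> x; move=> xU; rewrite Ef // Eg //; move: xU; rewrite inE => Ux.
  by rewrite (deriveM (dfv _ Ux) (dgv _ Ux)).
- move=> f Pf [cf df] f0; split=> [x Ux|v].
    by apply: cvgV; [exact: f0|exact: cf].
  have [dfv [f' Pf' Ef]] := df v.
  split=> [x Ux|]; first by apply: derivableV; [exact: f0|exact: dfv].
  exists (fun x => -1 * ((f x)^-1 * (f x)^-1 * f' x)).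
    apply: FcMul; first by apply: FcBase; exact: C_infty_cst.
    by apply: FcMul => //; apply: FcMul; apply: FcInv.
  move=> x; move=> xU; rewrite Ef //; move: xU; rewrite inE => Ux.
  rewrite deriveV //; [|exact: f0|exact: dfv].
  by rewrite mulN1r /GRing.scale /= mulNr expr2 invfM.
Qed.

Lemma smoothD U f g : open U -> C_infty U (f : V -> R^o) ->
  C_infty U (g : V -> R^o) -> C_infty U ((fun x => f x + g x) : V -> R^o).
Proof. by move=> oU sf sg; apply: field_closure_smooth => //; apply: FcAdd; apply: FcBase. Qed.

Lemma smoothM U f g : open U -> C_infty U (f : V -> R^o) ->
  C_infty U (g : V -> R^o) -> C_infty U ((fun x => f x * g x) : V -> R^o).
Proof. by move=> oU sf sg; apply: field_closure_smooth => //; apply: FcMul; apply: FcBase. Qed.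

Lemma smoothV U f : open U -> C_infty U (f : V -> R^o) ->
  (forall x, U x -> f x != 0) -> C_infty U ((fun x => (f x)^-1) : V -> R^o).
Proof. by move=> oU sf f0; apply: field_closure_smooth => //; apply: FcInv => //; apply: FcBase. Qed.

Lemma smooth_sum U I (r : seq I) (P : pred I) (F : I -> V -> R) : open U ->
  (forall i, P i -> C_infty U (F i : V -> R^o)) ->
  C_infty U ((fun x => \sum_(i <- r | P i) F i x) : V -> R^o).
Proof.
move=> oU sF; elim: r => [|i r IH].
  by rewrite (_ : (fun _ => _) = cst 0); [exact: C_infty_cst|apply/funext=> x; rewrite big_nil].
case: (boolP (P i)) => Pi.
  rewrite (_ : (fun _ => _) = fun x => F i x + \sum_(j <- r | P j) F j x).
    by apply: smoothD => //; exact: sF.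
  by apply/funext=> x; rewrite big_cons Pi.
rewrite (_ : (fun _ => _) = fun x => \sum_(j <- r | P j) F j x) //.
by apply/funext=> x; rewrite big_cons (negPf Pi).
Qed.

Lemma smooth_prod U I (r : seq I) (P : pred I) (F : I -> V -> R) : open U ->
  (forall i, P i -> C_infty U (F i : V -> R^o)) ->
  C_infty U ((fun x => \prod_(i <- r | P i) F i x) : V -> R^o).
Proof.
move=> oU sF; elim: r => [|i r IH].
  by rewrite (_ : (fun _ => _) = cst 1); [exact: C_infty_cst|apply/funext=> x; rewrite big_nil].
case: (boolP (P i)) => Pi.
  rewrite (_ : (fun _ => _) = fun x => F i x * \prod_(j <- r | P j) F j x).
    by apply: smoothM => //; exact: sF.
  by apply/funext=> x; rewrite big_cons Pi.
rewrite (_ : (fun _ => _) = fun x => \prod_(j <- r | P j) F j x) //.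
by apply/funext=> x; rewrite big_cons (negPf Pi).
Qed.

End SmoothScalar.

(** * Matrix-valued maps and the mean value theorem along lines *)

Section SmoothMx.
Context {R : realType} {V : normedModType R} {p q : nat}.
Implicit Types (U : set V) (F : V -> 'M[R]_(p, q)).

Lemma continuous_mx F x :
  (forall i j, {for x, continuous (fun y => F y i j : R^o)}) -> {for x, continuous F}.
Proof.
move=> cF; apply/cvg_ballP => e e0.
have : \forall y \near x, forall i j, ball (F x i j) e (F y i j).
  apply: filter_forall => i; apply: filter_forall => j.
  by move/cvg_ballP: (cF i j); apply.
by apply: filterS => y Hy.
Qed.

(** Both directions are coinductive: the entries of a directional derivative are
    the directional derivatives of the entries. *)
Lemma smooth_mxP U F : open U ->
  C_infty U F <-> forall i j, C_infty U (fun y => F y i j : R^o).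
Proof.
move=> oU; split=> [sF i j|].
  apply: (C_infty_coind (P := fun f : V -> R^o => exists2 F : V -> 'M[R]_(p, q), C_infty U F & f = fun y => F y i j)) => //; last by exists F.
  move=> _ {sF}[{}F sF ->]; split=> [x Ux|v].
    apply: (@continuous_comp _ _ _ F (fun M : (matrix R p q) => M i j)).
      exact: C_infty_continuous Ux.
    exact: coord_continuous.
  split=> [x Ux|].
    by move: i j; apply/derivable_mxP; exact: C_infty_derivable Ux.
  exists (fun y => ('D_v F y) i j).
    by exists (fun y => 'D_v F y) => //; exact: C_infty_derive.
  move=> x; rewrite inE => Ux; rewrite derive_mx ?mxE //.
  exact: C_infty_derivable Ux.
move=> sF; apply: (C_infty_coind (P := fun F => forall i j, C_infty U (fun y => F y i j : R^o))) => //.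
move=> {sF}{}F sF; split=> [x Ux|v].
  by apply: continuous_mx => i j; exact: C_infty_continuous Ux.
have dF x : U x -> derivable F x v.
  by move=> Ux; apply/derivable_mxP => i j; exact: C_infty_derivable Ux.
split=> //.
exists (fun y => 'D_v F y) => // i j.
apply: (C_infty_eq_on (f := fun y => 'D_v (fun y => F y i j : R^o) y)) => //.
  by move=> x; rewrite inE => Ux; rewrite derive_mx ?mxE //; exact: dF.
exact: C_infty_derive.
Qed.

End SmoothMx.

Section Lines.
Context {R : realType} {V : normedModType R}.
Implicit Types (f : V -> R).

Lemma is_derive_line f x v t : derivable f (x + t *: v) v ->
  is_derive t 1 (fun s : R => f (x + s *: v)) ('D_v f (x + t *: v)).
Proof.
move=> df.
have E : (fun h : R => h^-1 *: (((fun s : R => f (x + s *: v)) \o shift t) (h *: (1:R)) - f (x + t *: v)))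
  = (fun h : R => h^-1 *: ((f \o shift (x + t *: v)) (h *: v) - f (x + t *: v))).
  apply/funext => h /=; congr (_ *: (f _ - _)).
  by rewrite [h *: 1]mulr1 scalerDl addrCA addrA addrAC.
split; first by rewrite /derivable E.
by rewrite /derive E.
Qed.

Lemma derivable_line f x v : derivable f x v ->
  is_derive (0:R) 1 (fun s : R => f (x + s *: v)) ('D_v f x).
Proof. by move=> df; have := @is_derive_line f x v 0; rewrite scale0r addr0; apply. Qed.

(** The one-variable mean value theorem for s |-> f (x + s v). *)
Lemma MVT_line f x v : (forall s : R, 0 <= s <= 1 -> derivable f (x + s *: v) v) ->
  exists2 c : R, 0 <= c <= 1 & f (x + v) - f x = 'D_v f (x + c *: v).
Proof.
move=> df.
pose g (s : R) : R := f (x + s *: v); pose dg (s : R) : R := 'D_v f (x + s *: v).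
have dfl (s : R) : s \in `[0, 1] -> is_derive s 1 g (dg s).
  by move=> s01; apply: is_derive_line; apply: df; move: s01; rewrite in_itv.
have d1 : {in `]0, 1[%R, forall s : R, is_derive s 1 g (dg s)}.
  move=> s s01; apply: dfl; move: s01; rewrite !in_itv /= => /andP[s0 s1].
  by rewrite !ltW.
have gc : {within `[(0 : R), 1], continuous g}.
  by apply: derivable_within_continuous => s s01; case: (dfl _ s01).
have [c] := MVT_segment ler01 d1 gc.
rewrite in_itv /= /g scale1r scale0r addr0 subr0 mulr1 => c01 E; by exists c.
Qed.

Lemma is_derive_scale f x v (c : R) : derivable f x v ->
  is_derive x (c *: v) f (c * 'D_v f x).
Proof.
move=> df; have := derivable_line df => D.
have D2 : is_derive (0:R) 1 (fun s : R => f (x + s *: (c *: v))) (c * 'D_v f x).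
  have -> : (fun s : R => f (x + s *: (c *: v))) = (fun s => f (x + s *: v)) \o (fun s => s * c).
    by apply/funext => s /=; rewrite scalerA.
  rewrite mulrC.
  have Dc : is_derive (0 : R) 1 (fun s : R => s * c) c.
    have := is_deriveM (is_derive_id (0 : R) (1 : R)) (is_derive_cst c (0 : R) (1 : R)).
    by move=> H; apply: is_derive_eq H _; rewrite scaler0 add0r [c *: 1]mulr1.
  have := @is_derive1_comp R (fun s => f (x + s *: v)) (fun s => s * c) 0 ('D_v f x) c.
  by rewrite mul0r; apply.
have E : (fun h : R => h^-1 *: (((fun s : R => f (x + s *: (c *: v))) \o shift 0) (h *: (1:R)) - f (x + 0 *: (c *: v))))
  = (fun h : R => h^-1 *: ((f \o shift x) (h *: (c *: v)) - f x)).
  apply/funext => h /=; congr (_ *: (f _ - f _)); last by rewrite scale0r addr0.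
  by rewrite [h *: 1]mulr1 addr0 addrC.
case: D2; rewrite /derivable /derive E => D2 D3; by split.
Qed.

End Lines.

Lemma differentiable_eps {R : realType} {V W : normedModType R} (f : V -> W)
    (df : {linear V -> W}) x : continuous df ->
  (forall e : R, 0 < e -> \forall h \near (0 : V), `|f (h + x) - f x - df h| <= e * `|h|) ->
  differentiable f x /\ ('d f x = df :> (V -> W)).
Proof.
move=> cdf H.
have LE : f \o shift x = cst (f x) + df +o_ 0 id.
  apply/eqaddoP => e e0; apply: filterS (H e e0) => h.
  by rewrite !fctE /= opprD addrA.
have dE := diff_unique cdf LE.
by split=> //; apply/diff_locallyP; rewrite dE.
Qed.

Section Differentiable.
Context {R : realType} {m : nat}.
Local Notation V := 'cV[R]_m.
Implicit Types (U : set V) (f : V -> R).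

Lemma normr_coord_le (h : V) k : `|h k 0| <= `|h|.
Proof.
rewrite [leRHS]/Num.Def.normr /= mx_normrE.
exact: (le_bigmax _ (fun i : 'I_m * 'I_1 => `|h i.1 i.2|) (k, 0)).
Qed.

Lemma cV_normP (h : V) (e : R) : 0 <= e -> (forall k, `|h k 0| <= e) -> `|h| <= e.
Proof.
move=> e0 He; rewrite [leLHS]/Num.Def.normr /= mx_normrE.
by apply: bigmax_le => // -[i j] _ /=; rewrite ord1.
Qed.

Let E (k : 'I_m) : V := delta_mx k 0.

Let dlin_def f x : V -> R := fun h => \sum_k h k 0 * 'D_(E k) f x.

Let dlin_linear f x : linear (dlin_def f x).
Proof.
move=> a u v; rewrite /dlin_def scaler_sumr -big_split /=.
by apply: eq_bigr => k _; rewrite !mxE mulrDl -mulrA.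
Qed.

(** Going from x to x + h one coordinate at a time, the mean value theorem writes
    f (x + h) - f x as a sum of partial derivatives at nearby points; their continuity
    makes the error o(h). *)
Lemma C1_differentiable U f x : open U -> U x -> C_k (W := R^o) 1 U f ->
  differentiable (f : V -> R^o) x /\
  forall v, 'D_v f x = \sum_k v k 0 * 'D_(E k) f x.
Proof.
move=> oU Ux [_ df].
have [L EL] : exists L : {linear V -> R^o}, (L : V -> R) = dlin_def f x.
  exists (HB.pack_for {linear V -> R^o} (dlin_def f x)
    (GRing.isLinear.Build _ _ _ _ (dlin_def f x : V -> R^o) (@dlin_linear f x))).
  by [].
have Lc : continuous (L : V -> R^o).
  rewrite EL /dlin_def.
  apply: (@continuous_big R^o 'I_m +%R 0 xpredT) => [|k _ y].
    exact: add_continuous.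
  apply: (@continuousM R V (fun h : V => h k 0) (fun=> 'D_(E k) f x) y).
    exact: coord_continuous.
  exact: cst_continuous.
suff [dfx dE] : differentiable (f : V -> R^o) x /\ ('d (f : V -> R^o) x = L :> (V -> R^o)).
  by split=> // v; rewrite deriveE // dE EL.
apply: differentiable_eps => // e e0.
  pose e' := e / m.+1%:R.
  have e'0 : 0 < e' by rewrite divr_gt0.
  have Hk : \forall y \near x, forall k : 'I_m, `|'D_(E k) f x - 'D_(E k) f y| < e'.
    apply: (@filter_forall _ _ _ (nbhs x) (nbhs_filter x)) => k; have [_ [ck _]] := df (E k).
    by move/cvgrPdist_lt: (ck _ Ux); apply.
  have : \forall y \near x, U y /\ forall k : 'I_m, `|'D_(E k) f x - 'D_(E k) f y| < e'.
    by apply: filterI Hk; exact: nbhs_open.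
  move=> /nbhs_ballP [r /= r0 Hr].
  near=> h.
  have hr : `|h| < r by near: h; exact: (@nbhs0_lt R V r r0).
  have Hb y : `|y| <= `|h| -> U (x + y) /\ forall k, `|'D_(E k) f x - 'D_(E k) f (x + y)| < e'.
    move=> yh; apply: Hr; rewrite mx_norm_ball /ball_ /=.
    by rewrite opprD addNKr normrN; exact: le_lt_trans hr.
  pose P k : V := \col_i (if (i < k)%N then h i 0 else 0).
  have P0 : P 0%N = 0 by apply/colP => i; rewrite !mxE.
  have Pm : P m = h by apply/colP => i; rewrite !mxE ltn_ord.
  have PS (k : 'I_m) : P k.+1 = P k + h k 0 *: E k.
    apply/colP => i; rewrite !mxE ltnS leq_eqVlt eqxx andbT.
    rewrite -val_eqE /=; case: ltngtP => // [_|_|H]; rewrite ?mulr0 ?addr0 //.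
    by rewrite mulr1 add0r; congr (h _ _); apply/val_inj.
  have step (k : 'I_m) : `|f (x + P k.+1) - f (x + P k) - h k 0 * 'D_(E k) f x| <= e' * `|h|.
    have Pk (s : R) : 0 <= s <= 1 -> `|P k + s *: (h k 0 *: E k)| <= `|h|.
      move=> /andP[s0 s1]; apply: cV_normP => // i; rewrite !mxE eqxx andbT.
      case: (ltnP i k) => ik.
        by rewrite (_ : (i == k) = false) ?mulr0 ?addr0 ?normr_coord_le // -val_eqE /= ltn_eqF.
      rewrite add0r; case: eqP => [_|_]; last by rewrite !mulr0 normr0.
      rewrite mulr1 normrM (ger0_norm s0).
      by rewrite (le_trans _ (normr_coord_le h k)) // ler_piMl.
    have [|c c01] := @MVT_line _ _ f (x + P k) (h k 0 *: E k).
      move=> s s01; rewrite -addrA; have [Uy _] := Hb _ (Pk _ s01).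
      have [dk _] := df (E k).
      by case: (is_derive_scale (h k 0) (dk _ Uy)).
    rewrite -![x + P k + _]addrA -PS => ->; have [Uy Hy] := Hb _ (Pk _ c01).
    have [dk _] := df (E k).
    have [_ ->] := is_derive_scale (h k 0) (dk _ Uy).
    rewrite -mulrBr normrM mulrC ler_pM //; last exact: normr_coord_le.
    by rewrite distrC; apply: ltW.
  have -> : f (h + x) - f x - L h
      = \sum_(k < m) (f (x + P k.+1) - f (x + P k) - h k 0 * 'D_(E k) f x).
    rewrite sumrB.
    have -> : \sum_(k < m) (f (x + P k.+1) - f (x + P k)) = f (x + h) - f x.
      rewrite -(big_mkord xpredT (fun k => f (x + P k.+1) - f (x + P k))).
      by rewrite telescope_sumr // Pm P0 addr0.
    by rewrite EL [h + x]addrC.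
  apply: le_trans (ler_norm_sum _ _ _) _.
  apply: le_trans (ler_sum _ (fun k _ => step k)) _.
  rewrite sumr_const card_ord -mulr_natl mulrA ler_wpM2r //.
  rewrite /e' mulrCA ler_piMr ?(ltW e0) //.
  by rewrite ler_pdivrMr ?mul1r ?ler_nat.
Unshelve. all: by end_near.
Qed.

End Differentiable.

(** * Symmetry of second derivatives *)

Section Schwarz.
Context {R : realType} {V : normedModType R}.
Implicit Types (U : set V) (f : V -> R).

Lemma derive_translate f v u x :
  (derivable (fun y => f (y + v)) x u <-> derivable f (x + v) u) /\
  'D_u (fun y => f (y + v)) x = 'D_u f (x + v).
Proof.
have E : (fun h : R => h^-1 *: (((fun y => f (y + v)) \o shift x) (h *: u) - f (x + v)))
  = (fun h : R => h^-1 *: ((f \o shift (x + v)) (h *: u) - f (x + v))).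
  by apply/funext => h /=; rewrite addrA.
by rewrite /derivable /derive E.
Qed.

(** Two applications of the mean value theorem to the second difference of f on
    the parallelogram spanned by u and v. *)
Lemma second_difference U f u v x : C_infty U (f : V -> R^o) ->
  (forall s t : R, 0 <= s <= 1 -> 0 <= t <= 1 -> U (x + s *: u + t *: v)) ->
  exists s t : R, [/\ 0 <= s <= 1, 0 <= t <= 1 &
    f (x + u + v) - f (x + u) - f (x + v) + f x =
    'D_v (fun y => 'D_u f y) (x + s *: u + t *: v)].
Proof.
move=> sf HU.
have i01 : 0 <= (0 : R) <= 1 by rewrite lexx ler01.
have i11 : 0 <= (1 : R) <= 1 by rewrite lexx ler01.
pose g y := f (y + v) - f y.
have dg s : 0 <= s <= 1 -> derivable (g : V -> R^o) (x + s *: u) u /\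
   'D_u g (x + s *: u) = 'D_u f (x + s *: u + v) - 'D_u f (x + s *: u).
  move=> s01.
  have d1 : derivable (f : V -> R^o) (x + s *: u + v) u.
    by apply: C_infty_derivable sf _; have := HU _ _ s01 i11; rewrite scale1r.
  have d0 : derivable (f : V -> R^o) (x + s *: u) u.
    by apply: C_infty_derivable sf _; have := HU _ _ s01 i01; rewrite scale0r addr0.
  have [t1 t2] := derive_translate f v u (x + s *: u).
  have {}d1 := t1.2 d1.
  split; first exact: (derivableB d1 d0).
  by rewrite -t2; exact: (deriveB d1 d0).
have [|s s01 Es] := @MVT_line _ _ g x u; first by move=> s /dg[].
have [|t t01 Et] := @MVT_line _ _ (fun y => 'D_u f y) (x + s *: u) v.
  by move=> t t01; apply: C_infty_derivable (C_infty_derive u sf) _; exact: HU.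
exists s, t; split=> //; rewrite -Et -(dg _ s01).2 -Es /g.
by rewrite opprB addrA addrAC.
Qed.

(** Schwarz: the second difference is symmetric in u and v, and by
    [second_difference] both mixed derivatives are its limits on parallelograms
    shrinking to x. *)
Lemma derive_comm U f u v x : open U -> U x -> C_infty U (f : V -> R^o) ->
  'D_u (fun y => 'D_v f y) x = 'D_v (fun y => 'D_u f y) x.
Proof.
move=> oU Ux sf.
pose D2 w1 w2 y := 'D_w1 (fun z => 'D_w2 f z) y.
have cD w1 w2 : {for x, continuous (D2 w1 w2 : V -> R^o)}.
  by apply: C_infty_continuous Ux; do 2 apply: C_infty_derive.
have scale2 w1 w2 t y : U y ->
    'D_(t *: w1) (fun y => 'D_(t *: w2) f y) y = t * (t * D2 w1 w2 y).
  move=> Uy; have sw2 := C_infty_derive w2 sf.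
  have [_ <-] := is_derive_scale t (C_infty_derivable (v := w1) sw2 Uy).
  have -> : t * 'D_(t *: w1) (fun y => 'D_w2 f y) y = 'D_(t *: w1) (t \*: (fun y => 'D_w2 f y : R^o)) y.
    by rewrite deriveZ //; exact: C_infty_derivable sw2 Uy.
  apply: (derive_eq_on _ oU Uy) => z; rewrite inE => Uz.
  by have [_ ->] := is_derive_scale t (C_infty_derivable (v := w2) sf Uz).
have : exists2 A : V -> R, A = D2 u v & exists2 B : V -> R, B = D2 v u & True.
  by exists (D2 u v) => //; exists (D2 v u).
rewrite -/(D2 u v x) -/(D2 v u x) => -[A EA [B EB _]].
have scaleA t y : U y -> 'D_(t *: u) (fun y => 'D_(t *: v) f y) y = t * (t * A y).
  by rewrite EA; exact: scale2.
have scaleB t y : U y -> 'D_(t *: v) (fun y => 'D_(t *: u) f y) y = t * (t * B y).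
  by rewrite EB; exact: scale2.
have cA : {for x, continuous (A : V -> R^o)} by rewrite EA; exact: cD.
have cB : {for x, continuous (B : V -> R^o)} by rewrite EB; exact: cD.
rewrite -EA -EB; clear EA EB scale2 cD D2.
apply/eqP; rewrite -subr_eq0 -normr_le0; apply/ler_addgt0Pl => e e0.
rewrite addr0.
have e20 : 0 < e / 2 by rewrite divr_gt0.
have : \forall y \near x, U y /\ (`|A x - A y| < e / 2 /\ `|B x - B y| < e / 2).
  apply: filterI; [exact: nbhs_open|apply: filterI].
    by move/cvgrPdist_lt: cA; apply.
  by move/cvgrPdist_lt: cB; apply.
move=> /nbhs_ballP [r /= r0 Hr].
have n0 : 0 < `|u| + `|v| + 1 by rewrite ltr_wpDl // addr_ge0.
have [t t0 tr] : exists2 t : R, 0 < t & t * (`|u| + `|v| + 1) < r.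
  exists (r / 2 / (`|u| + `|v| + 1)); first by rewrite !divr_gt0.
  by rewrite divfK ?gt_eqF // gtr_pMr // invf_lt1 ?ltr1n.
have Hb (a b : R) : 0 <= a <= 1 -> 0 <= b <= 1 -> ball x r (x + a *: (t *: u) + b *: (t *: v)).
  move=> /andP[a0 a1] /andP[b0 b1].
  rewrite -ball_normE /= -addrA opprD addNKr normrN.
  apply: le_lt_trans (ler_normD _ _) _.
  rewrite !normrZ (ger0_norm a0) (ger0_norm b0). rewrite (gtr0_norm t0).
  apply: le_lt_trans tr; rewrite 2!mulrDr mulr1 -[leLHS]addr0 lerD ?(ltW t0) // lerD //.
    by rewrite ler_piMl // mulr_ge0 // ltW.
  by rewrite ler_piMl // mulr_ge0 // ltW.
have HU1 (a b : R) : 0 <= a <= 1 -> 0 <= b <= 1 -> U (x + a *: (t *: u) + b *: (t *: v)).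
  by move=> /Hb H /H /Hr[].
have HU2 (a b : R) : 0 <= a <= 1 -> 0 <= b <= 1 -> U (x + a *: (t *: v) + b *: (t *: u)).
  by move=> a01 b01; rewrite addrAC; exact: HU1.
have [a [b [a01 b01 E1]]] := second_difference sf HU1.
have [c [d [c01 d01 E2]]] := second_difference sf HU2.
have : f (x + t *: u + t *: v) - f (x + t *: u) - f (x + t *: v) + f x =
       f (x + t *: v + t *: u) - f (x + t *: v) - f (x + t *: u) + f x.
  by rewrite [x + t *: v + t *: u]addrAC [in RHS](addrAC (f _) (- f (x + t *: v))).

rewrite E1 E2 (scaleB _ _ (HU1 _ _ a01 b01)) (scaleA _ _ (HU2 _ _ c01 d01)).
have tN : t != 0 by rewrite gt_eqF.
move=> /(mulfI tN) /(mulfI tN) E.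
have [_ [_ H1]] := Hr _ (Hb _ _ a01 b01).
have Hb2 : ball x r (x + c *: (t *: v) + d *: (t *: u)) by rewrite addrAC; exact: Hb.
have [_ [H2 _]] := Hr _ Hb2.
rewrite E in H1; move: H1 H2; set C := A (x + _ + _) => H1 H2.
have -> : A x - B x = (A x - C) - (B x - C) by rewrite opprB addrA addrNK.
by apply: ltW; apply: le_lt_trans (ler_normB _ _) _; rewrite (splitr e) ltrD.
Qed.

End Schwarz.

(** * Derivatives of matrix-valued maps *)

Section MatrixCalculus.
Context {R : realType} {m : nat}.
Local Notation V := 'cV[R]_m.
Implicit Types (U : set V).

Lemma derive_entry U p q (F : V -> 'M[R]_(p, q)) v x i j : C_infty U F -> U x ->
  ('D_v F x) i j = 'D_v (fun y => F y i j : R^o) x.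
Proof. by move=> sF Ux; rewrite derive_mx ?mxE //; exact: C_infty_derivable sF Ux. Qed.

Lemma smooth_entry U p q (F : V -> 'M[R]_(p, q)) i j : open U -> C_infty U F ->
  C_infty U (fun y => F y i j : R^o).
Proof. by move=> oU sF; move: i j; apply/smooth_mxP. Qed.

Lemma derive_coords U p q (F : V -> 'M[R]_(p, q)) v x : open U -> U x -> C_infty U F ->
  'D_v F x = \sum_k v k 0 *: 'D_(delta_mx k 0) F x.
Proof.
move=> oU Ux sF; apply/matrixP => i j; rewrite (derive_entry _ _ _ sF Ux).
have [_ ->] := C1_differentiable oU Ux (smooth_entry i j oU sF 1%N).
rewrite summxE; apply: eq_bigr => k _; by rewrite mxE (derive_entry _ _ _ sF Ux).
Qed.

Lemma derive_linear U p q (F : V -> 'M[R]_(p, q)) c u v x : open U -> U x -> C_infty U F ->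
  'D_(c *: u + v) F x = c *: 'D_u F x + 'D_v F x.
Proof.
move=> oU Ux sF; rewrite !(derive_coords _ oU Ux sF) scaler_sumr -big_split /=.
by apply: eq_bigr => k _; rewrite !mxE scalerDl scalerA.
Qed.

Lemma derive_subl U p q (F : V -> 'M[R]_(p, q)) u v x : open U -> U x -> C_infty U F ->
  'D_(u - v) F x = 'D_u F x - 'D_v F x.
Proof.
move=> oU Ux sF; have := derive_linear (-1) v u oU Ux sF.
by rewrite !scaleN1r addrC [in RHS]addrC.
Qed.

Lemma smooth_add U p q (F G : V -> 'M[R]_(p, q)) : open U ->
  C_infty U F -> C_infty U G -> C_infty U (fun y => F y + G y).
Proof.
move=> oU sF sG; apply/smooth_mxP => // i j.
apply: (C_infty_eq_on (f := fun y => F y i j + G y i j)) => //.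
  by move=> y _ /=; rewrite mxE.
by apply: smoothD => //; exact: smooth_entry.
Qed.

Lemma smooth_scale U p q (f : V -> R) (F : V -> 'M[R]_(p, q)) : open U ->
  C_infty U (f : V -> R^o) -> C_infty U F -> C_infty U (fun y => f y *: F y).
Proof.
move=> oU sF sG; apply/smooth_mxP => // i j.
apply: (C_infty_eq_on (f := fun y => f y * F y i j)) => //.
  by move=> y _ /=; rewrite mxE.
by apply: smoothM => //; exact: smooth_entry.
Qed.

Lemma smooth_opp U p q (F : V -> 'M[R]_(p, q)) : open U ->
  C_infty U F -> C_infty U (fun y => - F y).
Proof.
move=> oU sF; apply: (C_infty_eq_on (f := fun y => cst (-1) y *: F y)) => //.
  by move=> y _ /=; rewrite scaleN1r.
by apply: smooth_scale => //; exact: C_infty_cst.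
Qed.

Lemma smooth_sub U p q (F G : V -> 'M[R]_(p, q)) : open U ->
  C_infty U F -> C_infty U G -> C_infty U (fun y => F y - G y).
Proof. by move=> oU sF sG; apply: smooth_add => //; exact: smooth_opp. Qed.

Lemma smooth_mulmx U p q r (F : V -> 'M[R]_(p, q)) (G : V -> 'M[R]_(q, r)) : open U ->
  C_infty U F -> C_infty U G -> C_infty U (fun y => F y *m G y).
Proof.
move=> oU sF sG; apply/smooth_mxP => // i j.
apply: (C_infty_eq_on (f := fun y => \sum_k F y i k * G y k j)) => //.
  by move=> y _ /=; rewrite mxE.
by apply: smooth_sum => // k _; apply: smoothM => //; exact: smooth_entry.
Qed.

Lemma smooth_summx U p q (I : Type) (r : seq I) (F : I -> V -> 'M[R]_(p, q)) : open U ->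
  (forall i, C_infty U (F i)) -> C_infty U (fun y => \sum_(i <- r) F i y).
Proof.
move=> oU sF; apply/smooth_mxP => // i j.
apply: (C_infty_eq_on (f := fun y => \sum_(k <- r) F k y i j)) => //.
  by move=> y _ /=; rewrite summxE.
by apply: smooth_sum => // k _; exact: smooth_entry.
Qed.

Lemma smooth_det U p (F : V -> 'M[R]_p) : open U -> C_infty U F ->
  C_infty U ((fun y => \det (F y)) : V -> R^o).
Proof.
move=> oU sF; apply: smooth_sum => // s _; apply: smoothM => //.
  exact: C_infty_cst.
by apply: smooth_prod => // k _; exact: smooth_entry.
Qed.

(** Cramer's rule reduces this to quotients of polynomials in the entries. *)
Lemma smooth_invmx U p (F : V -> 'M[R]_p) : open U -> C_infty U F ->
  (forall y, U y -> F y \in unitmx) -> C_infty U (fun y => invmx (F y)).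
Proof.
move=> oU sF uF.
apply: (C_infty_eq_on (f := fun y => (\det (F y))^-1 *: \adj (F y))) => //.
  by move=> y; rewrite inE => Uy; rewrite /invmx uF.
apply: smooth_scale => //.
  apply: smoothV => //; first exact: smooth_det.
  by move=> y Uy; have := uF y Uy; rewrite unitmxE unitfE.
apply/smooth_mxP => // i j.
apply: (C_infty_eq_on (f := fun y => cofactor (F y) j i)) => //.
  by move=> y _ /=; rewrite mxE.
apply: smoothM => //; first exact: C_infty_cst.
apply: smooth_det => //; apply/smooth_mxP => // k l.
apply: (C_infty_eq_on (f := fun y => F y (lift j k) (lift i l))) => //.
  by move=> y _ /=; rewrite !mxE.
exact: smooth_entry.
Qed.

Lemma smooth_id U : open U -> C_infty U (id : V -> V).
Proof.
move=> oU; apply: (C_infty_coind (P := fun f => f = id \/ exists c, f = cst c)) => //; last by left.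
move=> f [->|[c ->]].
  split=> [x _|v]; first by [].
  split=> [x _|]; first exact: derivable_id.
  exists (cst v); first by right; exists v.
  by move=> x _; rewrite derive_id.
split=> [x _|v]; first exact: cst_continuous.
split=> [x _|]; first exact: derivable_cst.
exists (cst 0); first by right; exists 0.
by move=> x _; rewrite derive_cst.
Qed.

Lemma derive_addmx U p q (F G : V -> 'M[R]_(p, q)) v x : U x ->
  C_infty U F -> C_infty U G -> 'D_v (fun y => F y + G y) x = 'D_v F x + 'D_v G x.
Proof. by move=> Ux sF sG; apply: deriveD; [exact: C_infty_derivable sF Ux|exact: C_infty_derivable sG Ux]. Qed.

Lemma derive_oppmx U p q (F : V -> 'M[R]_(p, q)) v x : U x ->
  C_infty U F -> 'D_v (fun y => - F y) x = - 'D_v F x.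
Proof. by move=> Ux sF; apply: deriveN; exact: C_infty_derivable sF Ux. Qed.

Lemma derive_submx U p q (F G : V -> 'M[R]_(p, q)) v x : U x ->
  C_infty U F -> C_infty U G -> 'D_v (fun y => F y - G y) x = 'D_v F x - 'D_v G x.
Proof. by move=> Ux sF sG; apply: deriveB; [exact: C_infty_derivable sF Ux|exact: C_infty_derivable sG Ux]. Qed.

Lemma derive_sumR U n (F : 'I_n -> V -> R) v x : U x ->
  (forall k, C_infty U (F k : V -> R^o)) ->
  'D_v (fun y => \sum_k F k y) x = \sum_k 'D_v (F k) x.
Proof.
move=> Ux sF.
have -> : (fun y => \sum_k F k y) = \sum_k F k.
  by apply/funext => y; rewrite fct_sumE.
by rewrite derive_sum // => k; exact: C_infty_derivable (sF k) Ux.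
Qed.

Lemma derive_summx U p q n (F : 'I_n -> V -> 'M[R]_(p, q)) v x : U x ->
  (forall k, C_infty U (F k)) ->
  'D_v (fun y => \sum_k F k y) x = \sum_k 'D_v (F k) x.
Proof.
move=> Ux sF.
have -> : (fun y => \sum_k F k y) = \sum_k F k.
  by apply/funext => y; rewrite fct_sumE.
by rewrite derive_sum // => k; exact: C_infty_derivable (sF k) Ux.
Qed.

Lemma derive_mulmx U p q r (F : V -> 'M[R]_(p, q)) (G : V -> 'M[R]_(q, r)) v x :
  open U -> U x -> C_infty U F -> C_infty U G ->
  'D_v (fun y => F y *m G y) x = 'D_v F x *m G x + F x *m 'D_v G x.
Proof.
move=> oU Ux sF sG; apply/matrixP => i j.
rewrite (derive_entry _ _ _ (smooth_mulmx oU sF sG) Ux).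
have -> : (fun y => (F y *m G y) i j) = (fun y => \sum_k F y i k * G y k j).
  by apply/funext => y; rewrite mxE.
rewrite (derive_sumR _ Ux); last first.
  by move=> k; apply: smoothM => //; exact: smooth_entry.
rewrite !mxE -big_split /=; apply: eq_bigr => k _.
have := @deriveM R V (fun y => F y i k) (fun y => G y k j) x v
  (C_infty_derivable (smooth_entry i k oU sF) Ux)
  (C_infty_derivable (smooth_entry k j oU sG) Ux).
move=> E; rewrite [LHS]E [RHS]addrC /GRing.scale /=.
rewrite !(derive_entry _ _ _ sF Ux) !(derive_entry _ _ _ sG Ux).
by congr (_ + _); rewrite mulrC.
Qed.

Lemma derive_scalemx U p q (f : V -> R) (F : V -> 'M[R]_(p, q)) v x :
  open U -> U x -> C_infty U (f : V -> R^o) -> C_infty U F ->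
  'D_v (fun y => f y *: F y) x = 'D_v f x *: F x + f x *: 'D_v F x.
Proof.
move=> oU Ux sf sF; apply/matrixP => i j.
rewrite (derive_entry _ _ _ (smooth_scale oU sf sF) Ux).
have -> : (fun y => (f y *: F y) i j) = (fun y => f y * F y i j).
  by apply/funext => y; rewrite mxE.
have := @deriveM R V f (fun y => F y i j) x v
  (C_infty_derivable sf Ux) (C_infty_derivable (smooth_entry i j oU sF) Ux).
move=> E; rewrite [LHS]E !mxE addrC /GRing.scale /=.
by rewrite !(derive_entry _ _ _ sF Ux); congr (_ + _); rewrite mulrC.
Qed.

Lemma derive_mulmxc U p q r (F : V -> 'M[R]_(p, q)) (B : 'M[R]_(q, r)) v x :
  open U -> U x -> C_infty U F ->
  'D_v (fun y => F y *m B) x = 'D_v F x *m B.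
Proof.
move=> oU Ux sF; rewrite (derive_mulmx _ oU Ux sF (C_infty_cst B oU)).
by rewrite derive_cst mulmx0 addr0.
Qed.

Lemma derive_mulcmx U p q r (B : 'M[R]_(p, q)) (F : V -> 'M[R]_(q, r)) v x :
  open U -> U x -> C_infty U F ->
  'D_v (fun y => B *m F y) x = B *m 'D_v F x.
Proof.
move=> oU Ux sF; rewrite (derive_mulmx _ oU Ux (C_infty_cst B oU) sF).
by rewrite derive_cst mul0mx add0r.
Qed.

Lemma smooth_mulmxc U p q r (F : V -> 'M[R]_(p, q)) (B : 'M[R]_(q, r)) :
  open U -> C_infty U F -> C_infty U (fun y => F y *m B).
Proof. by move=> oU sF; apply: smooth_mulmx => //; exact: C_infty_cst. Qed.

Lemma smooth_mulcmx U p q r (B : 'M[R]_(p, q)) (F : V -> 'M[R]_(q, r)) :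
  open U -> C_infty U F -> C_infty U (fun y => B *m F y).
Proof. by move=> oU sF; apply: smooth_mulmx => //; exact: C_infty_cst. Qed.

Lemma derive_commmx U p q (F : V -> 'M[R]_(p, q)) u v x :
  open U -> U x -> C_infty U F ->
  'D_u (fun y => 'D_v F y) x = 'D_v (fun y => 'D_u F y) x.
Proof.
move=> oU Ux sF; apply/matrixP => i j.
have E a b : ('D_a (fun y => 'D_b F y) x) i j =
    'D_a (fun y => 'D_b (fun y => F y i j : R^o) y) x.
  apply: etrans (derive_entry a i j (C_infty_derive b sF) Ux) _.
  apply: (derive_eq_on _ oU Ux) => y; rewrite inE => Uy.
  exact: derive_entry sF Uy.
apply: etrans (E u v) (etrans _ (esym (E v u))).
exact: derive_comm oU Ux (smooth_entry i j oU sF).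
Qed.

Lemma smooth_derive_field U p q (X : V -> V) (F : V -> 'M[R]_(p, q)) : open U ->
  C_infty U X -> C_infty U F -> C_infty U (fun y => 'D_(X y) F y).
Proof.
move=> oU sX sF.
apply: (C_infty_eq_on (f := fun y => \sum_k X y k 0 *: 'D_(delta_mx k 0) F y)) => //.
  by move=> y; rewrite inE => Uy; rewrite -(derive_coords _ oU Uy sF).
apply: smooth_summx => // k; apply: smooth_scale => //.
  exact: smooth_entry.
exact: C_infty_derive.
Qed.

(** The derivative of y |-> 'D_(X y) F y has one term from X, by linearity in the
    direction, and one from F. *)
Lemma derive_derive_field U p q (X : V -> V) (F : V -> 'M[R]_(p, q)) u x : open U -> U x ->
  C_infty U X -> C_infty U F ->
  'D_u (fun y => 'D_(X y) F y) x = 'D_('D_u X x) F x + 'D_(X x) (fun y => 'D_u F y) x.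
Proof.
move=> oU Ux sX sF.
apply: (etrans (y := 'D_u (fun y => \sum_k X y k 0 *: 'D_(delta_mx k 0) F y) x)).
  apply: (derive_eq_on _ oU Ux) => y; rewrite inE => Uy.
  exact: derive_coords oU Uy sF.
have sXk k := smooth_entry k 0 oU sX.
rewrite (derive_summx _ Ux); last first.
  by move=> k; apply: smooth_scale => //; exact: C_infty_derive.
rewrite (derive_coords ('D_u X x) oU Ux sF).
rewrite (derive_coords (X x) oU Ux (C_infty_derive u sF)) -big_split /=.
apply: eq_bigr => k _.
rewrite (derive_scalemx _ oU Ux (sXk k) (C_infty_derive _ sF)).
exact: (congr2 (fun a b => a *: 'D_(delta_mx k 0) F x + X x k 0 *: b)
  (esym (derive_entry u k 0 sX Ux)) (derive_commmx u (delta_mx k 0) oU Ux sF)).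
Qed.

(** The bracket of two fields acts on functions as a commutator: the second
    derivatives of F cancel by [derive_commmx]. *)
Lemma commutator U p q (X Y : V -> V) (F : V -> 'M[R]_(p, q)) x : open U -> U x ->
  C_infty U X -> C_infty U Y -> C_infty U F ->
  'D_(X x) (fun y => 'D_(Y y) F y) x - 'D_(Y x) (fun y => 'D_(X y) F y) x
  = 'D_('D_(X x) Y x - 'D_(Y x) X x) F x.
Proof.
move=> oU Ux sX sY sF.
have E1 := derive_derive_field (X x) oU Ux sY sF.
have E2 := etrans (derive_derive_field (Y x) oU Ux sX sF)
  (congr1 (fun t => 'D_('D_(Y x) X x) F x + t) (derive_commmx (X x) (Y x) oU Ux sF)).
apply: etrans (congr2 (fun a b => a - b) E1 E2) _.
have aux (a b c : 'M[R]_(p, q)) : a + c - (b + c) = a - b by rewrite opprD addrACA subrr addr0.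
apply: etrans (aux _ _ _) _; symmetry; exact: derive_subl sF.
Qed.

Lemma differentiable_mx U p q (F : V -> 'M[R]_(p, q)) x : open U -> U x -> C_infty U F ->
  differentiable F x.
Proof.
move=> oU Ux sF.
have -> : F = \sum_i \sum_j (fun y => F y i j *: delta_mx i j).
  apply/funext => y; rewrite fct_sumE [LHS]matrix_sum_delta.
  by apply: eq_bigr => i _; rewrite fct_sumE.
apply: differentiable_sum => i; apply: differentiable_sum => j.
apply: differentiableZl.
by have [] := C1_differentiable oU Ux (smooth_entry i j oU sF 1%N).
Qed.

End MatrixCalculus.

Lemma chain_rule {R : realType} {k m p q : nat} (U : set 'cV[R]_k) (U' : set 'cV[R]_m)
    (phi : 'cV[R]_k -> 'cV[R]_m) (F : 'cV[R]_m -> 'M[R]_(p, q)) v x :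
  open U -> open U' -> U x -> U' (phi x) -> C_infty U phi -> C_infty U' F ->
  'D_v (fun y => F (phi y)) x = 'D_('D_v phi x) F (phi x).
Proof.
move=> oU oU' Ux U'x sphi sF.
have dphi := differentiable_mx oU Ux sphi; have dF := differentiable_mx oU' U'x sF.
have dc := differentiable_comp dphi dF.
by rewrite -/(F \o phi) deriveE // diff_comp //= !deriveE.
Qed.

Lemma chain_rule_scalar {R : realType} {k m : nat} (U : set 'cV[R]_k) (U' : set 'cV[R]_m)
    (phi : 'cV[R]_k -> 'cV[R]_m) (f : 'cV[R]_m -> R) v x :
  open U -> open U' -> U x -> U' (phi x) -> C_infty U phi -> C_infty U' (f : _ -> R^o) ->
  'D_v (fun y => f (phi y)) x = 'D_('D_v phi x) f (phi x).
Proof.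
move=> oU oU' Ux U'x sphi sf.
have dphi := differentiable_mx oU Ux sphi.
have [df _] := C1_differentiable oU' U'x (sf 1%N).
have dc := differentiable_comp dphi df.
by rewrite -/((f : _ -> R^o) \o phi) deriveE // diff_comp //= !deriveE.
Qed.

Section LinearFamily.
Variables (R : realType) (m p q : nat) (W : set 'cV[R]_m).
Local Notation V := 'cV[R]_m.
Variable L : V -> 'cV[R]_p -> 'M[R]_(p, q).
Hypothesis linL : forall z c u v, W z -> L z (c *: u + v) = c *: L z u + L z v.
Hypothesis oW : open W.
Hypothesis sL : forall u, C_infty W (fun z => L z u).

(** A family of linear maps is determined by its values on the standard basis;
    this lets the parameter of a smooth family vary with the point. *)
Lemma family_coords z u : W z -> L z u = \sum_k u k 0 *: L z (delta_mx k 0).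
Proof.
move=> Wz.
have L0 : L z 0 = 0.
  have := linL 1 0 0 Wz; rewrite !scale1r addr0 => /eqP.
  by rewrite -subr_eq0 opprD addrA subrr sub0r oppr_eq0 => /eqP.
have Lsum k (c : 'I_k -> R) x : L z (\sum_j c j *: x j) = \sum_j c j *: L z (x j).
  elim: k c x => [|k IH] c x; first by rewrite !big_ord0.
  by rewrite !big_ord_recl linL // IH.
rewrite -Lsum; congr (L z _); rewrite [LHS]matrix_sum_delta.
by apply: eq_bigr => j _; rewrite big_ord1.
Qed.

Lemma smooth_family (U : set V) (eta : V -> 'cV[R]_p) : open U -> U `<=` W -> C_infty U eta ->
  C_infty U (fun z => L z (eta z)).
Proof.
move=> oU UW seta.
apply: (C_infty_eq_on (f := fun z => \sum_k eta z k 0 *: L z (delta_mx k 0))) => //.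
  by move=> z; rewrite inE => /UW Wz; rewrite -family_coords.
apply: smooth_summx => // k; apply: smooth_scale => //; first exact: smooth_entry.
exact: C_infty_sub UW (sL _).
Qed.

Lemma derive_family (U : set V) (eta : V -> 'cV[R]_p) u z : open U -> U `<=` W -> U z ->
  C_infty U eta ->
  'D_u (fun y => L y (eta y)) z = L z ('D_u eta z) + 'D_u (fun y => L y (eta z)) z.
Proof.
move=> oU UW Uz seta; have Wz := UW _ Uz.
have sLU x := C_infty_sub UW (sL x).
have se k := smooth_entry k 0 oU seta.
apply: (etrans (y := 'D_u (fun y => \sum_k eta y k 0 *: L y (delta_mx k 0)) z)).
  by apply: (derive_eq_on _ oU Uz) => y; rewrite inE => /UW Wy; exact: family_coords.
rewrite (derive_summx u Uz (fun k => smooth_scale oU (se k) (sLU (delta_mx k 0)))).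
have -> : 'D_u (fun y => L y (eta z)) z = 'D_u (fun y => \sum_k eta z k 0 *: L y (delta_mx k 0)) z.
  by apply: (derive_eq_on _ oU Uz) => y; rewrite inE => /UW Wy; exact: family_coords.
rewrite (derive_summx u Uz (fun k => smooth_scale oU (C_infty_cst (eta z k 0) oU) (sLU (delta_mx k 0)))).
rewrite family_coords // -big_split /=; apply: eq_bigr => k _.
rewrite (derive_scalemx u oU Uz (se k) (sLU _)).
rewrite (derive_scalemx u oU Uz (C_infty_cst (eta z k 0) oU) (sLU _)).
rewrite (derive_entry u k 0 seta Uz); congr (_ + _).
by rewrite [X in X *: _ + _](derive_cst (eta z k 0 : R^o)) scale0r add0r.
Qed.

End LinearFamily.

(** * Structure equations on an open set: Jacobi and Bianchi identities *)

Section EntryE.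
Context {R : pzRingType} {p q : nat}.
Implicit Types A B : 'M[R]_(p, q).
Lemma addmxE A B i j : (A + B) i j = A i j + B i j. Proof. by rewrite mxE. Qed.
Lemma oppmxE A i j : (- A) i j = - A i j. Proof. by rewrite mxE. Qed.
Lemma scalemxE c A i j : (c *: A) i j = c * A i j. Proof. by rewrite mxE. Qed.
Lemma zeromxE i j : (0 : 'M[R]_(p, q)) i j = 0. Proof. by rewrite mxE. Qed.
End EntryE.

Ltac mx_entries := apply/matrixP => ? ?; rewrite ?(addmxE, oppmxE, scalemxE, zeromxE).

Section Bianchi.
Variables (R : realType) (m : nat) (W : set 'cV[R]_m).
Local Notation V := 'cV[R]_m.
Hypothesis oW : open W.

Let br (X Y : V -> V) z := 'D_(X z) Y z - 'D_(Y z) X z.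

Let br_br (P Q T : V -> V) z : W z -> C_infty W P -> C_infty W Q -> C_infty W T ->
  'D_(br P Q z) T z - 'D_(T z) (br P Q) z =
  'D_(P z) (fun y => 'D_(Q y) T y) z - 'D_(Q z) (fun y => 'D_(P y) T y) z
    - ('D_(T z) (fun y => 'D_(P y) Q y) z - 'D_(T z) (fun y => 'D_(Q y) P y) z).
Proof.
move=> Wz sP sQ sT; apply: (congr2 (fun a b => a - b)).
  exact: (esym (commutator oW Wz sP sQ sT)).
exact: (derive_submx (T z) Wz (smooth_derive_field oW sP sQ) (smooth_derive_field oW sQ sP)).
Qed.

(** The Jacobi identity: by [commutator] each double bracket is a difference of
    second-order terms, and these cancel cyclically. *)
Lemma jacobi (X Y Z : V -> V) z : W z -> C_infty W X -> C_infty W Y -> C_infty W Z ->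
  ('D_(br X Y z) Z z - 'D_(Z z) (br X Y) z) + ('D_(br Y Z z) X z - 'D_(X z) (br Y Z) z)
  + ('D_(br Z X z) Y z - 'D_(Y z) (br Z X) z) = 0.
Proof.
move=> Wz sX sY sZ.
apply: etrans (congr2 +%R (congr2 +%R (br_br Wz sX sY sZ) (br_br Wz sY sZ sX)) (br_br Wz sZ sX sY)) _.
have aux (a1 a2 a3 a4 a5 a6 : V) : a1 - a2 - (a3 - a4) + (a5 - a4 - (a1 - a6)) + (a3 - a6 - (a5 - a2)) = 0.
  by mx_entries; ring.
exact: aux.
Qed.

Variables (S : V -> 'M[R]_m) (c : V -> V -> V -> V).
Hypothesis sS : C_infty W S.
Hypothesis uS : forall z, W z -> S z \in unitmx.
Hypothesis sc : forall u v, C_infty W (fun z => c z u v).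
Hypothesis frame_bracket : forall z u v, W z ->
  'D_(S z *m u) S z *m v - 'D_(S z *m v) S z *m u = S z *m c z u v.

Implicit Types u v w : V.
Let sSu (u : V) : C_infty W (fun y => S y *m u). Proof. exact: (smooth_mulmxc u oW sS). Qed.

Lemma frame_bracketE z u v : W z ->
  'D_(S z *m u) (fun y => S y *m v) z - 'D_(S z *m v) (fun y => S y *m u) z = S z *m c z u v.
Proof. by move=> Wz; rewrite !(derive_mulmxc _ _ oW Wz sS); exact: frame_bracket. Qed.

(** The Jacobi identity for the frame fields S u, whose brackets are S (c u v). *)
Lemma frame_jacobi z u v w : W z ->
  c z (c z u v) w + c z (c z v w) u + c z (c z w u) v =
  'D_(S z *m w) (fun y => c y u v) z + 'D_(S z *m u) (fun y => c y v w) z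
  + 'D_(S z *m v) (fun y => c y w u) z.
Proof.
move=> Wz.
have step a b d :
  'D_('D_(S z *m a) (fun y => S y *m b) z - 'D_(S z *m b) (fun y => S y *m a) z) (fun y => S y *m d) z
  - 'D_(S z *m d) (fun y => 'D_(S y *m a) (fun y => S y *m b) y - 'D_(S y *m b) (fun y => S y *m a) y) z
  = S z *m (c z (c z a b) d - 'D_(S z *m d) (fun y => c y a b) z).
  rewrite frame_bracketE //.
  have -> : 'D_(S z *m d) (fun y => 'D_(S y *m a) (fun y => S y *m b) y - 'D_(S y *m b) (fun y => S y *m a) y) z
    = 'D_(S z *m d) (fun y => S y *m c y a b) z.
    by apply: (derive_eq_on _ oW Wz) => y; rewrite inE => Wy; exact: frame_bracketE.
  rewrite (derive_mulmx _ oW Wz sS (sc a b)) opprD addrA mulmxBr; congr (_ - _).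
  rewrite -(frame_bracket (c z a b) d Wz); apply: (congr1 (fun t => t - _)).
  exact: derive_mulmxc sS.
have := etrans (esym (congr2 +%R (congr2 +%R (step u v w) (step v w u)) (step w u v)))
  (jacobi Wz (sSu u) (sSu v) (sSu w)).
rewrite -!mulmxDr => /(congr1 (mulmx (invmx (S z)))).
rewrite mulKmx ?uS // mulmx0.
have aux (a1 a2 a3 b1 b2 b3 : V) : a1 - b1 + (a2 - b2) + (a3 - b3) = 0 ->
    a1 + a2 + a3 = b1 + b2 + b3.
  move=> /(congr1 (fun t => t + (b1 + b2 + b3))); rewrite add0r => <-.
  by mx_entries; ring.
exact: aux.
Qed.

(** This is d (d a) = 0 for a 1-form a given by its components in the frame S, in
    the case where the components r of d a are constant. *)
Lemma closed_two_form (a : V -> 'rV[R]_m) (r : V -> V -> 'M[R]_1) : C_infty W a ->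
  (forall z u v, W z -> 'D_(S z *m u) a z *m v - 'D_(S z *m v) a z *m u
     - a z *m c z u v = r u v) ->
  forall z u v w, W z ->
  r (c z u v) w + r (c z v w) u + r (c z w u) v = 0.
Proof.
move=> sa da z u v w Wz.
have saf (x : V) : C_infty W (fun y => a y *m x) by exact: smooth_mulmxc.
have sac (x y : V) : C_infty W (fun z => a z *m c z x y) by exact: smooth_mulmx.
have comm (x y t : V) : 'D_(S z *m x) (fun p => 'D_(S p *m y) (fun q => a q *m t) p) z
    - 'D_(S z *m y) (fun p => 'D_(S p *m x) (fun q => a q *m t) p) z
    = 'D_(S z *m c z x y) a z *m t.
  apply: etrans (commutator oW Wz (sSu x) (sSu y) (saf t)) _.
  by rewrite frame_bracketE // (derive_mulmxc _ _ oW Wz sa).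
have diff (x y t : V) : 'D_(S z *m t) (fun p => 'D_(S p *m x) (fun q => a q *m y) p) z
    - 'D_(S z *m t) (fun p => 'D_(S p *m y) (fun q => a q *m x) p) z
    = 'D_(S z *m t) a z *m c z x y + a z *m 'D_(S z *m t) (fun p => c p x y) z.
  have s1 := smooth_derive_field oW (sSu x) (saf y).
  have s2 := smooth_derive_field oW (sSu y) (saf x).
  apply: etrans (esym (derive_submx (S z *m t) Wz s1 s2)) _.
  apply: etrans _ (derive_mulmx (S z *m t) oW Wz sa (sc x y)).
  apply/eqP; rewrite -subr_eq0; apply/eqP.
  apply: etrans (esym (derive_submx (S z *m t) Wz (smooth_sub oW s1 s2) (sac x y))) _.
  rewrite -[RHS](derive_cst (r x y) z (S z *m t)).
  apply: (derive_eq_on _ oW Wz) => p; rewrite inE => Wp.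
  by rewrite !(derive_mulmxc _ _ oW Wp sa) da.
rewrite -!(da z) //.
have E1 := comm u v w; have E2 := comm v w u; have E3 := comm w u v.
have D1 := diff u v w; have D2 := diff v w u; have D3 := diff w u v.
have J := congr1 (mulmx (a z)) (frame_jacobi u v w Wz).
rewrite !mulmxDr in J.
have aux (p1 p2 p3 n1 n2 n3 c1 c2 c3 d1 d2 d3 a1 a2 a3 b1 b2 b3 : 'M[R]_1) :
    b1 + b2 + b3 = a1 + a2 + a3 -> p1 - n1 = c1 -> p2 - n2 = c2 -> p3 - n3 = c3 ->
    p3 - n2 = d1 + a1 -> p1 - n3 = d2 + a2 -> p2 - n1 = d3 + a3 ->
    c1 - d1 - b1 + (c2 - d2 - b2) + (c3 - d3 - b3) = 0.
  move=> H <- <- <- H1 H2 H3; have -> : b1 = a1 + a2 + a3 - b2 - b3.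
    by rewrite -H; mx_entries; ring.
  have -> : d1 = p3 - n2 - a1 by rewrite H1; mx_entries; ring.
  have -> : d2 = p1 - n3 - a2 by rewrite H2; mx_entries; ring.
  have -> : d3 = p2 - n1 - a3 by rewrite H3; mx_entries; ring.
  by mx_entries; ring.
exact: aux J E1 E2 E3 D1 D2 D3.
Qed.

(** When the torsion T1 is annihilated by the coefficients A (hypothesis on
    A z u *m T1 v w), it is parallel, and the first Bianchi identity loses its
    derivative of the torsion.  It is [frame_jacobi] with c expressed by A and T1. *)
Lemma first_bianchi (A : V -> V -> 'M[R]_m) (T1 : V -> V -> V) (R1 : V -> V -> 'M[R]_m) :
  (forall u, C_infty W (fun z => A z u)) ->
  (forall z u v, W z -> c z u v = A z u *m v - A z v *m u - T1 u v) ->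
  (forall u v w, T1 (u - v) w = T1 u w - T1 v w) ->
  (forall u v, T1 u v = - T1 v u) ->
  (forall z u v w, W z -> A z u *m T1 v w = T1 (A z u *m v) w + T1 v (A z u *m w)) ->
  (forall z u v, W z -> 'D_(S z *m u) (fun y => A y v) z - 'D_(S z *m v) (fun y => A y u) z
     + A z u *m A z v - A z v *m A z u - A z (c z u v) = R1 u v) ->
  forall z u v w, W z ->
  R1 u v *m w + R1 v w *m u + R1 w u *m v = T1 (T1 u v) w + T1 (T1 v w) u + T1 (T1 w u) v.
Proof.
move=> sA cE T1B T1N T1eq R1E z u v w Wz.
have Dc (x y t : V) : 'D_t (fun p => c p x y) z = 'D_t (fun p => A p x) z *m y - 'D_t (fun p => A p y) z *m x.
  apply: (etrans (y := 'D_t (fun p => A p x *m y - A p y *m x - T1 x y) z)).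
    by apply: (derive_eq_on _ oW Wz) => p; rewrite inE => Wp; exact: cE.
  have s1 := smooth_mulmxc y oW (sA x); have s2 := smooth_mulmxc x oW (sA y).
  apply: etrans (derive_submx t Wz (smooth_sub oW s1 s2) (C_infty_cst (T1 x y) oW)) _.
  rewrite derive_cst subr0.
  apply: etrans (derive_submx t Wz s1 s2) _.
  by rewrite !(derive_mulmxc _ _ oW Wz (sA _)).
have J := frame_jacobi u v w Wz.
rewrite !Dc in J.
have cc (x y t : V) : c z (c z x y) t = A z (c z x y) *m t - A z t *m (A z x *m y) + A z t *m (A z y *m x)
   + A z t *m T1 x y - T1 (A z x *m y) t + T1 (A z y *m x) t + T1 (T1 x y) t.
  rewrite [LHS](cE _ _ _ Wz) [X in T1 X t]cE // [X in A z t *m X]cE // !T1B !mulmxBr.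
  by mx_entries; ring.
rewrite !cc !T1eq // in J.
move: J; rewrite [T1 u (A z w *m v)]T1N [T1 v (A z u *m w)]T1N [T1 w (A z v *m u)]T1N.
rewrite -!(R1E z) // !(mulmxDl, mulmxBl, mulmxDr, mulNmx) -!mulmxA.
have aux (k1 k2 k3 pwuv pwvu puvw puwv pvwu pvuw t1 t2 t3 t4 t5 t6 s1 s2 s3 d1 d2 d3 d4 d5 d6 : V) :
  (k1 - pwuv + pwvu + (t1 - t2) - t3 + t4 + s1 + (k2 - puvw + puwv + (t3 - t5) - t6 + t2 + s2)
    + (k3 - pvwu + pvuw + (t6 - t4) - t1 + t5 + s3)) = d1 - d2 + (d3 - d4) + (d5 - d6) ->
  d3 - d6 + puvw - pvuw - k1 + (d5 - d2 + pvwu - pwvu - k2) + (d1 - d4 + pwuv - puwv - k3) = s1 + s2 + s3.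
  move=> /matrixP J'; apply/matrixP => i j; move: (J' i j).
  by rewrite !(addmxE, oppmxE); lra.
exact: aux.
Qed.

End Bianchi.

(** * Vector fields in charts *)

Section ChartCalculus.
Variables (R : realType) (m : nat) (M : manifold R m).
Implicit Types (i j : Defs.index M) (x y : M) (U : set M) (X Y : vfield M).
Local Notation crd i := (Defs.coord (atlas i)).
Local Notation prm i := (param (atlas i)).
Local Notation Dom i := (dom (atlas i)).

Definition chart_image i U : set 'cV[R]_m := crd i @` (Dom i `&` U).

Lemma coordKd i y : Dom i y -> prm i (crd i y) = y.
Proof. by move=> dy; apply: coordK; rewrite inE. Qed.

Lemma chart_imageP i U z : chart_image i U z ->
  [/\ Dom i (prm i z), U (prm i z) & crd i (prm i z) = z].
Proof. by move=> [y [dy Uy] <-]; rewrite coordKd. Qed.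

Lemma chart_image_coord i U y : Dom i y -> U y -> chart_image i U (crd i y).
Proof. by move=> dy Uy; exists y. Qed.

Lemma chart_image_open i U : open U -> open (chart_image i U).
Proof.
move=> oU; rewrite openE => z Wz.
have [dz Uz Ez] := chart_imageP Wz.
have Iz : (crd i @` Dom i) z by exists (prm i z).
have n1 := nbhs_open (@open_coord_dom _ _ _ (atlas i)) Iz.
have n2 : \forall z' \near z, U (prm i z').
  by have := param_continuous Iz; apply; exact: nbhs_open.
near=> z'.
have Iz' : (crd i @` Dom i) z' by near: z'.
have Uz' : U (prm i z') by near: z'.
by case: Iz' Uz' => y dy <-; rewrite coordKd // => Uy; exists y.
Unshelve. all: by end_near. Qed.

Arguments chart_image_open i {U} oU.

Lemma Dom_open i : open (Dom i). Proof. exact: open_dom. Qed.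

Lemma transition_smooth i j : C_infty (chart_image i (Dom j)) (fun z => crd j (prm i z)).
Proof. exact: atlas_smooth. Qed.

Lemma tangent_coord_linear i x c (u v : 'cV[R]_m) : Dom i x ->
  @tangent_coord R m M i x (c *: u + v) = c *: @tangent_coord R m M i x u + @tangent_coord R m M i x v.
Proof.
move=> dx; rewrite /tangent_coord; apply: (derive_linear _ _ _ (chart_image_open (at_ x) (Dom_open i))).
  by apply: chart_image_coord => //; exact: at_dom.
exact: transition_smooth.
Qed.

Lemma tangent_coord_self x (v : 'cV[R]_m) : @tangent_coord R m M (at_ x) x v = v.
Proof.
rewrite /tangent_coord; set k := at_ x.
have oW := chart_image_open k openT.
have Wx : chart_image k setT (crd k x) by apply: chart_image_coord => //; exact: at_dom.
have := @derive_id R 'cV[R]_m (crd k x) v; move=> E; apply: etrans E.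
apply: (derive_eq_on _ oW Wx) => z; rewrite inE => Wz /=.
by have [] := chart_imageP Wz.
Qed.

(** The chain rule for the transition maps: the components of a tangent vector in two
    charts are related by the derivative of the change of charts. *)
Lemma tangent_coord_change i j x (v : 'cV[R]_m) : Dom i x -> Dom j x ->
  @tangent_coord R m M j x v =
  'D_(@tangent_coord R m M i x v) (fun z => crd j (prm i z)) (crd i x).
Proof.
move=> di dj; rewrite /tangent_coord; set k := at_ x.
have dk : Dom k x by exact: at_dom.
have oW := chart_image_open k (openI (Dom_open i) (Dom_open j)).
have Wx : chart_image k (Dom i `&` Dom j) (crd k x) by exact: chart_image_coord.
apply: (etrans (y := 'D_v (fun z => crd j (prm i (crd i (prm k z)))) (crd k x))).
  apply: (derive_eq_on _ oW Wx) => z; rewrite inE => Wz /=.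
  by have [_ [diz _] _] := chart_imageP Wz; rewrite coordKd.
have s1 : C_infty (chart_image k (Dom i `&` Dom j)) (fun z => crd i (prm k z)).
  by apply: C_infty_sub (transition_smooth k i); apply: image_subset => y [dy [? ?]].
have Ex : crd i (prm k (crd k x)) = crd i x by rewrite coordKd.
have Vx : chart_image i (Dom j) (crd i (prm k (crd k x))).
  by rewrite Ex; exact: chart_image_coord.
have := chain_rule (phi := fun z => crd i (prm k z)) (F := fun z => crd j (prm i z)) v
  oW (chart_image_open i (Dom_open j)) Wx Vx s1 (transition_smooth i j).
by rewrite Ex.
Qed.

Lemma tangent_coord_inj i x (u v : 'cV[R]_m) : Dom i x ->
  @tangent_coord R m M i x u = @tangent_coord R m M i x v -> u = v.
Proof.
move=> di E; rewrite -(tangent_coord_self x u) -(tangent_coord_self x v).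
by rewrite !(tangent_coord_change _ di (at_dom x)) E.
Qed.

Lemma act_on_fun_coord i U (f : M -> R) y (v : 'cV[R]_m) : open U -> U y -> Dom i y ->
  smooth_fun U f ->
  @act_on_fun R m M y v f =
  'D_(@tangent_coord R m M i y v) (f \o prm i : 'cV[R]_m -> R^o) (crd i y).
Proof.
move=> oU Uy di sf; rewrite /act_on_fun /tangent_coord; set k := at_ y.
have dk : Dom k y by exact: at_dom.
have oW := chart_image_open k (openI (Dom_open i) oU).
have Wy : chart_image k (Dom i `&` U) (crd k y) by exact: chart_image_coord.
apply: (etrans (y := 'D_v (fun z => (f \o prm i) (crd i (prm k z)) : R^o) (crd k y))).
  apply: (derive_eq_on _ oW Wy) => z; rewrite inE => Wz /=.
  by have [_ [diz _] _] := chart_imageP Wz; rewrite coordKd.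
have s1 : C_infty (chart_image k (Dom i `&` U)) (fun z => crd i (prm k z)).
  by apply: C_infty_sub (transition_smooth k i); apply: image_subset => z [dy [? ?]].
have Ex : crd i (prm k (crd k y)) = crd i y by rewrite coordKd.
have Vx : chart_image i U (crd i (prm k (crd k y))).
  by rewrite Ex; exact: chart_image_coord.
have := chain_rule_scalar (phi := fun z => crd i (prm k z)) (f := f \o prm i) v
  oW (chart_image_open i oU) Wy Vx s1 (sf i).
by rewrite Ex.
Qed.

(** The bracket is defined in the chart [at_ y]; the computation in any other
    chart gives the same vector, since brackets are compatible with the change of charts
    by [commutator]. *)
Lemma bracket_coord i U X Y y : open U -> U y -> Dom i y ->
  smooth_vfield U X -> smooth_vfield U Y ->
  @tangent_coord R m M i y (bracket X Y y) =
  'D_(vfield_coord X i (crd i y)) (vfield_coord Y i) (crd i y)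
  - 'D_(vfield_coord Y i (crd i y)) (vfield_coord X i) (crd i y).
Proof.
move=> oU Uy di sX sY.
set k := at_ y; have dk : Dom k y by exact: at_dom.
pose W := chart_image k (Dom i `&` U).
have oW : open W by exact: (chart_image_open k (openI (Dom_open i) oU)).
have Wy : W (crd k y) by exact: chart_image_coord.
pose phi z := crd i (prm k z).
have sphi : C_infty W phi.
  by apply: C_infty_sub (transition_smooth k i); apply: image_subset => z [dy [? ?]].
have Ey : phi (crd k y) = crd i y by rewrite /phi coordKd.
have sub : W `<=` chart_image k U by apply: image_subset => z [? [? ?]].
have sXk : C_infty W (vfield_coord X k) by apply: C_infty_sub (sX k).
have sYk : C_infty W (vfield_coord Y k) by apply: C_infty_sub (sY k).
have rel Z w : W w -> vfield_coord Z i (phi w) = 'D_(vfield_coord Z k w) phi w.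
  move=> Ww; have [dkw [diw Uw] Ew] := chart_imageP Ww.
  rewrite /vfield_coord /phi coordKd //.
  by rewrite (tangent_coord_change _ dkw diw) Ew.
have oV : open (chart_image i U) by exact: chart_image_open.
have Vy : chart_image i U (phi (crd k y)) by rewrite Ey; exact: chart_image_coord.
have key Z Z' : smooth_vfield U Z -> 
   'D_(vfield_coord Z' i (crd i y)) (vfield_coord Z i) (crd i y) =
   'D_(vfield_coord Z' k (crd k y)) (fun w => 'D_(vfield_coord Z k w) phi w) (crd k y).
  move=> sZ; rewrite -Ey (rel _ _ Wy).
  have E := chain_rule (vfield_coord Z' k (crd k y)) oW oV Wy Vy sphi (sZ i).
  apply: etrans (esym E) _.
  by apply: (derive_eq_on _ oW Wy) => w; rewrite inE => Ww; exact: rel.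
have E := commutator oW Wy sXk sYk sphi.
have self Z : vfield_coord Z k (crd k y) = Z y.
  by rewrite /vfield_coord coordKd // tangent_coord_self.
apply: esym; apply: etrans (congr2 (fun a b => a - b) (key Y X sY) (key X Y sX)) _.
by apply: etrans E _; rewrite !self.
Qed.

End ChartCalculus.

Arguments chart_image_open {R m M} i {U} oU.

(** * Covariant derivatives of combinations of fields *)

Lemma unitmx_inj (R : fieldType) m (A : 'M[R]_m) :
  (forall u : 'cV_m, A *m u = 0 -> u = 0) -> A \in unitmx.
Proof.
move=> inj; rewrite unitmxE unitfE; apply/negP => /eqP d0.
have /det0P[v v0 vA] : \det A^T == 0 by rewrite det_tr d0.
have /inj : A *m v^T = 0 by rewrite -[A]trmxK -trmx_mul vA trmx0.
by move=> /(congr1 trmx); rewrite trmxK trmx0 => /eqP; rewrite (negPf v0).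
Qed.

Section ConnectionCalculus.
Variables (R : realType) (m : nat) (M : manifold R m).
Local Notation V := 'cV[R]_m.
Implicit Types (U : set M) (Y Z : vfield M).
Local Notation crd i := (Defs.coord (atlas i)).
Local Notation prm i := (param (atlas i)).

Lemma smooth_vfield_scale U (f : M -> R) Y : open U -> smooth_fun U f -> smooth_vfield U Y ->
  smooth_vfield U ((fun y => f y *: (Y y : V)) : vfield M).
Proof.
move=> oU sf sY i; have oW := chart_image_open i oU.
apply: (C_infty_eq_on (f := fun z => f (prm i z) *: vfield_coord Y i z)) => //.
  move=> z; rewrite inE => /chart_imageP[dz _ _].
  have := tangent_coord_linear (f (prm i z)) (Y (prm i z)) 0 dz; rewrite !addr0 => E.
  rewrite [RHS]E -[LHS]addr0; congr (_ + _).
  have := tangent_coord_linear (-1) (0 : V) 0 dz.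
  by rewrite !scaleN1r oppr0 addr0 addNr => ->.
by apply: smooth_scale => //; exact: sf.
Qed.

Lemma tangent_coord0 i x : dom (atlas i) x -> @tangent_coord R m M i x (0 : V) = 0.
Proof.
move=> dx; have := tangent_coord_linear (-1) (0 : V) 0 dx.
by rewrite !scaleN1r oppr0 addr0 addNr.
Qed.

Lemma tangent_coordB i x (u v : V) : dom (atlas i) x ->
  @tangent_coord R m M i x (u - v) = @tangent_coord R m M i x u - @tangent_coord R m M i x v.
Proof.
move=> dx; have := tangent_coord_linear (-1) v u dx.
by rewrite !scaleN1r ![_ + u]addrC addrC => ->; rewrite addrC.
Qed.

Lemma tangent_coord_sum i x n (c : 'I_n -> R) (u : 'I_n -> V) : dom (atlas i) x ->
  @tangent_coord R m M i x (\sum_j c j *: u j) = \sum_j c j *: @tangent_coord R m M i x (u j).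
Proof.
move=> dx; elim: n c u => [|n IH] c u; first by rewrite !big_ord0 tangent_coord0.
by rewrite !big_ord_recl /= tangent_coord_linear // IH.
Qed.

Lemma smooth_fun_cst U (c : R) : open U -> smooth_fun U (fun _ : M => c).
Proof. by move=> oU i; apply: C_infty_cst; exact: chart_image_open. Qed.

Lemma act_on_cst x (v : V) (c : R) : @act_on_fun R m M x v (fun=> c) = 0.
Proof. exact: derive_cst. Qed.

Variable nb : forall x : M, tangent x -> vfield M -> tangent x.
Hypothesis nbc : is_connection nb.

Lemma smooth_vfield_comb U n (f : 'I_n -> M -> R) (Y : 'I_n -> vfield M) : open U ->
  (forall j, smooth_fun U (f j)) -> (forall j, smooth_vfield U (Y j)) ->
  smooth_vfield U ((fun y => \sum_j f j y *: (Y j y : V)) : vfield M).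
Proof.
move=> oU sf sY i; have oW := chart_image_open i oU.
apply: (C_infty_eq_on (f := fun z => \sum_j f j (prm i z) *: vfield_coord (Y j) i z)) => //.
  move=> z; rewrite inE => /chart_imageP[dz _ _].
  by symmetry; exact: tangent_coord_sum.
by apply: smooth_summx => // j; apply: smooth_scale => //; [exact: sf|exact: sY].
Qed.

(** Leibniz rule for a finite combination of fields.  The case n = 0, where the
    covariant derivative of the zero field vanishes, follows from additivity. *)
Lemma nabla_comb U n (f : 'I_n -> M -> R) (Y : 'I_n -> vfield M) x (v : V) :
  open U -> U x -> (forall j, smooth_fun U (f j)) -> (forall j, smooth_vfield U (Y j)) ->
  nb (v : tangent x) ((fun y => \sum_j f j y *: (Y j y : V)) : vfield M) =
  \sum_j (@act_on_fun R m M x v (f j) *: (Y j x : V) + f j x *: (nb (v : tangent x) (Y j) : V)).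
Proof.
move=> oU Ux; elim: n f Y => [|n IH] f Y sf sY.
  pose O : vfield M := fun=> 0 : V.
  have sO : smooth_vfield U O.
    have := @smooth_vfield_comb U 0 (fun _ _ => 0) (fun _ => O) oU.
    move=> H; have {}H := H (fun _ => smooth_fun_cst 0 oU).
    move=> i; apply: (C_infty_eq_on (f := cst 0)); first exact: chart_image_open.
      move=> z; rewrite inE => /chart_imageP[dz _ _].
      by symmetry; exact: tangent_coord0.
    by apply: C_infty_cst; exact: chart_image_open.
  rewrite big_ord0; transitivity (nb (v : tangent x) O); first by congr nb; apply/funext => y; rewrite big_ord0.
  have sOx : smooth_vfield_at x O by exists U.
  have := connection_add nbc (v : tangent x) sOx sOx.
  have -> : (fun y => (O y : V) + O y) = O by apply/funext => y; rewrite /O addr0.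
  by move/(congr1 (fun t : V => t - nb (v : tangent x) O)); rewrite /= addrK subrr => <-.
rewrite big_ord_recl.
pose Y0 : vfield M := fun y => f ord0 y *: (Y ord0 y : V).
pose Y1 : vfield M := fun y => \sum_(j < n) f (lift ord0 j) y *: (Y (lift ord0 j) y : V).
have s0 : smooth_vfield U Y0 by exact: smooth_vfield_scale.
have s1 : smooth_vfield U Y1 := smooth_vfield_comb oU (fun j => sf (lift ord0 j)) (fun j => sY (lift ord0 j)).
have -> : (fun y => \sum_j f j y *: (Y j y : V)) = (fun y => (Y0 y : V) + Y1 y).
  by apply/funext => y; rewrite big_ord_recl.
rewrite (connection_add nbc); [|by exists U|by exists U].
have E0 := connection_leibniz nbc (v : tangent x) oU Ux (sf ord0) (sY ord0).
have E1 := IH (fun j => f (lift ord0 j)) (fun j => Y (lift ord0 j)) (fun j => sf _) (fun j => sY _).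
exact: (congr2 (fun a b : V => a + b) E0 E1).
Qed.

End ConnectionCalculus.

(** * A connection in a moving frame *)

Section MovingFrame.
Variables (R : realType) (m : nat) (M : manifold R m).
Local Notation V := 'cV[R]_m.
Variable nb : forall x : M, tangent x -> vfield M -> tangent x.
Hypothesis nbc : is_connection nb.
Variables (U : set M) (s : M -> 'M[R]_m).
Hypothesis oU : open U.
Hypothesis us : forall y, U y -> s y \in unitmx.
Hypothesis ss : forall w : V, smooth_vfield U ((fun y => s y *m w) : vfield M).
Implicit Types (u v w : V).
Local Notation crd i := (Defs.coord (atlas i)).
Local Notation prm i := (param (atlas i)).
Local Notation E w := ((fun y => s y *m w) : vfield M).
Local Notation ek j := (delta_mx j 0 : V).

Definition frame_mx (i : Defs.index M) (z : V) : 'M[R]_m :=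
  \matrix_(k, j) vfield_coord (E (ek j)) i z k 0.

(** The coefficients of the connection in the frame s, as in [Lambda], for a
    connection that is not yet part of an affine manifold. *)
Definition Lam (y : M) (u : V) : 'M[R]_m :=
  \matrix_(i, j) (invmx (s y) *m (nb (s y *m u : tangent y) (E (ek j)) : V)) i 0.

Lemma mulmx_sum_coord p (A : 'M[R]_(p, m)) (w : V) : A *m w = \sum_j w j 0 *: (A *m ek j).
Proof.
rewrite {1}[w]matrix_sum_delta mulmx_sumr; apply: eq_bigr => j _.
by rewrite big_ord1 scalemxAr.
Qed.

Lemma frame_mxE i z w : dom (atlas i) (prm i z) -> vfield_coord (E w) i z = frame_mx i z *m w.
Proof.
move=> dz; rewrite /vfield_coord mulmx_sum_coord (tangent_coord_sum _ _ dz).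
rewrite [RHS]mulmx_sum_coord; apply: eq_bigr => j _; congr (_ *: _).
by apply/colP => k; rewrite -[frame_mx i z *m _]colE [RHS]mxE [RHS]mxE.
Qed.

Lemma frame_mx_smooth i : C_infty (chart_image i U) (frame_mx i).
Proof.
have oW := chart_image_open i oU.
apply/smooth_mxP => // k j.
apply: (C_infty_eq_on (f := fun z => vfield_coord (E (ek j)) i z k 0)) => //.
  by move=> z _; rewrite mxE.
exact: smooth_entry oW (ss (ek j) i).
Qed.

Lemma frame_mx_unit i z : chart_image i U z -> frame_mx i z \in unitmx.
Proof.
move=> /chart_imageP[dz Uz _]; apply: unitmx_inj => u.
rewrite -frame_mxE // => E1.
have := tangent_coord_inj dz (etrans E1 (esym (tangent_coord0 dz))).
move=> /(congr1 (mulmx (invmx (s (prm i z))))); rewrite mulKmx ?us // mulmx0; exact.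
Qed.

Lemma Lam_col y u j : U y -> nb (s y *m u : tangent y) (E (ek j)) = s y *m (Lam y u *m ek j).
Proof.
move=> Uy; rewrite (_ : Lam y u *m ek j = invmx (s y) *m (nb (s y *m u : tangent y) (E (ek j)) : V)).
  by rewrite mulKVmx // us.
by apply/colP => k; rewrite -colE !mxE; apply: eq_bigr.
Qed.

Lemma Lam_E y u w : U y -> nb (s y *m u : tangent y) (E w) = s y *m (Lam y u *m w).
Proof.
move=> Uy.
have -> : E w = (fun y => \sum_j w j 0 *: (s y *m ek j)).
  by apply/funext => z; rewrite mulmx_sum_coord.
have := nabla_comb nbc (s y *m u) oU Uy (fun j => smooth_fun_cst (w j 0) oU) (fun j => ss (ek j)).
move=> H; apply: etrans H _.
rewrite [in RHS](mulmx_sum_coord (Lam y u) w) mulmx_sumr; apply: eq_bigr => j _.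
by rewrite act_on_cst scale0r add0r Lam_col // scalemxAr.
Qed.

Lemma Lam_linear y c u v : U y -> Lam y (c *: u + v) = c *: Lam y u + Lam y v.
Proof.
move=> Uy; apply/matrixP => i j.
have sE : smooth_vfield_at y (E (ek j)) by exists U.
rewrite !mxE.
have -> : nb (s y *m (c *: u + v) : tangent y) (E (ek j)) =
   c *: (nb (s y *m u : tangent y) (E (ek j)) : V) + nb (s y *m v : tangent y) (E (ek j)).
  by rewrite mulmxDr -scalemxAr; exact: (connection_linear nbc).
by rewrite mulr_sumr -big_split /=; apply: eq_bigr => k _; rewrite !mxE mulrDr mulrCA.
Qed.

Definition nablaE (u : V) (w : V) : vfield M := fun y => nb (s y *m u : tangent y) (E w).

Lemma nablaE_smooth u w : smooth_vfield U (nablaE u w).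
Proof. exact: (connection_smooth nbc oU (ss u) (ss w)). Qed.

(** Only the covariant derivatives of the frame fields are known to be smooth; the
    coefficients are recovered from them by inverting the matrix of the frame in the
    chart. *)
Lemma Lam_smooth i u : C_infty (chart_image i U) (fun z => Lam (prm i z) u).
Proof.
have oW := chart_image_open i oU.
pose N z : 'M[R]_m := \matrix_(k, j) vfield_coord (nablaE u (ek j)) i z k 0.
apply: (C_infty_eq_on (f := fun z => invmx (frame_mx i z) *m N z)) => //.
  move=> z; rewrite inE => Wz; have [dz Uz _] := chart_imageP Wz.
  suff -> : N z = frame_mx i z *m Lam (prm i z) u by rewrite mulKmx // frame_mx_unit.
  apply/matrixP => k j; rewrite mxE /vfield_coord /nablaE Lam_col //.
  have := frame_mxE (Lam (prm i z) u *m ek j) dz; rewrite /vfield_coord => ->.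
  by rewrite mulmxA -colE mxE.
apply: smooth_mulmx => //.
  by apply: smooth_invmx => //; [exact: frame_mx_smooth|move=> z; exact: frame_mx_unit].
apply/smooth_mxP => // k j.
apply: (C_infty_eq_on (f := fun z => vfield_coord (nablaE u (ek j)) i z k 0)) => //.
  by move=> z _; rewrite mxE.
exact: smooth_entry oW (nablaE_smooth u (ek j) i).
Qed.

Lemma Lam_smooth_fun u v j : smooth_fun U (fun y => (Lam y u *m v) j 0).
Proof.
move=> i; have oW := chart_image_open i oU.
apply: (smooth_entry (F := fun z => Lam (prm i z) u *m v) j 0 oW).
by apply: smooth_mulmxc => //; exact: Lam_smooth.
Qed.

Lemma torsion_coord i z u v : chart_image i U z ->
  let y := prm i z in
  @tangent_coord R m M i y
    ((nb (s y *m u : tangent y) (E v) : V) - nb (s y *m v : tangent y) (E u) - bracket (E u) (E v) y)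
  = frame_mx i z *m (Lam y u *m v - Lam y v *m u)
    - ('D_(frame_mx i z *m u) (frame_mx i) z *m v - 'D_(frame_mx i z *m v) (frame_mx i) z *m u).
Proof.
move=> Wz y; have [dz Uz Ez] := chart_imageP Wz.
have oW := chart_image_open i oU.
rewrite !Lam_E // -mulmxBr tangent_coordB //.
have := frame_mxE (Lam y u *m v - Lam y v *m u) dz; rewrite /vfield_coord => ->.
apply: (congr1 (fun t => _ - t)).
rewrite (bracket_coord oU Uz dz (ss u) (ss v)) Ez !frame_mxE //.
have D a b : 'D_a (vfield_coord (E b) i) z = 'D_a (frame_mx i) z *m b.
  apply: etrans _ (derive_mulmxc b a oW Wz (frame_mx_smooth i)).
  apply: (derive_eq_on _ oW Wz) => p; rewrite inE => /chart_imageP[dp _ _].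
  exact: frame_mxE.
by rewrite !D.
Qed.

(** The field nabla_(s v) (s w) is the combination of the frame fields with
    coefficients Lam v w, so that [nabla_comb] applies to it. *)
Lemma second_covariant_coord i z u v w : chart_image i U z ->
  let y := prm i z in
  @tangent_coord R m M i y (nb (s y *m u : tangent y) (nablaE v w)) =
  frame_mx i z *m ('D_(frame_mx i z *m u) (fun p => Lam (prm i p) v) z *m w
     + Lam y u *m (Lam y v *m w)).
Proof.
move=> Wz y; have [dz Uz Ez] := chart_imageP Wz.
have oW := chart_image_open i oU.
have -> : nb (s y *m u : tangent y) (nablaE v w) =
    nb (s y *m u : tangent y) ((fun y => \sum_j (Lam y v *m w) j 0 *: (s y *m ek j)) : vfield M).
  apply: (connection_local nbc _ oU Uz (nablaE_smooth v w)) => p Up.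
  by rewrite /nablaE Lam_E // mulmx_sum_coord.
have := nabla_comb nbc (s y *m u) oU Uz (fun j => @Lam_smooth_fun v w j) (fun j => ss (ek j)).
move=> H; apply: etrans (congr1 (@tangent_coord R m M i y) H) _.
have -> : \sum_j (@act_on_fun R m M y (s y *m u) (fun y => (Lam y v *m w) j 0) *: (s y *m ek j)
     + (Lam y v *m w) j 0 *: (nb (s y *m u : tangent y) (E (ek j)) : V)) =
   s y *m ('D_(frame_mx i z *m u) (fun p => Lam (prm i p) v) z *m w + Lam y u *m (Lam y v *m w)).
  rewrite mulmxDr big_split /=; congr (_ + _); last first.
    rewrite (mulmx_sum_coord (Lam y u) (Lam y v *m w)) mulmx_sumr; apply: eq_bigr => j _.
    by rewrite Lam_col // scalemxAr.
  rewrite [RHS](mulmx_sum_coord (s y)); apply: eq_bigr => j _; congr (_ *: _).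
  rewrite (act_on_fun_coord (s y *m u) oU Uz dz (@Lam_smooth_fun v w j)) Ez.
  rewrite -[LHS]/('D_(vfield_coord (E u) i z) (fun p => (Lam (prm i p) v *m w) j 0) z) frame_mxE //.
  have sL := smooth_mulmxc w oW (Lam_smooth i v).
  by rewrite -(derive_mulmxc w _ oW Wz (Lam_smooth i v)) (derive_entry _ _ _ sL Wz).
exact: frame_mxE.
Qed.

End MovingFrame.

(** * The structure equations of an infinitesimally homogeneous manifold *)

Section StructureEquations.
Variables (R : realType) (m : nat) (G g : set 'M[R]_m).
Local Notation V := 'cV[R]_m.
Variables (M : affine_manifold G) (T0 : V -> V -> V) (R0 : V -> V -> 'M[R]_m)
  (I0 : V -> set 'M[R]_m).
Hypothesis ct : characteristic_tensors g M T0 R0 I0.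
Implicit Types (u v w : V).

Lemma smooth_vfield_near (U : set M) (x : M) (X : vfield M) :
  open U -> U x -> smooth_vfield U X -> smooth_vfield_at x X.
Proof. by move=> oU Ux sX; exists U. Qed.

(** The curvature of M at a point is computed by R0 in the two frames s x and
    s x h of the structure. *)
Lemma curvature_tensor_equivariant h u v : G h ->
  R0 (h *m u) (h *m v) *m h = h *m R0 u v.
Proof.
move=> Gh; have [x _] := carrier_nonempty M.
have [U [s [[oU Ps ss] Ux]]] := structure_section (structureP M) x.
have Px := Ps x Ux.
have ux := structure_frame (structureP M) Px.
have Pxh := structure_act (structureP M) Px Gh.
have sx w := smooth_vfield_near oU Ux (ss w).
apply/matrixP => i j.
have E1 := curvatureE ct Px (sx (h *m u)) (sx (h *m v)) (sx (h *m delta_mx j 0)) erefl erefl erefl.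
have E2 := curvatureE ct (u := u) (v := v) (w := delta_mx j 0) Pxh
  (sx (h *m u)) (sx (h *m v)) (sx (h *m delta_mx j 0)) (mulmxA _ _ _) (mulmxA _ _ _) (mulmxA _ _ _).
have := etrans (esym E1) E2.
rewrite -(mulmxA (s x) h) => /(congr1 (mulmx (invmx (s x)))); rewrite !mulKmx //.
rewrite !mulmxA -!colE => /matrixP/(_ i 0).
by rewrite [LHS]mxE [RHS]mxE.
Qed.

(** Cartan's structure equations in a chart and a local section of the structure:
    S is the matrix of the section and L the family of connection coefficients.  The
    inner torsion says that L u is lam u modulo g, and the torsion and the curvature are
    the constants T0 and R0. *)
Theorem structure_equations (lam : V -> 'M[R]_m) : g 0 ->
  (forall u, I0 u = gl_class g (lam u)) ->
  exists (W : set V) (z0 : V) (S : V -> 'M[R]_m) (L : V -> V -> 'M[R]_m),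
  [/\ open W, W z0, C_infty W S, forall z, W z -> S z \in unitmx
    & forall u, C_infty W (fun z => L z u)] /\
  (forall z c u v, W z -> L z (c *: u + v) = c *: L z u + L z v) /\
  (forall z u, W z -> exists2 B, g B & L z u = lam u + B) /\
  (forall z u v, W z ->
    'D_(S z *m u) S z *m v - 'D_(S z *m v) S z *m u
    = S z *m (L z u *m v - L z v *m u - T0 u v)) /\
  (forall z u v, W z ->
    'D_(S z *m u) (fun p => L p v) z - 'D_(S z *m v) (fun p => L p u) z
    + L z u *m L z v - L z v *m L z u
    - L z (L z u *m v - L z v *m u - T0 u v) = R0 u v).
Proof.
move=> g0 I0E; have [x _] := carrier_nonempty M.
have [U [s [ls Ux]]] := structure_section (structureP M) x.
have [oU Ps ss] := ls.
have us y : U y -> s y \in unitmx by move=> /Ps; exact: (structure_frame (structureP M)).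
have nbc := nabla_connection M.
pose L0 := Lam (nabla (a:=M)) s.
have sx w (y : M) (Uy : U y) := smooth_vfield_near oU Uy (ss w).
have tors u v y : U y ->
    ((nabla (s y *m u : tangent y) ((fun y => s y *m v) : vfield M) : V)
     - nabla (s y *m v : tangent y) ((fun y => s y *m u) : vfield M)
     - bracket ((fun y => s y *m u) : vfield M) ((fun y => s y *m v) : vfield M) y) = s y *m T0 u v.
  by move=> Uy; exact: (torsionE ct (Ps y Uy) (sx u y Uy) (sx v y Uy) erefl erefl).
have brk u v y : U y ->
    bracket ((fun y => s y *m u) : vfield M) ((fun y => s y *m v) : vfield M) y
    = s y *m (L0 y u *m v - L0 y v *m u - T0 u v).
  move=> Uy; have := tors u v y Uy; rewrite !(Lam_E nbc oU us ss) // => H.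
  rewrite !mulmxBr -H; have aux (a b d : V) : d = a - b - (a - b - d) by rewrite opprB addrCA subrr addr0.
  exact: aux.
pose i := at_ x.
exists (chart_image i U), (Defs.coord (atlas i) x), (frame_mx s i), (fun z => L0 (param (atlas i) z)).
have oW : open (chart_image i U) := chart_image_open i oU.
split; [split=> //|split; [|split; [|split]]].
- by apply: chart_image_coord => //; exact: at_dom.
- exact: frame_mx_smooth.
- by move=> z; exact: frame_mx_unit.
- by move=> u; exact: (Lam_smooth nbc).
- by move=> z c u v /chart_imageP[_ Uz _]; exact: (Lam_linear nbc oU ss).
- move=> z u /chart_imageP[_ Uz _]; set y := param (atlas i) z.
  have := inner_torsionE ct u (Ps y Uz); rewrite I0E.
  move=> /seteqP[+ _] => /(_ (s y *m L0 y u *m invmx (s y))).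
  case.
    exists U, s; split=> //.
    exists (L0 y u) => //; exists 0 => //.
    by rewrite addr0 mulKmx ?us.
  move=> _ [B gB <-] E; exists B => //; symmetry.
  move: E => /(congr1 (fun t => invmx (s y) *m t *m s y)).
  by rewrite !mulmxA !mulVmx ?us // !mul1mx -!mulmxA !mulVmx ?us // !mulmx1.
- move=> z u v Wz; have [dz Uz _] := chart_imageP Wz.
  have := torsion_coord nbc oU us ss u v Wz; rewrite /= tors //.
  have := frame_mxE s (T0 u v) dz; rewrite /vfield_coord => -> E.
  rewrite mulmxBr -/L0 E.
  have aux (a d : V) : d = a - (a - d) by rewrite opprB addrCA subrr addr0.
  exact: aux.
- move=> z u v Wz; have [dz Uz _] := chart_imageP Wz; set y := param (atlas i) z.
  apply/matrixP => k j; pose w : V := delta_mx j 0.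
  have C := curvatureE ct (Ps y Uz) (sx u y Uz) (sx v y Uz) (sx w y Uz) erefl erefl erefl.
  have := congr1 (@tangent_coord R m M i y) C.
  rewrite /curvature !(tangent_coordB _ _ dz).
  rewrite -/(nablaE (nabla (a:=M)) s v w) -/(nablaE (nabla (a:=M)) s u w).
  rewrite !(second_covariant_coord nbc oU us ss _ _ _ Wz).
  rewrite (brk u v y Uz) (Lam_E nbc oU us ss) //.
  have := frame_mxE s (R0 u v *m w) dz; rewrite /vfield_coord => ->.
  have := frame_mxE s (L0 y (L0 y u *m v - L0 y v *m u - T0 u v) *m w) dz; rewrite /vfield_coord => ->.
  rewrite -!mulmxBr => /(congr1 (mulmx (invmx (frame_mx s i z)))).
  have uS : frame_mx s i z \in unitmx := frame_mx_unit us Wz.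
  rewrite !mulKmx // => E.
  have : (('D_(frame_mx s i z *m u) (fun p => L0 (param (atlas i) p) v) z 
     - 'D_(frame_mx s i z *m v) (fun p => L0 (param (atlas i) p) u) z
     + L0 y u *m L0 y v - L0 y v *m L0 y u - L0 y (L0 y u *m v - L0 y v *m u - T0 u v)) *m w) 
   = R0 u v *m w.
    rewrite -E !(mulmxBl, mulmxDl) -!mulmxA.
    have aux (a1 a2 a3 a4 a5 : V) : a1 - a2 + a3 - a4 - a5 = a1 + a3 - (a2 + a4) - a5.
      by mx_entries; ring.
    exact: aux.
  rewrite -!colE => /matrixP/(_ k 0).
  by rewrite [LHS]mxE [RHS]mxE.
Qed.

End StructureEquations.

(** * Hermitian linear algebra *)

Section Hermitian.
Variables (R : realType) (n : nat).
Local Notation H := 'cV[R]_(n + n).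
Local Notation J := (@J0 R n).
Implicit Types (X Y Z : H) (c : R).

Lemma mulJJ p (A : 'M[R]_(n + n, p)) : J *m (J *m A) = - A.
Proof.
rewrite mulmxA /J0 mulmx_block !mulmx0 !mul0mx !mulmx1 !mul1mx !addr0 !add0r.
rewrite (_ : block_mx _ _ _ _ = - 1%:M) ?mulNmx ?mul1mx //.
by rewrite (scalar_mx_block n n) opp_block_mx oppr0.
Qed.

Lemma JT : J^T = - J.
Proof. by rewrite /J0 tr_block_mx opp_block_mx !linearN /= !trmx0 trmx1 !oppr0 opprK. Qed.

Lemma h0C X Y : h0 X Y = h0 Y X.
Proof. by rewrite /h0 -[in LHS](trmxK Y) -trmx_mul mxE. Qed.
Lemma h0Dl X Y Z : h0 (X + Y) Z = h0 X Z + h0 Y Z.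
Proof. by rewrite /h0 linearD /= mulmxDl mxE. Qed.
Lemma h0Zl c X Y : h0 (c *: X) Y = c * h0 X Y.
Proof. by rewrite /h0 linearZ /= -scalemxAl mxE. Qed.
Lemma h0Dr X Y Z : h0 X (Y + Z) = h0 X Y + h0 X Z.
Proof. by rewrite h0C h0Dl !(h0C X). Qed.
Lemma h0Zr c X Y : h0 X (c *: Y) = c * h0 X Y.
Proof. by rewrite h0C h0Zl (h0C X). Qed.
Lemma h0Nl X Y : h0 (- X) Y = - h0 X Y.
Proof. by rewrite -scaleN1r h0Zl mulN1r. Qed.
Lemma h0Nr X Y : h0 X (- Y) = - h0 X Y.
Proof. by rewrite -scaleN1r h0Zr mulN1r. Qed.
Lemma h00l Y : h0 0 Y = 0. Proof. by rewrite /h0 trmx0 mul0mx mxE. Qed.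
Lemma h00r Y : h0 Y 0 = 0. Proof. by rewrite h0C h00l. Qed.

Lemma h0E X Y : h0 X Y = \sum_k X k 0 * Y k 0.
Proof. by rewrite /h0 mxE; apply: eq_bigr => k _; rewrite mxE. Qed.

Lemma h0_ge0 X : 0 <= h0 X X.
Proof. by rewrite h0E; apply: sumr_ge0 => k _; rewrite -expr2 sqr_ge0. Qed.

Lemma h0_eq0 X : (h0 X X == 0) = (X == 0).
Proof.
apply/eqP/eqP => [|->]; last by rewrite h00l.
rewrite h0E => /psumr_eq0P E; apply/colP => k; rewrite mxE.
have /eqP := E (fun k _ => sqr_ge0 _) k isT.
by rewrite mulf_eq0 orbb => /eqP.
Qed.

Lemma exists_unit_vector : (0 < n)%N -> exists X : H, h0 X X = 1.
Proof.
move=> n0; exists (delta_mx (lshift n (Ordinal n0)) 0); rewrite h0E (bigD1 (lshift n (Ordinal n0))) //=.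
rewrite big1 => [|k /negPf k0]; first by rewrite addr0 mxE !eqxx mulr1.
by rewrite mxE k0 mul0r.
Qed.

Lemma h0JJ X Y : h0 (J *m X) (J *m Y) = h0 X Y.
Proof. by rewrite /h0 trmx_mul -mulmxA JT mulNmx mulJJ opprK. Qed.
Lemma h0Jr X Y : h0 X (J *m Y) = - omega0 X Y.
Proof. by rewrite /omega0 -h0JJ mulJJ h0Nr. Qed.
Lemma h0Jl X Y : h0 (J *m X) Y = omega0 X Y. Proof. by []. Qed.

Lemma omega0C X Y : omega0 X Y = - omega0 Y X.
Proof. by rewrite -h0Jr h0C. Qed.
Lemma omega0Dl X Y Z : omega0 (X + Y) Z = omega0 X Z + omega0 Y Z.
Proof. by rewrite /omega0 mulmxDr h0Dl. Qed.
Lemma omega0Zl c X Y : omega0 (c *: X) Y = c * omega0 X Y.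
Proof. by rewrite /omega0 -scalemxAr h0Zl. Qed.
Lemma omega0Nl X Y : omega0 (- X) Y = - omega0 X Y.
Proof. by rewrite /omega0 mulmxN h0Nl. Qed.
Lemma omega0Dr X Y Z : omega0 X (Y + Z) = omega0 X Y + omega0 X Z.
Proof. by rewrite /omega0 h0Dr. Qed.
Lemma omega0Zr c X Y : omega0 X (c *: Y) = c * omega0 X Y.
Proof. by rewrite /omega0 h0Zr. Qed.
Lemma omega0Nr X Y : omega0 X (- Y) = - omega0 X Y.
Proof. by rewrite /omega0 h0Nr. Qed.
Lemma omega0Jl X Y : omega0 (J *m X) Y = - h0 X Y.
Proof. by rewrite /omega0 mulJJ h0Nl. Qed.
Lemma omega0Jr X Y : omega0 X (J *m Y) = h0 X Y.
Proof. by rewrite /omega0 h0JJ. Qed.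
Lemma omega0XX X : omega0 X X = 0.
Proof. by have := omega0C X X; lra. Qed.
Lemma omega00l Y : omega0 0 Y = 0. Proof. by rewrite /omega0 mulmx0 h00l. Qed.
Lemma omega00r Y : omega0 Y 0 = 0. Proof. by rewrite /omega0 h00r. Qed.

Definition h0_simp := (h0Dl, h0Dr, h0Zl, h0Zr, h0Nl, h0Nr, h0JJ, h0Jl, h0Jr,
  omega0Dl, omega0Dr, omega0Zl, omega0Zr, omega0Nl, omega0Nr, omega0Jl, omega0Jr, omega0XX,
  h00l, h00r, omega00l, omega00r).

Lemma outerE p (X : 'cV[R]_p) Y Z : X *m Y^T *m Z = h0 Y Z *: X.
Proof.
rewrite -mulmxA; apply/colP => k; rewrite !mxE big_ord1 mulrC; congr (_ * _).
Qed.

Lemma mx_vec_eq p (A B : 'M[R]_(p, n + n)) : (forall Z, A *m Z = B *m Z) -> A = B.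
Proof.
by move=> E; apply/matrixP => i j; have := E (delta_mx j 0); rewrite -!colE => /colP/(_ i); rewrite !mxE.
Qed.

Lemma Un_h0 A X Y : @Un R n A -> h0 (A *m X) (A *m Y) = h0 X Y.
Proof. by move=> [AA _]; rewrite /h0 trmx_mul -mulmxA (mulmxA A^T) AA mul1mx. Qed.

Lemma h0_mx_eq X Y : (forall Z, h0 Z X = h0 Z Y) -> X = Y.
Proof.
move=> E; apply/eqP; rewrite -subr_eq0 -h0_eq0 h0Dr h0Nr E subrr //.
Qed.

Lemma UnP A : (forall X Y, h0 (A *m X) (A *m Y) = h0 X Y) ->
  (forall X, A *m (J *m X) = J *m (A *m X)) -> @Un R n A.
Proof.
move=> Ah AJ; split; apply: mx_vec_eq => Z; last by rewrite -!mulmxA AJ.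
apply: h0_mx_eq => Y; rewrite mul1mx -(Ah Y Z) /h0 trmx_mul !mulmxA.
by rewrite -!mulmxA.
Qed.

Lemma Un_J A X : @Un R n A -> A *m (J *m X) = J *m (A *m X).
Proof. by move=> [_ AJ]; rewrite !mulmxA AJ. Qed.

Lemma Un_omega0 A X Y : @Un R n A -> omega0 (A *m X) (A *m Y) = omega0 X Y.
Proof. by move=> UA; rewrite /omega0 -(Un_J _ UA) Un_h0. Qed.

Lemma un_J A X : @un R n A -> A *m (J *m X) = J *m (A *m X).
Proof. by move=> [_ AJ]; rewrite !mulmxA AJ. Qed.

Lemma un_h0 A X Y : @un R n A -> h0 (A *m X) Y = - h0 X (A *m Y).
Proof. by move=> [AT _]; rewrite /h0 trmx_mul AT mulmxN mulNmx mxE -mulmxA. Qed.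

Lemma un_omega0 A X Y : @un R n A -> omega0 (A *m X) Y = - omega0 X (A *m Y).
Proof. by move=> uA; rewrite /omega0 -(un_J _ uA) un_h0. Qed.

Lemma J_Un : @Un R n J.
Proof. by split=> //; apply: mx_vec_eq => Z; rewrite -mulmxA JT mulNmx mulJJ opprK mul1mx. Qed.

(** The reflection with the complex line through X as its fixed space is unitary;
    a vector that it fixes is its own projection to that line. *)
Lemma complex_reflection X : X != 0 ->
  exists2 A, @Un R n A & A *m X = X /\
    forall Y, A *m Y = Y -> h0 X X *: Y = h0 X Y *: X + omega0 X Y *: (J *m X).
Proof.
rewrite -h0_eq0 => N0; set N := h0 X X in N0 *.
pose A : 'M[R]_(n + n) := (2 / N) *: (X *m X^T + (J *m X) *m (J *m X)^T) - 1%:M.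
have AE Y : A *m Y = (2 / N) *: (h0 X Y *: X + omega0 X Y *: (J *m X)) - Y.
  by rewrite /A mulmxBl mul1mx -scalemxAl mulmxDl !outerE.
exists A.
  apply: UnP => [Y Z|Y]; rewrite !AE.
    rewrite !h0_simp -/N (h0C Y X) (omega0C Y X).
    by field.
  rewrite !h0_simp !mulmxDr mulmxN -!scalemxAr mulmxDr -!scalemxAr mulJJ.
  by mx_entries; field.
split.
  by rewrite AE !h0_simp -/N scale0r addr0 scalerA divfK // scaler_nat mulr2n addrK.
move=> Y; rewrite AE => E.
have : (2 / N) *: (h0 X Y *: X + omega0 X Y *: (J *m X)) = 2 *: Y.
  by rewrite -[LHS](subrK Y) E scaler_nat mulr2n.
move=> /(congr1 (fun t => (N / 2) *: t)); rewrite !scalerA.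
rewrite (_ : N / 2 * (2 / N) = 1); last by field.
by rewrite scale1r divfK // => ->.
Qed.

(** The group U(n) is transitive on spheres.  With D = X - Y, the map that is the
    identity on the complex hyperplane orthogonal to D, and multiplies D by the unit
    complex number needed to send X to Y, does it. *)
Lemma Un_transitive X Y : h0 X X = h0 Y Y -> exists2 A, @Un R n A & A *m X = Y.
Proof.
move=> EN; have [->|XY] := eqVneq X Y.
  by exists 1%:M; rewrite ?mul1mx //; split; rewrite ?trmx1 !mul1mx ?mulmx1.
have [D DE] : exists D, D = X - Y by exists (X - Y).
have D0 : h0 D D != 0 by rewrite h0_eq0 DE subr_eq0.
pose p := h0 D X; pose s := omega0 D X.
have Dp : h0 D D = 2 * p.
  by rewrite /p DE !h0_simp (h0C Y X) -EN; ring.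
have p0 : p != 0 by move: D0; rewrite Dp mulf_eq0 negb_or => /andP[].
have N0 : p ^+ 2 + s ^+ 2 != 0.
  by rewrite gt_eqF // ltr_pwDl ?sqr_ge0 // exprn_even_gt0.
set N := p ^+ 2 + s ^+ 2 in N0.
pose re Z := (p * h0 D Z + s * omega0 D Z) / N.
pose im Z := (p * omega0 D Z - s * h0 D Z) / N.
pose A : 'M[R]_(n + n) := 1%:M - N^-1 *: (D *m (p *: D + s *: (J *m D))^T
   + (J *m D) *m (p *: (J *m D) - s *: D)^T).
have AE Z : A *m Z = Z - (re Z *: D + im Z *: (J *m D)).
  rewrite /A mulmxBl mul1mx -scalemxAl mulmxDl !outerE !h0_simp /re /im.
  by mx_entries; field.
exists A.
  apply: UnP => [Z T|Z]; rewrite !AE.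
    rewrite !h0_simp Dp (h0C Z D) (omega0C Z D) /re /im.
    by rewrite /N; field; rewrite -/N.
  rewrite mulmxBr mulmxDr -!scalemxAr mulJJ /re /im !h0_simp.
  by mx_entries; field.
rewrite AE.
have -> : re X = 1 by rewrite /re -/p -/s -!expr2 divff.
have -> : im X = 0 by rewrite /im -/p -/s [s * p]mulrC subrr mul0r.
by rewrite scale1r scale0r addr0 DE opprB addrCA subrr addr0.
Qed.

End Hermitian.

(** * Invariant curvature tensors of Kahler type *)

Section Kahler.
Variables (R : realType) (n : nat).
Local Notation H := 'cV[R]_(n + n).
Local Notation J := (@J0 R n).
Implicit Types (X Y Z : H).

(** The algebraic symmetries of the curvature of a Kahler metric, except for the
    skew symmetry of the operators S X Y. *)
Record kahler_like (S : H -> H -> 'M[R]_(n + n)) : Prop := {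
  kl_add : forall X Y Z, S (X + Y) Z = S X Z + S Y Z;
  kl_scale : forall c X Y, S (c *: X) Y = c *: S X Y;
  kl_anti : forall X Y, S X Y = - S Y X;
  kl_comm : forall X Y, S X Y *m J = J *m S X Y;
  kl_inv : forall X Y, S (J *m X) (J *m Y) = S X Y;
  kl_bianchi : forall X Y Z, S X Y *m Z + S Y Z *m X + S Z X *m Y = 0 }.

Lemma kl_opp S X Y : kahler_like S -> S (- X) Y = - S X Y.
Proof.
by move=> kS; rewrite -scaleN1r (kl_scale kS) scaleN1r.
Qed.

(** A Kahler curvature tensor is determined by its holomorphic sectional
    curvature: polarize S X (J X) X = 0, then use the first Bianchi identity. *)
Lemma kahler_like_eq0 S : kahler_like S -> (forall X, S X (J *m X) *m X = 0) ->
  forall X Y, S X Y = 0.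
Proof.
move=> kS S0.
have addr X Y Z : S X (Y + Z) = S X Y + S X Z.
  by rewrite (kl_anti kS) (kl_add kS) opprD -!(kl_anti kS).
have oppr X Y : S X (- Y) = - S X Y.
  by rewrite (kl_anti kS) (kl_opp _ _ kS) opprK (kl_anti kS Y).
have swapJ X Y : S (J *m X) Y = - S X (J *m Y).
  by rewrite -(kl_inv kS X) mulJJ oppr opprK.
have commJ X Y Z : S X Y *m (J *m Z) = J *m (S X Y *m Z).
  by rewrite !mulmxA (kl_comm kS).
have pol X Z : S X (J *m X) *m Z = - 2 *: (S X (J *m Z) *m X).
  have E1 := S0 (X + Z); have E2 := S0 (X - Z).
  have E3 : S Z (J *m X) = S X (J *m Z) by rewrite -[LHS]opprK -swapJ (kl_anti kS (J *m Z)) opprK.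
  move: E1 E2; rewrite !mulmxDr !mulmxN !(kl_add kS) !addr ?(kl_opp _ _ kS) ?oppr ?E3.
  rewrite !mulmxDl !mulNmx !S0 => /matrixP E1 /matrixP E2.
  apply/matrixP => i j; move: (E1 i j) (E2 i j).
  by rewrite !(addmxE, oppmxE, scalemxE, zeromxE); lra.
have SX X Z : S X (J *m X) *m Z = 0.
  have := kl_bianchi kS X (J *m X) Z.
  have -> : S (J *m X) Z *m X = 2^-1 *: (S X (J *m X) *m Z).
    by rewrite swapJ pol scalerA mulrN mulVf // scaleN1r mulNmx.
  have -> : S Z X *m (J *m X) = 2^-1 *: (S X (J *m X) *m Z).
    have := pol X (J *m Z); rewrite commJ mulJJ oppr mulNmx => E.
    rewrite commJ (kl_anti kS Z X) mulNmx mulmxN.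
    have -> : S X Z *m X = 2^-1 *: (J *m (S X (J *m X) *m Z)).
      by rewrite E scalerA scalerN -scaleNr mulrN mulVf // opprK scale1r.
    by rewrite -scalemxAr mulJJ scalerN opprK.
  move=> /matrixP E; apply/matrixP => i j; move: (E i j).
  by rewrite !(addmxE, scalemxE, zeromxE); lra.
move=> X Y; apply: mx_vec_eq => Z; rewrite mul0mx.
have := SX (X + J *m Y) Z.
rewrite mulmxDr (kl_add kS) !addr !mulmxDl !SX mulJJ oppr (kl_inv kS) (kl_anti kS Y X).
by rewrite mulNmx => /matrixP E; apply/matrixP => i j; move: (E i j);
   rewrite !(addmxE, oppmxE, zeromxE); lra.
Qed.

(** The endomorphism [K] X Y as a matrix. *)
Definition Kmx X Y : 'M[R]_(n + n) :=
  4^-1 *: (X *m Y^T - Y *m X^T + (J *m X) *m (J *m Y)^T - (J *m Y) *m (J *m X)^T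
           - (2 * omega0 X Y) *: J).

Lemma KmxE X Y Z : Kmx X Y *m Z = K X Y Z.
Proof.
rewrite /Kmx /K -scalemxAl !(mulmxDl, mulmxBl, mulNmx) !outerE -scalemxAl.
by rewrite ![h0 (J *m _) Z]/=.
Qed.

Lemma K_kahler : kahler_like Kmx.
Proof.
split=> [X Y Z|c X Y|X Y|X Y|X Y|X Y Z].
- apply: mx_vec_eq => T; rewrite mulmxDl !KmxE /K !mulmxDr !h0_simp.
  by mx_entries; ring.
- apply: mx_vec_eq => T; rewrite -scalemxAl !KmxE /K -!scalemxAr !h0_simp.
  by mx_entries; ring.
- apply: mx_vec_eq => T; rewrite mulNmx !KmxE /K (omega0C Y X).
  by mx_entries; ring.
- apply: mx_vec_eq => T; rewrite -!mulmxA !KmxE /K !h0_simp -!scalemxAr.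
  rewrite !(mulmxDr, mulmxN) -!scalemxAr !mulJJ.
  by mx_entries; ring.
- apply: mx_vec_eq => T; rewrite !KmxE /K !h0_simp !mulJJ.
  by mx_entries; ring.
- rewrite !KmxE /K (h0C Z X) (h0C Z Y) (h0C Y X) (omega0C Z X) (omega0C Z Y) (omega0C Y X).
  by mx_entries; ring.
Qed.

Lemma K_hol X : Kmx X (J *m X) *m X = - (h0 X X *: (J *m X)).
Proof.
rewrite KmxE /K !h0_simp mulJJ.
by mx_entries; field.
Qed.

Lemma kahler_sub_scale S (k : R) : kahler_like S -> kahler_like (fun X Y => S X Y - k *: Kmx X Y).
Proof.
move=> kS; have kK := K_kahler; split=> [X Y Z|c X Y|X Y|X Y|X Y|X Y Z].
- by rewrite (kl_add kS) (kl_add kK); mx_entries; ring.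
- by rewrite (kl_scale kS) (kl_scale kK); mx_entries; ring.
- by rewrite (kl_anti kS) (kl_anti kK X Y); mx_entries; ring.
- by rewrite mulmxBl mulmxBr (kl_comm kS) -scalemxAl -scalemxAr (kl_comm kK).
- by rewrite (kl_inv kS) (kl_inv kK).
- rewrite !mulmxBl -!(scalemxAl k).
  have aux (a1 a2 a3 b1 b2 b3 : H) : a1 + a2 + a3 = 0 -> b1 + b2 + b3 = 0 ->
      a1 - k *: b1 + (a2 - k *: b2) + (a3 - k *: b3) = 0.
    rewrite -!addrA => /eqP; rewrite addr_eq0 => /eqP -> /eqP.
    by rewrite addr_eq0 => /eqP ->; mx_entries; ring.
  exact: aux (kl_bianchi kS X Y Z) (kl_bianchi kK X Y Z).
Qed.

(** The vector S X (J X) X is fixed by the stabilizer of X in U(n), hence is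
    a combination of X and J X, and is orthogonal to X.  So it equals q X (J X) / |X|^2,
    where q is invariant and homogeneous of degree 4, hence proportional to |X|^4 by
    transitivity on spheres.  Subtracting a multiple of K makes the holomorphic
    sectional curvature vanish, and [kahler_like_eq0] applies. *)
Theorem invariant_kahler_curvature S : (0 < n)%N -> kahler_like S ->
  (forall X Y, @un R n (S X Y)) ->
  (forall A X Y, @Un R n A -> S (A *m X) (A *m Y) *m A = A *m S X Y) ->
  exists k : R, forall X Y, S X Y = k *: Kmx X Y.
Proof.
move=> n0 kS uS eS.
pose q X := h0 (J *m X) (S X (J *m X) *m X).
have qE X : h0 X X *: (S X (J *m X) *m X) = q X *: (J *m X).
  have [->|X0] := eqVneq X 0; first by rewrite !mulmx0 !scaler0.
  have [A UA [AX fixA]] := complex_reflection X0.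
  have AY : A *m (S X (J *m X) *m X) = S X (J *m X) *m X.
    have := eS A X (J *m X) UA.
    rewrite (Un_J _ UA) AX => E; by rewrite mulmxA -E -mulmxA AX.
  rewrite (fixA _ AY) /q.
  have -> : h0 X (S X (J *m X) *m X) = 0.
    by have := un_h0 X X (uS X (J *m X)); rewrite h0C; lra.
  by rewrite scale0r add0r.
have qU A X : @Un R n A -> q (A *m X) = q X.
  move=> UA; rewrite /q -!(Un_J _ UA) (mulmxA _ A X) (eS _ _ _ UA) -mulmxA.
  by rewrite Un_h0.
have [X1 X11] := exists_unit_vector R n0.
have scaler (c : R) X Y : S X (c *: Y) = c *: S X Y.
  by rewrite (kl_anti kS) (kl_scale kS) -scalerN -(kl_anti kS).
have qX X : q X = (h0 X X) ^+ 2 * q X1.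
  pose c := Num.sqrt (h0 X X).
  have cc : c ^+ 2 = h0 X X by rewrite sqr_sqrtr // h0_ge0.
  have [A UA AX] : exists2 A, @Un R n A & A *m (c *: X1) = X.
    by apply: Un_transitive; rewrite !h0_simp X11 mulr1 -expr2 cc.
  rewrite -[in LHS]AX qU // /q -!scalemxAr (kl_scale kS) scaler -!scalemxAl !h0_simp -cc.
  by ring.
exists (- q X1) => X Y; apply/eqP; rewrite -subr_eq0; apply/eqP; move: X Y.
apply: (kahler_like_eq0 (kahler_sub_scale (- q X1) kS)) => X.
rewrite mulmxBl -scalemxAl K_hol.
have [->|X0] := eqVneq X 0; first by rewrite !mulmx0 !scaler0 oppr0 scaler0 subr0.
have N0 : h0 X X != 0 by rewrite h0_eq0.
apply: (scalerI N0); rewrite scaler0 scalerBr qE qX.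
by mx_entries; ring.
Qed.

End Kahler.

(** * The equivariant tensors lam, Tm and Rm *)

Section Blocks.
Variables (R : realType) (n : nat).
Local Notation H := 'cV[R]_(n + n).
Local Notation V := 'cV[R]_(n + n + 1).
Local Notation J := (@J0 R n).

Definition top (u : V) : H := usubmx u.
Definition bot (u : V) : R := dsubmx u 0 0.

Lemma split_col (u : V) : u = col_mx (top u) (bot u)%:M.
Proof. by rewrite /top /bot -mx11_scalar vsubmxK. Qed.
Lemma top_col X (s : R) : top (col_mx X s%:M) = X. Proof. exact: col_mxKu. Qed.
Lemma bot_col X (s : R) : bot (col_mx X s%:M) = s.
Proof. by rewrite /bot col_mxKd mxE. Qed.

Lemma V_eq (u v : V) : top u = top v -> bot u = bot v -> u = v.
Proof. by move=> E1 E2; rewrite (split_col u) (split_col v) E1 E2. Qed.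

Lemma topD u v : top (u + v) = top u + top v. Proof. exact: linearD. Qed.
Lemma topZ c u : top (c *: u) = c *: top u. Proof. exact: linearZ. Qed.
Lemma topN u : top (- u) = - top u. Proof. exact: linearN. Qed.
Lemma bot0 : bot 0 = 0. Proof. by rewrite /bot linear0 mxE. Qed.
Lemma botD u v : bot (u + v) = bot u + bot v. Proof. by rewrite /bot linearD mxE. Qed.
Lemma botZ c u : bot (c *: u) = c * bot u. Proof. by rewrite /bot linearZ mxE. Qed.
Lemma botN u : bot (- u) = - bot u. Proof. by rewrite /bot linearN mxE. Qed.

Lemma flat_mul (X Y : H) : flat X *m Y = (h0 X Y)%:M.
Proof. by rewrite [LHS]mx11_scalar. Qed.

Lemma top_block (A : 'M[R]_(n + n)) B C D (u : V) :
  top (block_mx A B C D *m u) = A *m top u + bot u *: B.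
Proof.
rewrite [in LHS](split_col u) mul_block_col mul_mx_scalar; exact: col_mxKu.
Qed.

Lemma bot_block (A : 'M[R]_(n + n)) B (Z : H) (s : R) (u : V) :
  bot (block_mx A B (flat Z) s%:M *m u) = h0 Z (top u) + s * bot u.
Proof.
rewrite [in LHS](split_col u) mul_block_col flat_mul -scalar_mxM -raddfD.
exact: bot_col.
Qed.

Lemma bot_block0 (A : 'M[R]_(n + n)) B (s : R) (u : V) :
  bot (block_mx A B 0 s%:M *m u) = s * bot u.
Proof.
rewrite [in LHS](split_col u) mul_block_col mul0mx add0r -scalar_mxM.
exact: bot_col.
Qed.

Lemma bot_block00 (A : 'M[R]_(n + n)) B (u : V) : bot (block_mx A B 0 0 *m u) = 0.
Proof.
by rewrite [in LHS](split_col u) mul_block_col !mul0mx add0r /bot col_mxKd mxE.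
Qed.

Lemma top_inH (X : H) : top (inH X) = X. Proof. exact: col_mxKu. Qed.
Lemma bot_inH (X : H) : bot (inH X) = 0. Proof. by rewrite /bot col_mxKd mxE. Qed.
Lemma top_e : top (@e R n) = 0. Proof. exact: col_mxKu. Qed.
Lemma bot_e : bot (@e R n) = 1. Proof. by rewrite /bot col_mxKd mxE. Qed.

Lemma inH_e (u : V) : u = inH (top u) + bot u *: e.
Proof.
by apply: V_eq; rewrite ?topD ?botD ?topZ ?botZ ?top_inH ?bot_inH ?top_e ?bot_e
  ?scaler0 ?addr0 ?mulr1 ?add0r.
Qed.

Lemma mxV_eq (A B : 'M[R]_(n + n + 1)) : (forall u : V, A *m u = B *m u) -> A = B.
Proof.
move=> E; apply/matrixP => i j; have := E (delta_mx j 0).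
by rewrite -!colE => /colP/(_ i); rewrite !mxE.
Qed.

(** The complex structure of H0, extended by 0 to V. *)
Definition Jv : 'M[R]_(n + n + 1) := block_mx J 0 0 0.

(** Linear equations for u(n) + 0 in gl(V), which can be differentiated. *)
Lemma un0P B : @un0 R n B <-> [/\ B^T = - B, B *m e = 0 & B *m Jv = Jv *m B].
Proof.
split=> [[A [AT AJ] <-]|[BT Be BJ]].
  split.
  - by rewrite tr_block_mx !trmx0 AT opp_block_mx !oppr0.
  - by rewrite /e mul_block_col !mulmx0 !mul0mx !addr0 col_mx0.
  - by rewrite /Jv !mulmx_block !(mulmx0, mul0mx) !addr0 AJ.
have E := submxK B.
have ur0 : ursubmx B = 0 /\ drsubmx B = 0.
  move: Be; rewrite -E /e mul_block_col !mulmx0 !mulmx1 !add0r block_mxKur block_mxKdr.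
  by rewrite -(col_mx0 R (n + n) 1 1) => /eq_col_mx[].
have dl0 : dlsubmx B = 0.
  apply: trmx_inj; rewrite trmx_dlsub BT trmx0.
  by rewrite (_ : - B = (-1) *: B) ?scaleN1r // /ursubmx !linearN /= -/(ursubmx B) ur0.1 oppr0.
have [A EB] : exists A, B = block_mx A 0 0 0.
  by exists (ulsubmx B); rewrite -{1}E ur0.1 ur0.2 dl0.
move: BT BJ; rewrite EB tr_block_mx opp_block_mx => /eq_block_mx[AT _ _ _].
rewrite /Jv !mulmx_block !(mulmx0, mul0mx) !addr0 => /eq_block_mx[AJ _ _ _].
by exists A.
Qed.

Lemma un0_act B : @un0 R n B -> exists2 A, @un R n A &
  (forall u : V, top (B *m u) = A *m top u) /\ (forall u : V, bot (B *m u) = 0).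
Proof.
move=> [A uA <-]; exists A => //; split=> u; last exact: bot_block00.
by rewrite top_block scaler0 addr0.
Qed.

Lemma Un1_act g : @Un1 R n g -> exists2 A, @Un R n A &
  (forall u : V, top (g *m u) = A *m top u) /\ (forall u : V, bot (g *m u) = bot u).
Proof.
move=> [A UA <-]; exists A => //; split=> u; last by rewrite bot_block0 mul1r.
by rewrite top_block scaler0 addr0.
Qed.

End Blocks.

Section Tensors.
Variables (R : realType) (n : nat) (a b alpha beta gamma delta mu nu sig : R).
Local Notation H := 'cV[R]_(n + n).
Local Notation V := 'cV[R]_(n + n + 1).
Local Notation J := (@J0 R n).
Implicit Types (u v w : V) (X Y Z : H).

Definition Pl X : H := alpha *: X + beta *: (J *m X).
Definition Ql X : H := gamma *: X + delta *: (J *m X).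
Definition Nl X : H := mu *: X + nu *: (J *m X).

(** The lift of the inner torsion, on the whole of V. *)
Definition lam u : 'M[R]_(n + n + 1) :=
  block_mx (a * bot u)%:M (Pl (top u)) (flat (Ql (top u))) (b * bot u)%:M.
(** The general equivariant alternating map for which Tm (H0, H0) is along e and
    Tm (H0, e) along H0; with the parameters of [Tm_of_T0], it is the torsion that
    remains once the contribution of lam has been removed. *)
Definition Tm u v : V :=
  col_mx (bot v *: Nl (top u) - bot u *: Nl (top v)) (sig * omega0 (top u) (top v))%:M.
(** The curvature of the unitary part of the connection. *)
Definition Rm1 (k : R) u v : 'M[R]_(n + n + 1) :=
  block_mx (k *: Kmx (top u) (top v) - (sig * nu * omega0 (top u) (top v)) *: J) 0 0 0.
(** The curvature after adding lam to a connection of torsion [Tm] and curvature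
    [Rm1]; there are no derivatives of lam in it, because lam is equivariant, hence
    parallel for a connection that preserves the structure. *)
Definition Rm (k : R) u v := Rm1 k u v + lam (Tm u v) + (lam u *m lam v - lam v *m lam u).

Lemma top_lam u v : top (lam u *m v) = (a * bot u) *: top v + bot v *: Pl (top u).
Proof. by rewrite /lam top_block mul_scalar_mx. Qed.
Lemma bot_lam u v : bot (lam u *m v) = h0 (Ql (top u)) (top v) + b * bot u * bot v.
Proof. by rewrite /lam bot_block. Qed.
Lemma top_Tm u v : top (Tm u v) = bot v *: Nl (top u) - bot u *: Nl (top v).
Proof. exact: top_col. Qed.
Lemma bot_Tm u v : bot (Tm u v) = sig * omega0 (top u) (top v).
Proof. exact: bot_col. Qed.
Lemma top_Rm1 k u v w : top (Rm1 k u v *m w) =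
  k *: (Kmx (top u) (top v) *m top w) - (sig * nu * omega0 (top u) (top v)) *: (J *m top w).
Proof. by rewrite /Rm1 top_block scaler0 addr0 mulmxBl -!scalemxAl. Qed.
Lemma bot_Rm1 k u v w : bot (Rm1 k u v *m w) = 0.
Proof. exact: bot_block00. Qed.

Lemma lam_linear c u v : lam (c *: u + v) = c *: lam u + lam v.
Proof.
apply: mxV_eq => w; rewrite mulmxDl -scalemxAl; apply: V_eq.
  rewrite topD topZ !top_lam topD topZ botD botZ /Pl !mulmxDr -!scalemxAr.
  by mx_entries; ring.
rewrite botD botZ !bot_lam topD topZ botD botZ /Ql !mulmxDr -!scalemxAr !h0_simp.
by ring.
Qed.
Lemma lamD u v : lam (u + v) = lam u + lam v.
Proof. by have := lam_linear 1 u v; rewrite !scale1r. Qed.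
Lemma lamN u : lam (- u) = - lam u.
Proof.
apply: mxV_eq => w; rewrite mulNmx; apply: V_eq.
  rewrite topN !top_lam topN botN /Pl !mulmxN.
  by mx_entries; ring.
rewrite botN !bot_lam topN botN /Ql !mulmxN !h0_simp.
by ring.
Qed.

Lemma Tm_linear c u v w : Tm (c *: u + v) w = c *: Tm u w + Tm v w.
Proof.
apply: V_eq; rewrite ?(topD, topZ, botD, botZ) ?(top_Tm, bot_Tm) ?(topD, topZ, botD, botZ).
  by rewrite /Nl !mulmxDr -!scalemxAr; mx_entries; ring.
by rewrite !h0_simp; ring.
Qed.
Lemma Tm_anti u v : Tm u v = - Tm v u.
Proof.
apply: V_eq; rewrite ?topN ?botN ?(top_Tm, bot_Tm).
  by mx_entries; ring.
by rewrite omega0C; ring.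
Qed.
Lemma TmB u v w : Tm (u - v) w = Tm u w - Tm v w.
Proof. by have := Tm_linear (-1) v u w; rewrite !scaleN1r ![- _ + _]addrC. Qed.

(** Infinitesimal equivariance of lam. *)
Lemma lam_un0 B v : @un0 R n B -> B *m lam v - lam v *m B = lam (B *m v).
Proof.
move=> /un0_act[A uA [tB bB]]; apply: mxV_eq => w; rewrite mulmxBl -!mulmxA.
apply: V_eq.
  rewrite topD topN tB !top_lam !tB !bB mulr0 scale0r !mulmxDr -!scalemxAr /Pl.
  by rewrite !mulmxDr -!scalemxAr -!(un_J _ uA); mx_entries; ring.
rewrite botD botN bB !bot_lam !tB !bB /Ql !h0_simp.
by rewrite (un_h0 (top v) _ uA) (un_omega0 (top v) _ uA); ring.
Qed.

Lemma Tm_un0 B v w : @un0 R n B -> B *m Tm v w = Tm (B *m v) w + Tm v (B *m w).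
Proof.
move=> /un0_act[A uA [tB bB]]; apply: V_eq.
  rewrite topD tB !top_Tm !tB !bB /Nl !mulmxDr mulmxN -!scalemxAr !mulmxDr -!scalemxAr -!(un_J _ uA).
  by mx_entries; ring.
by rewrite botD bB !bot_Tm !tB (un_omega0 _ _ uA); ring.
Qed.

Lemma lam_Un1 g v : @Un1 R n g -> g *m lam v = lam (g *m v) *m g.
Proof.
move=> /Un1_act[A UA [tg bg]]; apply: mxV_eq => w; rewrite -!mulmxA.
apply: V_eq.
  rewrite tg !top_lam !tg !bg !mulmxDr -!scalemxAr /Pl.
  by rewrite !mulmxDr -!scalemxAr -!(Un_J _ UA).
rewrite bg !bot_lam !tg !bg /Ql -!(Un_J _ UA) !h0Dl !h0Zl.
by rewrite !(Un_h0 _ _ UA).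
Qed.

Lemma Tm_Un1 g v w : @Un1 R n g -> g *m Tm v w = Tm (g *m v) (g *m w).
Proof.
move=> /Un1_act[A UA [tg bg]]; apply: V_eq.
  rewrite tg !top_Tm !tg !bg /Nl !mulmxDr !mulmxN -!scalemxAr !mulmxDr -!scalemxAr -!(Un_J _ UA).
  by [].
by rewrite bg !bot_Tm !tg (Un_omega0 _ _ UA).
Qed.

(** The parameters mu, nu and sig are those of the theorem: T0 and the
    alternation of lam have the same shape as [Tm], and their parameters subtract. *)
Lemma Tm_of_T0 (T0 : V -> V -> V) (tau1 tau2 tau3 : R) :
  mu = tau1 - alpha + a -> nu = tau2 - beta -> sig = tau3 - 2 * delta ->
  alternating_bilinear T0 ->
  (forall X Y : H, T0 (inH X) (inH Y) = (tau3 * omega0 X Y) *: e) ->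
  (forall X : H, T0 (inH X) e = inH (tau1 *: X + tau2 *: (J *m X))) ->
  forall u v, T0 u v = Tm u v + lam u *m v - lam v *m u.
Proof.
move=> Emu Enu Esig [lin anti] TXY TXe u v.
have linr c x y z : T0 x (c *: y + z) = c *: T0 x y + T0 x z.
  by rewrite anti lin opprD -scalerN -!anti.
have Tee : T0 e e = 0.
  have := anti e e; move=> /eqP; rewrite -addr_eq0 -mulr2n => /eqP.
  by move=> /matrixP E; apply/matrixP => i j; move: (E i j); rewrite !mxE; lra.
have -> : T0 u v = T0 (bot u *: e + inH (top u)) (bot v *: e + inH (top v)).
  by rewrite ![_ *: e + _]addrC -!inH_e.
rewrite lin !linr Tee TXY TXe (anti e) TXe.
apply: V_eq; rewrite ?(topD, topN, topZ, botD, botN, botZ) ?(top_lam, bot_lam, top_Tm, bot_Tm)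
   ?(topN, topZ, top_inH, bot_inH, top_e, bot_e) ?(botN, botZ, bot_inH, bot_e, top_e) ?(bot_inH, top_inH).
  by rewrite /Nl /Pl Emu Enu; mx_entries; rewrite ?mxE; ring.
by rewrite /Ql !h0_simp (h0C (top v) (top u)) (omega0C (top v) (top u)) Esig bot0; ring.
Qed.

End Tensors.

(** * Necessity *)

(** Differentiate the linear equations of [un0P]. *)
Lemma derive_un0 (R : realType) n p (W : set 'cV[R]_p) (B : 'cV[R]_p -> 'M[R]_(n + n + 1)) v z :
  open W -> W z -> C_infty W B -> (forall y, W y -> @un0 R n (B y)) -> @un0 R n ('D_v B z).
Proof.
move=> oW Wz sB uB; apply/un0P; split.
- apply/matrixP => i j; rewrite mxE oppmxE !(derive_entry _ _ _ sB Wz).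
  rewrite -[RHS](@deriveN _ _ _ (fun y => B y i j : R^o)); last first.
    exact: C_infty_derivable (smooth_entry i j oW sB) Wz.
  apply: (derive_eq_on _ oW Wz) => y; rewrite inE => /uB/un0P[/matrixP/(_ i j) + _ _].
  by rewrite mxE oppmxE.
- rewrite -(derive_mulmxc e v oW Wz sB) -(derive_cst (0 : 'cV[R]_(n + n + 1)) z v).
  by apply: (derive_eq_on _ oW Wz) => y; rewrite inE => /uB/un0P[].
- rewrite -(derive_mulmxc (@Jv R n) v oW Wz sB) -(derive_mulcmx (@Jv R n) v oW Wz sB).
  by apply: (derive_eq_on _ oW Wz) => y; rewrite inE => /uB/un0P[].
Qed.

Section Un0.
Variables (R : realType) (n : nat).
Implicit Types B C : 'M[R]_(n + n + 1).

Lemma un0_0 : @un0 R n 0.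
Proof. by apply/un0P; rewrite trmx0 oppr0 !mul0mx mulmx0. Qed.
Lemma un0D B C : @un0 R n B -> @un0 R n C -> @un0 R n (B + C).
Proof.
move=> /un0P[BT Be BJ] /un0P[CT Ce CJ]; apply/un0P; split.
- by rewrite linearD /= BT CT opprD.
- by rewrite mulmxDl Be Ce addr0.
- by rewrite mulmxDl mulmxDr BJ CJ.
Qed.
Lemma un0N B : @un0 R n B -> @un0 R n (- B).
Proof.
move=> /un0P[BT Be BJ]; apply/un0P; split.
- by rewrite linearN /= BT.
- by rewrite mulNmx Be oppr0.
- by rewrite mulNmx mulmxN BJ.
Qed.
Lemma un0B B C : @un0 R n B -> @un0 R n C -> @un0 R n (B - C).
Proof. by move=> uB uC; apply: un0D => //; exact: un0N. Qed.
Lemma un0Z c B : @un0 R n B -> @un0 R n (c *: B).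
Proof.
move=> /un0P[BT Be BJ]; apply/un0P; split.
- by rewrite linearZ /= BT scalerN.
- by rewrite -scalemxAl Be scaler0.
- by rewrite -scalemxAl -scalemxAr BJ.
Qed.
Lemma un0_comm B C : @un0 R n B -> @un0 R n C -> @un0 R n (B *m C - C *m B).
Proof.
move=> /un0P[BT Be BJ] /un0P[CT Ce CJ]; apply/un0P; split.
- by rewrite linearB /= !trmx_mul BT CT !mulNmx !mulmxN !opprK opprB.
- by rewrite mulmxBl -!mulmxA Be Ce !mulmx0 subrr.
- by rewrite mulmxBl mulmxBr -!mulmxA BJ CJ !mulmxA BJ CJ.
Qed.

Lemma trace_Jv_comm B C : @un0 R n C -> \tr (@Jv R n *m (B *m C - C *m B)) = 0.
Proof.
move=> /un0P[_ _ CJ]; rewrite mulmxBr linearB /= mulmxA mxtrace_mulC mulmxA.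
by rewrite CJ -mulmxA subrr.
Qed.
End Un0.

Section InvariantCurvature.
Variables (R : realType) (n : nat) (mu nu sig : R).
Local Notation H := 'cV[R]_(n + n).
Local Notation V := 'cV[R]_(n + n + 1).
Local Notation J := (@J0 R n).
Local Notation Tm := (@Tm R n mu nu sig).
Local Notation un0 := (@un0 R n).
Variable R1 : V -> V -> 'M[R]_(n + n + 1).
Hypothesis n0 : (0 < n)%N.
Hypothesis R1_linear : forall c u v w, R1 (c *: u + v) w = c *: R1 u w + R1 v w.
Hypothesis R1_anti : forall u v, R1 u v = - R1 v u.
Hypothesis R1_un0 : forall u v, un0 (R1 u v).
Hypothesis R1_equivariant : forall g u v, @Un1 R n g -> R1 (g *m u) (g *m v) *m g = g *m R1 u v.
Hypothesis R1_bianchi : forall u v w, R1 u v *m w + R1 v w *m u + R1 w u *m v =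
  Tm (Tm u v) w + Tm (Tm v w) u + Tm (Tm w u) v.
Implicit Types (u v w : V) (X Y Z : H).

(** The element -1 of U(n), extended by 1 on e, commutes with R1 (X, e) and
    changes its sign. *)
Lemma R1_e u : R1 (inH (top u)) e = 0.
Proof.
set B := R1 _ _; have uB : un0 B := R1_un0 _ _.
pose g : 'M[R]_(n + n + 1) := block_mx (- 1%:M) 0 0 1%:M.
have Ug : @Un1 R n g.
  exists (- 1%:M) => //; apply: UnP => [X Y|X]; rewrite !mulNmx !mul1mx ?mulmxN //.
  by rewrite h0Nl h0Nr opprK.
have gX : g *m inH (top u) = - inH (top u).
  by rewrite /g /inH mul_block_col !(mulmx0, mul0mx) !addr0 mulNmx mul1mx opp_col_mx oppr0.
have ge : g *m e = e.
  by rewrite /g /e mul_block_col !(mulmx0, mul0mx) !add0r mul1mx.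
have gB : g *m B = - B /\ B *m g = - B.
  case: uB => A _ <-; rewrite /g !mulmx_block !(mulmx0, mul0mx) !addr0.
  by rewrite mulNmx mul1mx mulmxN mulmx1 !opp_block_mx !oppr0.
have := R1_equivariant (inH (top u)) e Ug; rewrite gX ge.
have -> : R1 (- inH (top u)) e = - B.
  have := R1_linear (-1) (inH (top u)) 0 e; rewrite addr0 !scaleN1r => ->.
  have -> : R1 0 e = 0; last by rewrite addr0.
  have := R1_linear 1 0 0 e; rewrite !scale1r addr0 => /eqP.
  by rewrite -subr_eq0 opprD addrA subrr sub0r oppr_eq0 => /eqP.
rewrite mulNmx gB.1 gB.2 opprK => /matrixP E; apply/matrixP => i j; move: (E i j).
by rewrite oppmxE zeromxE; lra.
Qed.

Lemma R1_top u v : R1 u v = R1 (inH (top u)) (inH (top v)).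
Proof.
have linr c x y z : R1 x (c *: y + z) = c *: R1 x y + R1 x z.
  by rewrite R1_anti R1_linear opprD -scalerN -!R1_anti.
have ee : R1 e e = 0.
  have := R1_anti e e => /matrixP E; apply/matrixP => i j; move: (E i j).
  by rewrite oppmxE zeromxE; lra.
rewrite [in LHS](inH_e u) [in LHS](inH_e v) ![inH _ + _ *: e]addrC R1_linear !linr ee.
by rewrite (R1_anti e (inH _)) !R1_e oppr0 !(scaler0, addr0, add0r).
Qed.

(** The Bianchi identity on X, J X, e with X a unit vector: the left-hand side has no
    component along e, because R1 is u(n)-valued and vanishes on (H0, e); that of the
    right-hand side is a multiple of sig * mu. *)
Lemma sig_mu : sig * mu = 0.
Proof.
have [X XX] := exists_unit_vector R n0.
have P1 : R1 (inH X) (inH (J *m X)) *m e = 0.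
  by have /un0P[] := R1_un0 (inH X) (inH (J *m X)).
have P2 : R1 (inH (J *m X)) e *m inH X = 0.
  by have := R1_e (inH (J *m X)); rewrite top_inH => ->; rewrite mul0mx.
have P3 : R1 e (inH X) *m inH (J *m X) = 0.
  by have := R1_e (inH X); rewrite top_inH R1_anti => /eqP; rewrite oppr_eq0 => /eqP ->; rewrite mul0mx.
have := etrans (esym (R1_bianchi (inH X) (inH (J *m X)) e))
  (congr2 +%R (congr2 +%R P1 P2) P3).
rewrite !addr0 => /(congr1 (@bot R n)).
rewrite bot0 !botD !bot_Tm !top_Tm !(top_inH, bot_inH, top_e, bot_e) /Nl.
rewrite !h0_simp ?mulJJ ?h0_simp XX; lra.
Qed.

Definition r1 X Y : 'M[R]_(n + n) := ulsubmx (R1 (inH X) (inH Y)).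

Lemma r1E X Y : R1 (inH X) (inH Y) = block_mx (r1 X Y) 0 0 0 /\ @un R n (r1 X Y).
Proof.
have [A uA E] := R1_un0 (inH X) (inH Y).
by rewrite /r1 -E block_mxKul.
Qed.

Lemma R1_act u v w : top (R1 u v *m w) = r1 (top u) (top v) *m top w.
Proof. by rewrite R1_top (r1E _ _).1 top_block scaler0 addr0. Qed.

(** The correction by sig nu omega0 J absorbs the right-hand side Tm o Tm of the
    Bianchi identity on H0. *)
Definition s1 X Y := r1 X Y + (sig * nu * omega0 X Y) *: J.

Lemma r1_equivariant A X Y : @Un R n A -> r1 (A *m X) (A *m Y) *m A = A *m r1 X Y.
Proof.
move=> UA; apply: mx_vec_eq => Z.
have Ug : @Un1 R n (block_mx A 0 0 1%:M) by exists A.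
have E := congr1 (fun B : 'M[R]_(n + n + 1) => top (B *m inH Z))
  (R1_equivariant (inH X) (inH Y) Ug).
have tg (x : V) : top (block_mx A 0 0 1%:M *m x) = A *m top x.
  by rewrite top_block scaler0 addr0.
by move: E; rewrite -!mulmxA R1_act !tg R1_act !top_inH.
Qed.

Lemma inH_linear c X Y : inH (c *: X + Y) = c *: inH X + inH Y.
Proof. by rewrite /inH scale_col_mx add_col_mx scaler0 addr0. Qed.

Lemma r1_act X Y Z : r1 X Y *m Z = top (R1 (inH X) (inH Y) *m inH Z).
Proof. by rewrite R1_act !top_inH. Qed.

Lemma r1_linear c X Y Z : r1 (c *: X + Y) Z = c *: r1 X Z + r1 Y Z.
Proof.
apply: mx_vec_eq => T; rewrite mulmxDl -scalemxAl !r1_act inH_linear.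
by rewrite (R1_linear c (inH X) (inH Y) (inH Z)) mulmxDl -scalemxAl topD topZ.
Qed.

Lemma r1_anti X Y : r1 X Y = - r1 Y X.
Proof.
apply: mx_vec_eq => T; rewrite mulNmx !r1_act.
by rewrite (R1_anti (inH X) (inH Y)) mulNmx topN.
Qed.

Lemma s1_kahler : kahler_like s1.
Proof.
have lin c X Y Z : s1 (c *: X + Y) Z = c *: s1 X Z + s1 Y Z.
  rewrite /s1 r1_linear omega0Dl omega0Zl.
  by mx_entries; ring.
have s0 Y : s1 0 Y = 0.
  have := lin 1 0 0 Y; rewrite !scale1r addr0 => /eqP.
  by rewrite -subr_eq0 opprD addrA subrr sub0r oppr_eq0 => /eqP.
split.
- by move=> X Y Z; have := lin 1 X Y Z; rewrite !scale1r.
- by move=> c X Y; have := lin c X 0 Y; rewrite !addr0 s0 addr0.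
- move=> X Y; rewrite /s1 r1_anti omega0C.
  by mx_entries; ring.
- move=> X Y; have [_ [_ E]] := r1E X Y.
  by rewrite /s1 mulmxDl mulmxDr E -scalemxAl -scalemxAr.
- move=> X Y; rewrite /s1 (Un_omega0 _ _ (J_Un R n)); congr (_ + _).
  have := r1_equivariant X Y (J_Un R n).
  have [_ [_ <-]] := r1E X Y.
  move=> /(congr1 (fun B => - (B *m J))); rewrite -!mulmxA.
  have JJ : J *m J = - 1%:M by have := mulJJ (1%:M : 'M[R]_(n + n)); rewrite mulmx1.
  by rewrite JJ !mulmxN !mulmx1 !opprK.
- move=> X Y Z; have := congr1 (@top R n) (R1_bianchi (inH X) (inH Y) (inH Z)).
  rewrite !topD !R1_act !top_Tm !bot_Tm !(top_inH, bot_inH) /s1 !mulmxDl -!scalemxAl.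
  have sm : sig * mu = 0 := sig_mu.
  move=> /matrixP E; apply/matrixP => i j; move: (E i j).
  rewrite /Nl !scale0r !(addmxE, oppmxE, scalemxE, zeromxE).
  set x := (J *m X) i j; set y := (J *m Y) i j; set z := (J *m Z) i j.
  have sm2 t : sig * t * mu = 0 by rewrite mulrAC sm mul0r.
  rewrite !mulrDr !(mulrA _ mu) !sm2; lra.
Qed.

Lemma invariant_curvature :
  exists k : R, forall u v, R1 u v = Rm1 nu sig k u v.
Proof.
have us X Y : @un R n (s1 X Y).
  have [_ [rT rJ]] := r1E X Y; split.
    by rewrite /s1 linearD linearZ /= rT JT scalerN opprD.
  by rewrite /s1 mulmxDl mulmxDr rJ -scalemxAl -scalemxAr.
have es A X Y : @Un R n A -> s1 (A *m X) (A *m Y) *m A = A *m s1 X Y.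
  move=> UA; rewrite /s1 mulmxDl mulmxDr r1_equivariant // (Un_omega0 _ _ UA).
  by rewrite -scalemxAl -scalemxAr; case: UA => _ ->.
have [k sk] := invariant_kahler_curvature n0 s1_kahler us es.
exists k => u v; rewrite R1_top (r1E _ _).1 /Rm1; congr block_mx.
by rewrite -sk /s1 addrK.
Qed.

End InvariantCurvature.

Section Traces.
Variables (R : realType) (n : nat).
Local Notation H := 'cV[R]_(n + n).
Local Notation J := (@J0 R n).
Implicit Types (X Y Z : H).

Lemma trace_outer p (X Y : 'cV[R]_p) : \tr (X *m Y^T) = (Y^T *m X) 0 0.
Proof. by rewrite mxtrace_mulC /mxtrace big_ord1. Qed.

Lemma trace_JJ : \tr (J *m J) = - (n + n)%:R.
Proof.
have -> : J *m J = - 1%:M by have := mulJJ (1%:M : 'M[R]_(n + n)); rewrite mulmx1.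
by rewrite linearN /= mxtrace1.
Qed.

(** Up to a factor, the Ricci form of a complex space form. *)
Lemma trace_J_Kmx X Y : \tr (J *m Kmx X Y) = (n%:R + 1) * omega0 X Y.
Proof.
rewrite /Kmx -scalemxAr mulmxBr mulmxBr mulmxDr mulmxBr -scalemxAr !mulmxA.
have tJ : \tr (J *m J) = - (n + n)%:R := trace_JJ.
have trB (A B : 'M[R]_(n + n)) : \tr (A - B) = \tr A - \tr B by rewrite raddfB.
rewrite mxtraceZ 2!trB mxtraceD trB mxtraceZ tJ !trace_outer -!mulmxA.
have e1 A B : ((A : H)^T *m B) 0 0 = h0 A B by [].
rewrite !e1 !h0_simp (omega0C Y X) natrD.
by field.
Qed.

End Traces.

Section Necessity.
Variables (R : realType) (n : nat) (a b alpha beta gamma delta mu nu sig : R).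
Local Notation H := 'cV[R]_(n + n).
Local Notation V := 'cV[R]_(n + n + 1).
Local Notation J := (@J0 R n).
Variables (M : affine_manifold (@Un1 R n)) (T0 : V -> V -> V)
  (R0 : V -> V -> 'M[R]_(n + n + 1)) (I0 : V -> set 'M[R]_(n + n + 1)).
Local Notation lam := (@lam R n a b alpha beta gamma delta).
Local Notation Tm := (@Tm R n mu nu sig).
Local Notation un0 := (@un0 R n).
Hypothesis n0 : (0 < n)%N.
Hypothesis ct : characteristic_tensors un0 M T0 R0 I0.
Hypothesis T0E : forall u v, T0 u v = Tm u v + lam u *m v - lam v *m u.
Hypothesis I0E : forall u, I0 u = gl_class un0 (lam u).
Implicit Types (u v w : V) (X Y Z : H).

Definition R1 u v := R0 u v - lam (Tm u v) - (lam u *m lam v - lam v *m lam u).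

Lemma R1_equivariant g u v : @Un1 R n g -> R1 (g *m u) (g *m v) *m g = g *m R1 u v.
Proof.
move=> Ug; have E := curvature_tensor_equivariant ct u v Ug.
have lE x := lam_Un1 a b alpha beta gamma delta x Ug.
rewrite /R1 !mulmxBl !mulmxBr E -Tm_Un1 // -lE.
have lE2 x y : lam (g *m x) *m lam (g *m y) *m g = g *m (lam x *m lam y).
  by rewrite -mulmxA -lE mulmxA -lE -mulmxA.
by rewrite !lE2.
Qed.

(** The structure equations for A = L - lam, which is u(n)-valued.  The mixed terms
    [A, lam] are accounted for by the equivariance of lam. *)
Lemma local_model : exists (W : set V) (z0 : V) (S : V -> 'M[R]_(n + n + 1))
    (A : V -> V -> 'M[R]_(n + n + 1)),
  [/\ open W, W z0, C_infty W S, forall z, W z -> S z \in unitmx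
    & forall u, C_infty W (fun z => A z u)] /\
  (forall z c u v, W z -> A z (c *: u + v) = c *: A z u + A z v) /\
  (forall z u, W z -> un0 (A z u)) /\
  let c z u v := A z u *m v - A z v *m u - Tm u v in
  (forall z u v, W z ->
    'D_(S z *m u) S z *m v - 'D_(S z *m v) S z *m u = S z *m c z u v) /\
  (forall z u v, W z ->
    'D_(S z *m u) (fun p => A p v) z - 'D_(S z *m v) (fun p => A p u) z
    + A z u *m A z v - A z v *m A z u - A z (c z u v) = R1 u v).
Proof.
have [W [z0 [S [L [[oW Wz0 sS uS sL] [linL [Lg [Eq1 Eq2]]]]]]]] :=
  structure_equations ct (un0_0 R n) I0E.
have [A AE] : exists A, A = fun z u => L z u - lam u by eexists.
have uA z u : W z -> un0 (A z u).
  by move=> Wz; have [B uB LE] := Lg z u Wz; rewrite AE LE addrC addKr.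
have cE z u v : L z u *m v - L z v *m u - T0 u v = A z u *m v - A z v *m u - Tm u v.
  by rewrite T0E AE !mulmxBl; mx_entries; ring.
exists W, z0, S, A; split; [split=> //|split; [|split=> //]].
- by move=> u; rewrite AE; apply: smooth_sub => //; exact: C_infty_cst.
- by move=> z c u v Wz; rewrite AE linL // lam_linear scalerBr opprD addrACA.
split=> [z u v Wz|z u v Wz]; first by rewrite -cE Eq1.
have DA x y : 'D_x (fun p => A p y) z = 'D_x (fun p => L p y) z.
  rewrite AE (derive_submx x Wz (sL y) (C_infty_cst (lam y) oW)).
  by rewrite derive_cst subr0.
rewrite !DA /R1 -(Eq2 z u v Wz) cE.
have e1 : L z u = A z u + lam u by rewrite AE subrK.
have e2 : L z v = A z v + lam v by rewrite AE subrK.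
set c := A z u *m v - A z v *m u - Tm u v.
have e3 : L z c = A z c + lam c by rewrite AE subrK.
rewrite e1 e2 e3.
have lc : lam c = (A z u *m lam v - lam v *m A z u) - (A z v *m lam u - lam u *m A z v) - lam (Tm u v).
  by rewrite /c !lamD !lamN -!lam_un0; [|exact: uA|exact: uA].
have aux (d1 d2 p1 p2 p3 p4 q1 q2 q3 q4 ac l : 'M[R]_(n + n + 1)) :
   d1 - d2 + p1 - q1 - ac = d1 - d2 + (p1 + p2 + (p3 + p4)) - (q1 + q2 + (q3 + q4))
     - (ac + ((p2 - q3) - (q2 - p3) - l)) - l - (p4 - q4).
  by mx_entries; ring.
rewrite lc; clear lc e1 e2 e3 DA.
rewrite (mulmxDl (A z u) (lam u)) (mulmxDl (A z v) (lam v)).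
rewrite (mulmxDr (A z u)) (mulmxDr (lam u)) (mulmxDr (A z v)) (mulmxDr (lam v)).
exact: aux.
Qed.

Lemma R1_un0 u v : un0 (R1 u v).
Proof.
have [W [z [S [A [[oW Wz sS uS sA] [linA [uA [Eq1 Eq2]]]]]]]] := local_model.
rewrite -(Eq2 z u v Wz).
have dA x y : un0 ('D_x (fun p => A p y) z).
  by apply: (derive_un0 _ oW Wz (sA y)) => p Wp; exact: uA.
apply: un0B; last exact: uA.
rewrite -addrA; apply: un0D; first by apply: un0B; exact: dA.
by apply: un0_comm; exact: uA.
Qed.

Lemma R1_bianchi u v w : R1 u v *m w + R1 v w *m u + R1 w u *m v =
  Tm (Tm u v) w + Tm (Tm v w) u + Tm (Tm w u) v.
Proof.
have [W [z [S [A [[oW Wz sS uS sA] [linA [uA [Eq1 Eq2]]]]]]]] := local_model.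
have sc x y : C_infty W (fun z => A z x *m y - A z y *m x - Tm x y).
  apply: smooth_sub => //; last exact: C_infty_cst.
  by apply: smooth_sub => //; apply: smooth_mulmxc.
apply: (first_bianchi oW sS uS sc Eq1 sA (fun _ _ _ _ => erefl) (TmB mu nu sig) _ _ Eq2 _ _ _ Wz).
- exact: Tm_anti.
- by move=> p x y t Wp; apply: Tm_un0; exact: uA.
Qed.

Lemma R1_linear c u v w : R1 (c *: u + v) w = c *: R1 u w + R1 v w.
Proof.
have [R0l _] := R0_form ct.
rewrite /R1 R0l Tm_linear !lam_linear mulmxDl mulmxDr -scalemxAl -scalemxAr.
have aux (p1 p2 l1 l2 q1 q2 q3 q4 : 'M[R]_(n + n + 1)) :
  c *: p1 + p2 - (c *: l1 + l2) - (c *: q1 + q2 - (c *: q3 + q4)) =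
  c *: (p1 - l1 - (q1 - q3)) + (p2 - l2 - (q2 - q4)).
  by mx_entries; ring.
exact: aux.
Qed.

Lemma R1_anti u v : R1 u v = - R1 v u.
Proof.
have [_ R0a] := R0_form ct.
rewrite /R1 R0a Tm_anti lamN.
have aux (p l q1 q2 : 'M[R]_(n + n + 1)) : - p - - l - (q1 - q2) = - (p - l - (q2 - q1)).
  by mx_entries; ring.
exact: aux.
Qed.

(** For the remaining relation k * mu = 0, the 1-form al = tr (J A) is used: the
    commutators in the structure equation have no trace against J, so that d al is
    tr (J R1) = rho omega0 in the frame.  Being constant in the frame and closed, it
    satisfies an algebraic identity by [closed_two_form], whose value on
    X, J X, e is rho * mu = 0; and rho = k (n + 1) + 2 n sig nu. *)
Lemma necessity : sig * mu = 0 /\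
  exists2 k : R, k * mu = 0 & forall u v, R0 u v = Rm a b alpha beta gamma delta mu nu sig k u v.
Proof.
split; first exact: (sig_mu n0 R1_linear R1_anti R1_un0 R1_equivariant R1_bianchi).
have [k R1k] := invariant_curvature n0 R1_linear R1_anti R1_un0 R1_equivariant R1_bianchi.
exists k; last first.
  by move=> u v; rewrite /Rm -R1k /R1 [X in _ = X + _]addrAC subrK subrK.
have [W [z [S [A [[oW Wz sS uS sA] [linA [uA [Eq1 Eq2]]]]]]]] := local_model.
pose ea j : V := delta_mx j 0.
pose al z : 'rV[R]_(n + n + 1) := \row_j \tr (@Jv R n *m A z (ea j)).
have alE p u : W p -> al p *m u = (\tr (@Jv R n *m A p u))%:M.
  move=> Wp.
  rewrite (family_coords linA u Wp).
  apply/matrixP => i j; rewrite !mxE !ord1 eqxx mulr1n mulmx_sumr linear_sum /=.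
  by apply: eq_bigr => l _; rewrite !mxE -scalemxAr linearZ /= mulrC.
have strace u : C_infty W ((fun p => \tr (@Jv R n *m A p u)) : V -> R^o).
  apply: smooth_sum => // i _; apply: smooth_entry => //.
  exact: smooth_mulcmx.
have sal : C_infty W al.
  apply/smooth_mxP => // i j.
  apply: (C_infty_eq_on (f := fun p => \tr (@Jv R n *m A p (ea j)))) => //.
  by move=> p _; rewrite mxE.
have sc x y : C_infty W (fun z => A z x *m y - A z y *m x - Tm x y).
  apply: smooth_sub => //; last exact: C_infty_cst.
  by apply: smooth_sub => //; apply: smooth_mulmxc.
pose rho : R := k * (n%:R + 1) + 2 * n%:R * (sig * nu).
have trR1 u v : \tr (@Jv R n *m R1 u v) = rho * omega0 (top u) (top v).
  rewrite R1k /Rm1 /Jv mulmx_block !(mulmx0, mul0mx) !addr0 mxtrace_block linear0 addr0.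
  rewrite mulmxBr -(scalemxAr k) -(scalemxAr (sig * nu * _)) raddfB /= !mxtraceZ trace_J_Kmx trace_JJ /rho natrD.
  by ring.
have Dtr p x y : W p -> 'D_x al p *m y = (\tr (@Jv R n *m 'D_x (fun q => A q y) p))%:M.
  move=> Wp; rewrite -(derive_mulmxc y x oW Wp sal).
  apply: (etrans (y := 'D_x (fun q => (\tr (@Jv R n *m A q y))%:M : 'M[R]_1) p)).
    by apply: (derive_eq_on _ oW Wp) => q; rewrite inE => Wq; exact: alE.
  have sM : C_infty W (fun q => (\tr (@Jv R n *m A q y))%:M : 'M[R]_1).
    apply/smooth_mxP => // i j.
    apply: (C_infty_eq_on (f := fun q => \tr (@Jv R n *m A q y))) => //.
    by move=> q _; rewrite mxE !ord1 eqxx mulr1n.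
  apply/matrixP => i j; rewrite (derive_entry _ _ _ sM Wp) [RHS]mxE !ord1 eqxx mulr1n.
  have sJA := smooth_mulcmx (@Jv R n) oW (sA y).
  rewrite -(derive_mulcmx (@Jv R n) x oW Wp (sA y)).
  rewrite /mxtrace.
  apply: (etrans (y := 'D_x (fun q => \sum_i (@Jv R n *m A q y) i i : R^o) p)).
    by apply: (derive_eq_on _ oW Wp) => q _; rewrite mxE eqxx mulr1n.
  rewrite (derive_sumR x Wp (fun l => smooth_entry l l oW sJA)).
  by apply: eq_bigr => l _; rewrite (derive_entry _ _ _ sJA Wp).
have da p u v : W p -> 'D_(S p *m u) al p *m v - 'D_(S p *m v) al p *m u
     - al p *m (A p u *m v - A p v *m u - Tm u v) = (\tr (@Jv R n *m R1 u v))%:M.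
  move=> Wp; rewrite -(Eq2 p u v Wp).
  have aux (D1 D2 P Q C : 'M[R]_(n + n + 1)) : \tr (@Jv R n *m (P - Q)) = 0 ->
      (\tr (@Jv R n *m D1))%:M - (\tr (@Jv R n *m D2))%:M - (\tr (@Jv R n *m C))%:M
      = (\tr (@Jv R n *m (D1 - D2 + P - Q - C)))%:M :> 'M[R]_1.
    move=> PQ; have -> : D1 - D2 + P - Q - C = (D1 - D2 - C) + (P - Q) by mx_entries; ring.
    have trB (A1 B1 : 'M[R]_(n + n + 1)) : \tr (A1 - B1) = \tr A1 - \tr B1 by rewrite raddfB.
    rewrite mulmxDr mxtraceD PQ addr0 !mulmxBr !trB.
    by apply/matrixP => i j; rewrite !mxE !ord1 eqxx !mulr1n.
  apply: etrans _ (aux _ _ _ _ _ (trace_Jv_comm (A p u) (uA p v Wp))).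
  exact: (congr2 (fun t1 t2 => t1 - t2) (congr2 (fun t1 t2 => t1 - t2)
    (Dtr p (S p *m u) v Wp) (Dtr p (S p *m v) u Wp)) (alE p _ Wp)).
have [X XX] := exists_unit_vector R n0.
have aux1 (t1 t2 t3 : R) : t1%:M + t2%:M + t3%:M = 0 :> 'M[R]_1 -> t1 + t2 + t3 = 0.
  by move=> /matrixP/(_ 0 0); rewrite !mxE eqxx !mulr1n.
have closed (u v w : V) := aux1 _ _ _ (closed_two_form oW sS uS sc Eq1 sal da u v w Wz).
have {}closed (u v w : V) := etrans (esym (congr2 +%R (congr2 +%R (trR1 _ w) (trR1 _ u)) (trR1 _ v)))
  (closed u v w).
move: (closed (inH X) (inH (J *m X)) e).
have [A1 uA1 [t1 _]] := un0_act (uA z (inH X) Wz).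
have [A2 uA2 [t2 _]] := un0_act (uA z (inH (J *m X)) Wz).
have [A3 uA3 [t3 _]] := un0_act (uA z e Wz).
have smr := sig_mu n0 R1_linear R1_anti R1_un0 R1_equivariant R1_bianchi.
rewrite !(topD, topN) !t1 !t2 !t3 !top_Tm !(top_inH, top_e, bot_inH, bot_e) /Nl.
have hA : h0 (A3 *m X) X = 0 by have := un_h0 X X uA3; rewrite [h0 X _]h0C; lra.
rewrite !(un_J _ uA3) !(mulmx0, scaler0, scale0r, scale1r) !h0_simp hA XX => E.
have : rho * mu = 0 by lra.
rewrite /rho mulrDl => E2.
have n1 : n%:R + 1 != 0 :> R by rewrite natr1 pnatr_eq0.
apply: (mulfI n1); rewrite mulr0 -[RHS]E2.
have -> : 2 * n%:R * (sig * nu) * mu = 2 * n%:R * nu * (sig * mu) by ring.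
by rewrite smr; ring.
Qed.

End Necessity.

(** * Topology of open subsets *)

Section OpenSubspace.
Variables (T : topologicalType) (W : set T).
Notation WT := (set_type W : topologicalType).

Lemma subspace_val_continuous : continuous (set_val : WT -> T).
Proof. exact: initial_continuous. Qed.

Lemma subspace_nbhsP (x : WT) (A : set WT) : nbhs x A <->
  exists2 B : set T, open B /\ B (set_val x) & set_val @^-1` B `<=` A.
Proof.
split=> [|[B [oB Bx] BA]].
  rewrite nbhsE => -[U [[B oB BU] Ux] UA]; exists B; last by rewrite BU.
  by split=> //; rewrite -BU in Ux.
apply: filterS BA _; apply: subspace_val_continuous.
exact: open_nbhs_nbhs.
Qed.

Lemma subspace_hausdorff_set_type : hausdorff_space T -> hausdorff_space WT.
Proof.
move=> hT x y xy; apply: val_inj; rewrite -!set_valE; apply: hT => A B nA nB.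
have /xy : nbhs x (set_val @^-1` A) by exact: subspace_val_continuous.
have nB' : nbhs y (set_val @^-1` B) by exact: subspace_val_continuous.
by move=> /(_ _ nB')[z [? ?]]; exists (set_val z).
Qed.

Lemma subspace_second_countable : @second_countable T -> @second_countable WT.
Proof.
move=> [B cB [oB bB]]; exists [set set_val @^-1` U | U in B].
  exact: card_le_trans (card_image_le _ _) cB.
split=> [_ [U BU <-]|x A].
  by exists U => //; exact: oB.
move=> /subspace_nbhsP[U [oU Ux] UA].
have [U' [BU' U'x] U'U] : filter_from [set U | B U /\ U (set_val x)] id U.
  by apply: bB; exact: open_nbhs_nbhs.
exists (set_val @^-1` U') => /=; first by split=> //; exists U'.
by move=> y /U'U /UA.
Qed.

End OpenSubspace.

(** Balls with rational centres and radii 1 / (k + 1). *)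
Lemma cV_second_countable (R : realType) m : @second_countable 'cV[R]_m.
Proof.
pose F (p : 'cV[rat]_m * nat) : set 'cV[R]_m := ball (map_mx ratr p.1 : 'cV[R]_m) p.2.+1%:R^-1.
exists (range F).
  exact: card_le_trans (card_image_le _ _) (countableP _).
split=> [_ [p _ <-]|x A]; first exact: ball_open.
move=> /nbhs_ballP[e /= e0 eA].
have [k ke] : exists k : nat, k.+1%:R^-1 < e / 2.
  have e2 : 0 < e / 2 by rewrite divr_gt0.
  exists (Num.truncn (e / 2)^-1); rewrite -[ltRHS]invrK ltf_pV2 ?posrE ?invr_gt0 ?ltr0n //.
  exact: truncnS_gt.
pose d : R := k.+1%:R^-1.
have d0 : 0 < d by rewrite invr_gt0 ltr0n.
have ex i : exists q : rat, `|x i 0 - ratr q| < d.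
  have [q] : exists q : rat, ratr q \in `](x i 0 - d), (x i 0 + d)[.
    by apply: rat_in_itvoo; rewrite ltrD2l gtrN.
  rewrite in_itv /= => /andP[q1 q2]; exists q.
  by rewrite ltr_norml; apply/andP; split; lra.
pose q : 'cV[rat]_m := \col_i (sval (cid (ex i))).
have qx : ball (map_mx ratr q : 'cV[R]_m) d x.
  split=> // i j; rewrite !mxE ord1; have := svalP (cid (ex i)).
  by rewrite /ball /= distrC.
exists (F (q, k)) => /=; first by split=> //; exists (q, k).
apply: subset_trans eA => y yq.
have -> : e = e / 2 + e / 2 by rewrite -splitr.
apply: (@ball_triangle _ _ (map_mx ratr q : 'cV[R]_m)).
  by apply: ball_sym; apply: le_ball qx; exact: ltW.
by apply: le_ball yq; exact: ltW.
Qed.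

(** * The affine manifold defined by a frame and connection coefficients *)

Section FrameManifold.
Variables (R : realType) (m : nat) (W : set 'cV[R]_m) (x0 : 'cV[R]_m).
Local Notation V := 'cV[R]_m.
Hypotheses (oW : open W) (Wx0 : W x0).
Local Notation WT := (set_type W : topologicalType).

(** The inverse of the inclusion of W, with the value x0 outside W. *)
Definition sparam (z : V) : WT := insubd (exist _ x0 (mem_set Wx0) : set_type W) z.

Lemma sparamK z : W z -> set_val (sparam z) = z.
Proof. by move=> Wz; rewrite set_valE insubdK //; exact: mem_set. Qed.

Lemma set_valKd (x : WT) : sparam (set_val x) = x.
Proof. exact: valKd. Qed.

Lemma set_val_image : set_val @` [set: WT] = W.
Proof.
apply/seteqP; split=> [_ [x _ <-]|z Wz]; first exact: set_valP.
by exists (sparam z) => //; exact: sparamK.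
Qed.

Lemma sparam_continuous z : W z -> {for z, continuous sparam}.
Proof.
move=> Wz A /subspace_nbhsP[B [oB Bz] BA].
have nz : nbhs z (B `&` W).
  apply: nbhs_open; first exact: openI.
  by split=> //; rewrite sparamK in Bz.
by apply: filterS nz => y [By Wy]; apply: BA; rewrite /= sparamK.
Qed.

Lemma WT_open_image : open (set_val @` [set: WT]).
Proof. by rewrite set_val_image. Qed.

(** The open set W is covered by the single chart given by its inclusion. *)
Definition frame_chart : chart R m WT := @Chart R m WT setT set_val sparam
  openT WT_open_image (fun x _ => set_valKd x)
  (fun x _ => @subspace_val_continuous _ W x)
  (fun z Iz => sparam_continuous (eq_ind _ (fun A => A z) Iz _ set_val_image)).

Lemma frame_chart_smooth (i j : unit) :
  C_infty (set_val @` ([set: WT] `&` [set: WT])) (fun z => set_val (sparam z)).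
Proof.
rewrite setTI set_val_image.
apply: (C_infty_eq_on (f := id)) => //; last exact: smooth_id.
by move=> z; rewrite inE => Wz; rewrite sparamK.
Qed.

Definition frame_manifold : manifold R m := @Manifold R m WT
  (ex_intro _ (sparam x0) I) (@subspace_hausdorff_set_type _ W (@norm_hausdorff _ _))
  (@subspace_second_countable _ W (@cV_second_countable R m))
  unit (fun=> frame_chart) (fun=> tt) (fun _ => I) frame_chart_smooth.

Local Notation M := frame_manifold.

(** The components of a field in the chart, as functions on the vector space. *)
Definition pull (X : vfield M) (z : V) : V := X (sparam z).

Lemma vfield_coordE (X : vfield M) i z : vfield_coord X i z = pull X z.
Proof. by case: i; exact: (@tangent_coord_self R m M). Qed.

(** The open subset of the vector space that corresponds to U. *)
Definition cim (U : set M) : set V := chart_image (tt : Defs.index M) U.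

Lemma cimP U z : cim U z <-> W z /\ U (sparam z).
Proof.
split=> [[x [_ Ux] <-]|[Wz Uz]].
  by split; [exact: set_valP|rewrite [sparam _]set_valKd].
by exists (sparam z); [split|exact: sparamK].
Qed.

Lemma smooth_vfieldP U (X : vfield M) : open U -> smooth_vfield U X <-> C_infty (cim U) (pull X).
Proof.
move=> oU; have oC : open (cim U) by exact: chart_image_open.
split=> [sX|sX i].
  by apply: C_infty_eq_on (sX tt) => // z _; exact: vfield_coordE.
by apply: C_infty_eq_on sX => // z _; rewrite [RHS]vfield_coordE.
Qed.

Variables (S : V -> 'M[R]_m) (L : V -> V -> 'M[R]_m).
Hypothesis sS : C_infty W S.
Hypothesis uS : forall z, W z -> S z \in unitmx.
Hypothesis linL : forall z c u v, W z -> L z (c *: u + v) = c *: L z u + L z v.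
Hypothesis sL : forall u, C_infty W (fun z => L z u).

(** The components of a field in the frame S. *)
Definition comps (X : vfield M) (z : V) : V := invmx (S z) *m pull X z.

(** The connection for which nabla_(S u) (S w) = S (L u w). *)
Definition nab (x : M) (v : tangent x) (Y : vfield M) : tangent x :=
  S (set_val x) *m ('D_(v : V) (comps Y) (set_val x)
    + L (set_val x) (invmx (S (set_val x)) *m (v : V)) *m comps Y (set_val x)).

Lemma cim_sub U : cim U `<=` W. Proof. by move=> z /cimP[]. Qed.

Lemma cim_open U : open U -> open (cim U). Proof. by move=> oU; exact: chart_image_open. Qed.

Lemma cim_val U (x : M) : U x -> cim U (set_val x).
Proof. by move=> Ux; apply/cimP; split; [exact: set_valP|rewrite [sparam _]set_valKd]. Qed.

Lemma smooth_invS U : U `<=` W -> open U -> C_infty U (fun z => invmx (S z)).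
Proof.
by move=> UW oU; apply: smooth_invmx => // [|z /UW]; [exact: C_infty_sub sS|exact: uS].
Qed.

Lemma smooth_comps U X : open U -> smooth_vfield U X -> C_infty (cim U) (comps X).
Proof.
move=> oU /(smooth_vfieldP _ oU) sX; have oC := cim_open oU.
by apply: smooth_mulmx => //; apply: smooth_invS => //; exact: cim_sub.
Qed.

Lemma comps_val X (x : M) : comps X (set_val x) = invmx (S (set_val x)) *m X x.
Proof. by rewrite /comps /pull [sparam _]set_valKd. Qed.

Lemma comps_nab U X Y z : cim U z ->
  comps (fun x => nab (X x) Y) z =
  'D_(pull X z) (comps Y) z + L z (comps X z) *m comps Y z.
Proof.
move=> /cimP[Wz _]; rewrite {1}/comps /pull /nab sparamK // mulKmx ?uS //.
Qed.

Lemma pullE X z : W z -> pull X z = S z *m comps X z.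
Proof. by move=> Wz; rewrite /comps mulKVmx // uS. Qed.

Lemma nab_smooth X Y U : open U -> smooth_vfield U X -> smooth_vfield U Y ->
  smooth_vfield U (fun x => nab (X x) Y).
Proof.
move=> oU sX sY; have oC := cim_open oU; have CW := @cim_sub U.
apply/smooth_vfieldP => //.
apply: (C_infty_eq_on (f := fun z => S z *m ('D_(pull X z) (comps Y) z + L z (comps X z) *m comps Y z))) => //.
  move=> z; rewrite inE => Cz; rewrite -(comps_nab X Y Cz).
  by rewrite [RHS]pullE //; exact: CW.
apply: smooth_mulmx => //; first exact: C_infty_sub sS.
apply: smooth_add => //.
  by apply: smooth_derive_field => //; [apply/(smooth_vfieldP _ oU)|exact: smooth_comps].
apply: smooth_mulmx => //; last exact: smooth_comps.
exact: (smooth_family linL sL oC CW (smooth_comps oU sX)).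
Qed.

Lemma act_on_funE (x : M) (v : V) (f : M -> R) :
  act_on_fun (v : tangent x) f = 'D_v (fun z => f (sparam z) : R^o) (set_val x).
Proof. by []. Qed.

Lemma nab_connection : is_connection nab.
Proof.
split.
- move=> x c u v Y [U [oU Ux sY]]; have oC := cim_open oU; have Cx := cim_val Ux.
  have Wx := cim_sub Cx; rewrite /nab.
  rewrite (derive_linear c u v oC Cx (smooth_comps oU sY)).
  rewrite (mulmxDr (invmx _)) -(scalemxAr c) linL // mulmxDl -(scalemxAl c) [in RHS]scalemxAr -[in RHS]mulmxDr.
  have aux (d1 d2 l1 l2 : V) : c *: d1 + d2 + (c *: l1 + l2) = c *: (d1 + l1) + (d2 + l2).
    by rewrite scalerDr addrACA.
  exact: (congr1 (mulmx _) (aux _ _ _ _)).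
- move=> x v Y Z [U [oU Ux sY]] [U' [oU' U'x sZ]].
  have oI : open (U `&` U') by exact: openI.
  have oC := cim_open oI; have Cx : cim (U `&` U') (set_val x) by exact: cim_val.
  have sYI : C_infty (cim (U `&` U')) (comps Y).
    by apply: C_infty_sub (smooth_comps oU sY) => z /cimP[Wz [? ?]]; apply/cimP.
  have sZI : C_infty (cim (U `&` U')) (comps Z).
    by apply: C_infty_sub (smooth_comps oU' sZ) => z /cimP[Wz [? ?]]; apply/cimP.
  have E : comps (fun y => (Y y : V) + Z y) = fun z => comps Y z + comps Z z.
    by apply/funext => z; rewrite /comps /pull mulmxDr.
  rewrite /nab E (derive_addmx v Cx sYI sZI) !mulmxDr.
  by rewrite addrACA.
- move=> x v f Y U oU Ux sf sY; have oC := cim_open oU; have Cx := cim_val Ux.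
  have E : comps (fun y => f y *: (Y y : V)) = fun z => f (sparam z) *: comps Y z.
    by apply/funext => z; rewrite /comps /pull -scalemxAr.
  have Yx : Y x = S (set_val x) *m comps Y (set_val x).
    by rewrite comps_val mulKVmx // uS //; exact: cim_sub Cx.
  rewrite /nab E (derive_scalemx v oC Cx (sf tt) (smooth_comps oU sY)) [sparam _]set_valKd Yx.
  rewrite -scalemxAr -addrA mulmxDr -scalemxAr act_on_funE; congr (_ + _).
  have fx : (f \o param (atlas (tt : Defs.index M))) (set_val x) = f x.
    by congr f; exact: set_valKd.
  by rewrite fx -scalerDr -scalemxAr.
- move=> x v Y Z U oU Ux sY YZ; have oC := cim_open oU; have Cx := cim_val Ux.
  have E1 : 'D_v (comps Y) (set_val x) = 'D_v (comps Z) (set_val x).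
    apply: (derive_eq_on _ oC Cx) => z; rewrite inE => /cimP[_ Uz].
    by rewrite /comps /pull YZ.
  have E2 : comps Y (set_val x) = comps Z (set_val x) by rewrite !comps_val YZ.
  exact: (congr2 (fun d c => S (set_val x) *m (d +
    L (set_val x) (invmx (S (set_val x)) *m v) *m c)) E1 E2).
- exact: nab_smooth.
Qed.

End FrameManifold.

(** * Torsion and curvature in the frame *)

Section FrameTensors.
Variables (R : realType) (m : nat) (W : set 'cV[R]_m) (x0 : 'cV[R]_m).
Local Notation V := 'cV[R]_m.
Hypotheses (oW : open W) (Wx0 : W x0).
Variables (S : V -> 'M[R]_m) (L : V -> V -> 'M[R]_m).
Hypothesis sS : C_infty W S.
Hypothesis uS : forall z, W z -> S z \in unitmx.
Hypothesis linL : forall z c u v, W z -> L z (c *: u + v) = c *: L z u + L z v.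
Hypothesis sL : forall u, C_infty W (fun z => L z u).
Local Notation M := (frame_manifold oW Wx0).
Local Notation sparam := (sparam Wx0).
Variables (T0 : V -> V -> V) (R0 : V -> V -> 'M[R]_m).
Hypothesis Eq1 : forall z u v, W z ->
    'D_(S z *m u) S z *m v - 'D_(S z *m v) S z *m u
    = S z *m (L z u *m v - L z v *m u - T0 u v).
Hypothesis Eq2 : forall z u v, W z ->
    'D_(S z *m u) (fun p => L p v) z - 'D_(S z *m v) (fun p => L p u) z
    + L z u *m L z v - L z v *m L z u
    - L z (L z u *m v - L z v *m u - T0 u v) = R0 u v.
Implicit Types (X Y Z : vfield M) (x : M).
Local Notation comps := (@comps R m W x0 oW Wx0 S).
Local Notation pull := (@pull R m W x0 oW Wx0).
Local Notation nab := (@nab R m W x0 oW Wx0 S L).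
Local Notation cim := (@cim R m W x0 oW Wx0).

Lemma nabE x (v : V) Y : nab (v : tangent x) Y =
  S (set_val x) *m ('D_v (comps Y) (set_val x)
    + L (set_val x) (invmx (S (set_val x)) *m v) *m comps Y (set_val x)).
Proof. by []. Qed.

Lemma pull_val X x : pull X (set_val x) = X x.
Proof. by rewrite /pull [sparam _]set_valKd. Qed.

(** The term with the structure functions of the frame is rewritten by the torsion
    equation [Eq1]. *)
Lemma bracketE X Y x (U : set M) : open U -> U x -> smooth_vfield U X -> smooth_vfield U Y ->
  let z := set_val x : V in let xi := comps X z in let eta := comps Y z in
  bracket X Y x = S z *m ('D_(X x) (comps Y) z - 'D_(Y x) (comps X) z
    + (L z xi *m eta - L z eta *m xi - T0 xi eta)).
Proof.
move=> oU Ux sX sY z xi eta; have oC := cim_open oU; have Cx : cim U z := cim_val Ux.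
have Wz : W z := cim_sub Cx.
have sSC : C_infty (cim U) S by exact: (C_infty_sub (@cim_sub _ _ _ _ _ _ U) sS).
have DZ Z (sZ : smooth_vfield U Z) (v : V) : 'D_v (vfield_coord Z (at_ x)) z =
    'D_v S z *m comps Z z + S z *m 'D_v (comps Z) z.
  rewrite -(derive_mulmx v oC Cx sSC (smooth_comps sS uS oU sZ)).
  apply: (derive_eq_on _ oC Cx) => y; rewrite inE => Cy.
  by rewrite vfield_coordE (pullE uS) //; exact: cim_sub Cy.
have SX : X x = S z *m xi by rewrite /xi comps_val mulKVmx // uS.
have SY : Y x = S z *m eta by rewrite /eta comps_val mulKVmx // uS.
rewrite mulmxDr -(Eq1 xi eta Wz) -SX -SY mulmxBr.
apply: etrans (congr2 (fun a b => a - b) (DZ Y sY (X x)) (DZ X sX (Y x))) _.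
have aux (a1 a2 b1 b2 : V) : a1 + b1 - (a2 + b2) = b1 - b2 + (a1 - a2).
  by rewrite opprD addrACA addrC.
exact: aux.
Qed.

Lemma smooth_near_common X Y x : smooth_vfield_at x X -> smooth_vfield_at x Y ->
  exists U, [/\ open U, U x, smooth_vfield U X & smooth_vfield U Y].
Proof.
move=> [U [oU Ux sX]] [U' [oU' U'x sY]]; exists (U `&` U'); split.
- exact: openI.
- by [].
- by move=> i; apply: C_infty_sub (sX i) => z [y [dy [? ?]] <-]; exists y.
- by move=> i; apply: C_infty_sub (sY i) => z [y [dy [? ?]] <-]; exists y.
Qed.

Lemma frame_torsion X Y x : smooth_vfield_at x X -> smooth_vfield_at x Y ->
  let z := set_val x : V in
  (nab (X x) Y : V) - nab (Y x) X - bracket X Y x = S z *m T0 (comps X z) (comps Y z).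
Proof.
move=> sX sY z; have [U [oU Ux {}sX {}sY]] := smooth_near_common sX sY.
rewrite (bracketE oU Ux sX sY) !nabE -/z -!comps_val -/z.
set xi := comps X z; set eta := comps Y z.
rewrite -!mulmxBr; congr (_ *m _).
have aux (d1 d2 l1 l2 t : V) : d1 + l1 - (d2 + l2) - (d1 - d2 + (l1 - l2 - t)) = t.
  by mx_entries; ring.
exact: aux.
Qed.

(** The second derivatives of the components of Z are removed by [commutator];
    what remains is tensorial and is [Eq2]. *)
Lemma frame_curvature X Y Z x : smooth_vfield_at x X -> smooth_vfield_at x Y ->
  smooth_vfield_at x Z -> let z := set_val x : V in
  (nab (X x) (fun y => nab (Y y) Z) : V) - nab (Y x) (fun y => nab (X y) Z)
    - nab (bracket X Y x : tangent x) Z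
  = S z *m (R0 (comps X z) (comps Y z) *m comps Z z).
Proof.
move=> [U1 [oU1 U1x sX]] [U2 [oU2 U2x sY]] [U3 [oU3 U3x sZ]] z.
pose U := U1 `&` U2 `&` U3.
have oU : open U by do 2?apply: openI.
have Ux : U x by [].
have {}sX : smooth_vfield U X.
  by move=> i; apply: C_infty_sub (sX i) => p [y [dy [[? ?] ?]] <-]; exists y.
have {}sY : smooth_vfield U Y.
  by move=> i; apply: C_infty_sub (sY i) => p [y [dy [[? ?] ?]] <-]; exists y.
have {}sZ : smooth_vfield U Z.
  by move=> i; apply: C_infty_sub (sZ i) => p [y [dy [[? ?] ?]] <-]; exists y.
have oC := cim_open oU; have Cx : cim U z := cim_val Ux.
have CW : cim U `<=` W := @cim_sub _ _ _ _ _ _ U.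
have Wz : W z := CW _ Cx.
have sx := smooth_comps sS uS oU sX; have sy := smooth_comps sS uS oU sY.
have sz := smooth_comps sS uS oU sZ.
have pX := (smooth_vfieldP _ oU).1 sX; have pY := (smooth_vfieldP _ oU).1 sY.
set xi := comps X z; set eta := comps Y z; set zeta := comps Z z.
have second (P : vfield M) (pP : C_infty (cim U) (pull P)) (sP : C_infty (cim U) (comps P)) (v : V) :
    'D_v (comps (fun y => nab (P y) Z)) z =
    'D_v (fun y => 'D_(pull P y) (comps Z) y) z
    + ((L z ('D_v (comps P) z) + 'D_v (fun y => L y (comps P z)) z) *m zeta
       + L z (comps P z) *m 'D_v (comps Z) z).
  have sLP := smooth_family linL sL oC CW sP.
  rewrite -(derive_family linL sL v oC CW Cx sP).
  rewrite -(derive_mulmx v oC Cx sLP sz).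
  rewrite -(derive_addmx v Cx (smooth_derive_field oC pP sz) (smooth_mulmx oC sLP sz)).
  apply: (derive_eq_on _ oC Cx) => y; rewrite inE => Cy.
  exact: (comps_nab L uS _ _ Cy).
have E1 : nab (X x) (fun y => nab (Y y) Z) = S z *m
   ('D_(X x) (fun y => 'D_(pull Y y) (comps Z) y) z
    + ((L z ('D_(X x) (comps Y) z) + 'D_(X x) (fun y => L y eta) z) *m zeta
       + L z eta *m 'D_(X x) (comps Z) z)
    + L z xi *m ('D_(Y x) (comps Z) z + L z eta *m zeta)).
  rewrite nabE (second Y pY sy) -/z -comps_val -/xi; congr (_ *m (_ + _ *m _)).
  by rewrite (comps_nab L uS _ _ Cx) pull_val.
have E2 : nab (Y x) (fun y => nab (X y) Z) = S z *m
   ('D_(Y x) (fun y => 'D_(pull X y) (comps Z) y) z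
    + ((L z ('D_(Y x) (comps X) z) + 'D_(Y x) (fun y => L y xi) z) *m zeta
       + L z xi *m 'D_(Y x) (comps Z) z)
    + L z eta *m ('D_(X x) (comps Z) z + L z xi *m zeta)).
  rewrite nabE (second X pX sx) -/z -comps_val -/eta; congr (_ *m (_ + _ *m _)).
  by rewrite (comps_nab L uS _ _ Cx) pull_val.
pose br : V := bracket X Y x.
have brE : br = S z *m ('D_(X x) (comps Y) z - 'D_(Y x) (comps X) z
    + (L z xi *m eta - L z eta *m xi - T0 xi eta)) by exact: bracketE oU Ux sX sY.
have brI : invmx (S z) *m br = 'D_(X x) (comps Y) z - 'D_(Y x) (comps X) z
    + (L z xi *m eta - L z eta *m xi - T0 xi eta) by rewrite brE mulKmx // uS.
have E3 : nab (br : tangent x) Z = S z *m ('D_br (comps Z) z +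
    L z ('D_(X x) (comps Y) z - 'D_(Y x) (comps X) z
    + (L z xi *m eta - L z eta *m xi - T0 xi eta)) *m zeta).
  by rewrite -brI.
have LB u v : L z (u - v) = L z u - L z v.
  by have := linL (-1) v u Wz; rewrite !scaleN1r addrC => ->; rewrite addrC.
have LD u v : L z (u + v) = L z u + L z v.
  by have := linL 1 u v Wz; rewrite !scale1r.
have C1 : 'D_br (comps Z) z = 'D_(X x) (fun y => 'D_(pull Y y) (comps Z) y) z
    - 'D_(Y x) (fun y => 'D_(pull X y) (comps Z) y) z.
  have C0 := commutator oC Cx pX pY sz.
  rewrite !pull_val in C0.
  have pE P : vfield_coord P (at_ x) = pull P by apply/funext => y; exact: vfield_coordE.
  have brD : br = 'D_(X x) (pull Y) z - 'D_(Y x) (pull X) z by rewrite -!pE.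
  by rewrite brD; exact: (esym C0).
apply: etrans (congr2 (fun s t : V => s - t) (congr2 (fun s t : V => s - t) E1 E2) E3) _.
rewrite -!mulmxBr; congr (_ *m _).
have SX : X x = S z *m xi by rewrite /xi comps_val mulKVmx // uS.
have SY : Y x = S z *m eta by rewrite /eta comps_val mulKVmx // uS.
rewrite -(Eq2 xi eta Wz) -SX -SY.
have aux (F1 F2 dX dY t : V) (M1 M2 N1 N2 Lx Le Lc : 'M[R]_m) :
  F1 + ((M1 + M2) *m t + Le *m dX) + Lx *m (dY + Le *m t)
  - (F2 + ((N1 + N2) *m t + Lx *m dY) + Le *m (dX + Lx *m t))
  - (F1 - F2 + (M1 - N1 + Lc) *m t) = (M2 - N2 + Lx *m Le - Le *m Lx - Lc) *m t.
  rewrite !(mulmxDl, mulNmx, mulmxDr) -!mulmxA.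
  by mx_entries; ring.
apply: etrans _ (aux _ _ _ _ _ _ _ _ _ _ _ _).
apply: (congr1 (fun t => _ - t)).
apply: (congr2 +%R C1); congr (_ *m _); rewrite LD LB; reflexivity.
Qed.

End FrameTensors.

(** * Characteristic tensors of the manifold defined by a frame *)

Lemma invmx_mulmx (R : fieldType) m (A B : 'M[R]_m) : A \in unitmx -> B \in unitmx ->
  invmx (A *m B) = invmx B *m invmx A.
Proof.
move=> uA uB; have uAB : A *m B \in unitmx by rewrite unitmx_mul uA.
by apply: (can_inj (mulKmx uAB)); rewrite mulmxV // mulmxA -(mulmxA A) mulmxV // mulmx1 mulmxV.
Qed.

Section UnitaryGroup.
Variables (R : realType) (n : nat).
Local Notation V := 'cV[R]_(n + n + 1).
Implicit Types (g h B : 'M[R]_(n + n + 1)).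

(** Polynomial equations for U(n) x 1, which can be differentiated. *)
Lemma Un1P g : @Un1 R n g <-> [/\ g^T *m g = 1%:M, g *m e = e & g *m @Jv R n = @Jv R n *m g].
Proof.
split=> [[A [AA AJ] <-]|[gg ge gJ]].
  split.
  - rewrite tr_block_mx !trmx0 trmx1 mulmx_block !(mulmx0, mul0mx) !addr0 add0r AA mulmx1.
    by rewrite -scalar_mx_block.
  - by rewrite /e mul_block_col !mulmx0 mul0mx mulmx1 !add0r.
  - by rewrite /Jv !mulmx_block !(mulmx0, mul0mx) !addr0 AJ.
have gTe : g^T *m e = e by rewrite -{1}ge mulmxA gg mul1mx.
have E := submxK g.
have [ur0 dr1] : ursubmx g = 0 /\ drsubmx g = 1%:M.
  move: ge; rewrite -{1}E /e mul_block_col !mulmx0 !mulmx1 !add0r.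
  by move=> /eq_col_mx[].
have dl0 : dlsubmx g = 0.
  move: gTe; rewrite -{1}E tr_block_mx /e mul_block_col !mulmx0 !mulmx1 !add0r.
  by move=> /eq_col_mx[E1 _]; apply: trmx_inj; rewrite E1 trmx0.
have [A EA] : exists A, g = block_mx A 0 0 1%:M.
  by exists (ulsubmx g); rewrite -{1}E ur0 dr1 dl0.
exists A; last by [].
move: gg gJ; rewrite EA tr_block_mx !trmx0 trmx1 mulmx_block !(mulmx0, mul0mx) !addr0.
rewrite scalar_mx_block => /eq_block_mx[AA _ _ _].
by rewrite /Jv !mulmx_block !(mulmx0, mul0mx) !addr0 => /eq_block_mx[AJ _ _ _].
Qed.

Lemma Un1_unit g : @Un1 R n g -> g \in unitmx.
Proof. by move=> /Un1P[gg _ _]; have [] := mulmx1_unit gg. Qed.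

Lemma Un1_inv g : @Un1 R n g -> invmx g = g^T.
Proof.
move=> Ug; have /Un1P[gg _ _] := Ug.
by rewrite -[LHS]mul1mx -gg mulmxK // Un1_unit.
Qed.

Lemma Un1_1 : @Un1 R n 1%:M.
Proof. by apply/Un1P; rewrite trmx1 !mul1mx mulmx1. Qed.

Lemma Un1_M g h : @Un1 R n g -> @Un1 R n h -> @Un1 R n (g *m h).
Proof.
move=> /Un1P[gg ge gJ] /Un1P[hh he hJ]; apply/Un1P; split.
- by rewrite trmx_mul -mulmxA (mulmxA g^T) gg mul1mx.
- by rewrite -mulmxA he.
- by rewrite -mulmxA hJ !mulmxA gJ.
Qed.

Lemma Un1_V g : @Un1 R n g -> @Un1 R n (invmx g).
Proof.
move=> Ug; have /Un1P[gg ge gJ] := Ug; have ug := Un1_unit Ug; apply/Un1P; split.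
- by rewrite Un1_inv // trmxK; exact: mulmx1C gg.
- by rewrite -{1}ge mulKmx.
- by apply: (can_inj (mulKmx ug)); rewrite mulKVmx // !mulmxA gJ mulmxK.
Qed.

Lemma un0_Ad g B : @Un1 R n g -> @un0 R n B -> @un0 R n (invmx g *m B *m g).
Proof.
move=> Ug /un0P[BT Be BJ]; have /Un1P[gg ge gJ] := Ug.
have /Un1P[_ _ iJ] := Un1_V Ug.
apply/un0P; split.
- by rewrite Un1_inv // !trmx_mul trmxK BT mulNmx mulmxN mulmxA.
- by rewrite -!mulmxA ge Be mulmx0.
- by rewrite -!mulmxA gJ (mulmxA B) BJ !mulmxA iJ.
Qed.

(** The logarithmic derivative of a map into the group lies in the Lie
    algebra: differentiate the equations of [Un1P]. *)
Lemma logarithmic_derivative_un0 p (W : set 'cV[R]_p) (h : 'cV[R]_p -> 'M[R]_(n + n + 1)) v z :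
  open W -> W z -> C_infty W h -> (forall y, W y -> @Un1 R n (h y)) ->
  @un0 R n (invmx (h z) *m 'D_v h z).
Proof.
move=> oW Wz sh Uh; have Uz := Uh z Wz; have /Un1P[hh he hJ] := Uz.
have /Un1P[_ _ iJ] := Un1_V Uz.
have shT : C_infty W (fun y => (h y)^T).
  apply/smooth_mxP => // i j; apply: (C_infty_eq_on (f := fun y => h y j i)) => //.
    by move=> y _; rewrite mxE.
  exact: smooth_entry.
have DT : 'D_v (fun y => (h y)^T) z = ('D_v h z)^T.
  apply/matrixP => i j; rewrite (derive_entry _ _ _ shT Wz) mxE (derive_entry _ _ _ sh Wz).
  by apply: (derive_eq_on _ oW Wz) => y _; rewrite mxE.
have D1 : ('D_v h z)^T *m h z + (h z)^T *m 'D_v h z = 0.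
  rewrite -DT -(derive_mulmx v oW Wz shT sh) -(derive_cst (1%:M : 'M[R]_(n + n + 1)) z v).
  by apply: (derive_eq_on _ oW Wz) => y; rewrite inE => /Uh/Un1P[].
have D2 : 'D_v h z *m e = 0.
  rewrite -(derive_mulmxc e v oW Wz sh) -(derive_cst (e : V) z v).
  by apply: (derive_eq_on _ oW Wz) => y; rewrite inE => /Uh/Un1P[].
have D3 : 'D_v h z *m @Jv R n = @Jv R n *m 'D_v h z.
  rewrite -(derive_mulmxc (@Jv R n) v oW Wz sh) -(derive_mulcmx (@Jv R n) v oW Wz sh).
  by apply: (derive_eq_on _ oW Wz) => y; rewrite inE => /Uh/Un1P[].
apply/un0P; split.
- by rewrite Un1_inv // trmx_mul trmxK; apply/eqP; rewrite -addr_eq0 D1.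
- by rewrite -mulmxA D2 mulmx0.
- by rewrite -mulmxA D3 !mulmxA iJ.
Qed.

End UnitaryGroup.

Section ModelManifold.
Variables (R : realType) (n : nat) (a b alpha beta gamma delta : R).
Local Notation V := 'cV[R]_(n + n + 1).
Local Notation Mx := 'M[R]_(n + n + 1).
Local Notation lam := (@lam R n a b alpha beta gamma delta).
Variables (W : set V) (x0 : V).
Hypotheses (oW : open W) (Wx0 : W x0).
Variables (S : V -> Mx) (A : V -> V -> Mx).
Hypothesis sS : C_infty W S.
Hypothesis uS : forall z, W z -> S z \in unitmx.
Hypothesis linA : forall z c u v, W z -> A z (c *: u + v) = c *: A z u + A z v.
Hypothesis sA : forall u, C_infty W (fun z => A z u).
Hypothesis uA : forall z u, W z -> @un0 R n (A z u).
Let L z u := lam u + A z u.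
Variables (T0 : V -> V -> V) (R0 : V -> V -> Mx) (I0 : V -> set Mx).
Hypothesis T0_form : alternating_bilinear T0.
Hypothesis R0_form : alternating_bilinear R0.
Hypothesis T0_equiv : forall g u v, @Un1 R n g -> g *m T0 u v = T0 (g *m u) (g *m v).
Hypothesis R0_equiv : forall g u v, @Un1 R n g -> R0 (g *m u) (g *m v) *m g = g *m R0 u v.
Hypothesis I0E : forall u, I0 u = gl_class (@un0 R n) (lam u).
Hypothesis Eq1 : forall z u v, W z ->
    'D_(S z *m u) S z *m v - 'D_(S z *m v) S z *m u
    = S z *m (L z u *m v - L z v *m u - T0 u v).
Hypothesis Eq2 : forall z u v, W z ->
    'D_(S z *m u) (fun p => L p v) z - 'D_(S z *m v) (fun p => L p u) z
    + L z u *m L z v - L z v *m L z u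
    - L z (L z u *m v - L z v *m u - T0 u v) = R0 u v.
Local Notation M := (frame_manifold oW Wx0).
Local Notation nab := (@nab R _ W x0 oW Wx0 S L).

Let linL z c u v : W z -> L z (c *: u + v) = c *: L z u + L z v.
Proof. by move=> Wz; rewrite /L lam_linear linA // scalerDr addrACA. Qed.

Let sL u : C_infty W (fun z => L z u).
Proof. by apply: smooth_add => //; exact: C_infty_cst. Qed.

Definition frames (x : M) : set Mx := [set S (set_val x) *m g | g in @Un1 R n].

Lemma unitS (x : M) : S (set_val x) \in unitmx.
Proof. by apply: uS; exact: set_valP. Qed.

Lemma frames_structure : is_structure (@Un1 R n) frames.
Proof.
split.
- by move=> x _ [g Ug <-]; rewrite unitmx_mul unitS Un1_unit.
- by move=> x _ g [h Uh <-] Ug; exists (h *m g); [exact: Un1_M|rewrite mulmxA].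
- move=> x _ _ [g Ug <-] [h Uh <-]; exists (invmx g *m h).
    by apply: Un1_M => //; exact: Un1_V.
  by rewrite -mulmxA (mulmxA g) mulmxV ?Un1_unit // mul1mx.
- move=> x; exists setT, (fun y => S (set_val y)); split=> //; split.
  + exact: openT.
  + by move=> y _; exists 1%:M; [exact: Un1_1|rewrite mulmx1].
  + move=> w; apply/smooth_vfieldP; first exact: openT.
    apply: (C_infty_eq_on (f := fun z => S z *m w)).
    * by apply: cim_open; exact: openT.
    * by move=> z; rewrite inE => /cimP[Wz _]; rewrite /pull sparamK.
    * apply: smooth_mulmxc; first by apply: cim_open; exact: openT.
      exact: (C_infty_sub (@cim_sub _ _ _ _ oW Wx0 setT) sS).
Qed.

Definition model : affine_manifold (@Un1 R n) :=
  AffineManifold (nab_connection oW Wx0 sS uS linL sL) frames_structure.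

(** Any local section is S h with h in the group.  The coefficients in the frame S h are
    h^-1 dh + h^-1 (lam + A) (h u) h; the first term is in the Lie algebra, and
    equivariance of lam turns the second into lam u modulo the Lie algebra. *)
Lemma model_Lambda (U : set model) (s : model -> Mx) x u : local_section (structure model) U s ->
  U x -> exists2 B, @un0 R n B & Lambda s x u = lam u + B.
Proof.
move=> [oU Ps ss] Ux; pose z : V := set_val x.
have oC := cim_open (oW := oW) (Wx0 := Wx0) oU; have Cx : cim U z := cim_val Ux.
have CW : cim U `<=` W := @cim_sub _ _ _ _ oW Wx0 U.
pose h y := invmx (S y) *m s (sparam Wx0 y).
have Uh y : cim U y -> @Un1 R n (h y).
  move=> /cimP[Wy Uy]; have [g Ug E] := Ps _ Uy.
  by rewrite /h -E sparamK // mulKmx // uS.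
have s_smooth : C_infty (cim U) (fun y => s (sparam Wx0 y)).
  apply/smooth_mxP => // i j.
  have /(smooth_vfieldP _ oU) sj := ss (delta_mx j 0).
  apply: C_infty_eq_on (smooth_entry i 0 oC sj) => // y _.
  by rewrite /pull -colE mxE.
have sh : C_infty (cim U) h.
  by apply: smooth_mulmx => //; apply: smooth_invS.
have sx : s x = S z *m h z by rewrite /h [sparam _ _]set_valKd mulKVmx // unitS.
have compsE w y : comps S ((fun y => s y *m w) : vfield M) y = h y *m w.
  by rewrite /comps /pull mulmxA.
have Wz : W z := CW _ Cx; have Uhz := Uh z Cx.
have LE : Lambda s x u = invmx (h z) *m ('D_(s x *m u) h z + L z (h z *m u) *m h z).
  apply/matrixP => i j; rewrite mxE.
  have -> : nabla (s x *m u : tangent x) ((fun y => s y *m delta_mx j 0) : vfield model)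
    = S z *m ('D_(s x *m u) h z + L z (h z *m u) *m h z) *m delta_mx j 0.
    rewrite /= nabE -/z compsE -mulmxA; congr (S z *m _).
    rewrite (mulmxDl ('D_(s x *m u) h z)) -(mulmxA (L z (h z *m u))); congr (_ + L z _ *m _); last first.
      by rewrite sx -(mulmxA (S z)) mulKmx ?uS.
    rewrite -(derive_mulmxc _ _ oC Cx sh); apply: (derive_eq_on _ oC Cx) => y _.
    exact: compsE.
  rewrite mulmxA -colE mxE; congr (fun_of_matrix _ i j).
  rewrite mulmxA; congr (_ *m _).
  by rewrite sx invmx_mulmx ?uS ?Un1_unit // mulmxKV // uS.
exists (invmx (h z) *m 'D_(s x *m u) h z + invmx (h z) *m A z (h z *m u) *m h z).
  apply: un0D; first exact: (logarithmic_derivative_un0 _ oC Cx sh).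
  by apply: un0_Ad => //; exact: uA.
have lE := lam_Un1 a b alpha beta gamma delta u Uhz.
rewrite LE /L mulmxDl -lE !mulmxDr (mulmxA (invmx _) (h z)) mulVmx ?Un1_unit // mul1mx.
by rewrite -!mulmxA addrCA.
Qed.

Lemma gl_class_eq (B C : Mx) : @un0 R n C -> gl_class (@un0 R n) (B + C) = gl_class (@un0 R n) B.
Proof.
move=> uC; apply/seteqP; split=> _ [D uD <-].
  by exists (C + D); [exact: un0D|rewrite addrA].
by exists (D - C); [exact: un0B|rewrite -addrA (addrC C) subrK].
Qed.

Lemma Ad_lam (p k : Mx) u : p \in unitmx -> @Un1 R n k ->
  Ad_set (p *m k) (gl_class (@un0 R n) (lam (invmx k *m u))) =
  Ad_set p (gl_class (@un0 R n) (lam u)).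
Proof.
move=> up Uk; have uk := Un1_unit Uk.
have lE := lam_Un1 a b alpha beta gamma delta (invmx k *m u) Uk.
rewrite mulKVmx // in lE.
have conj D : p *m k *m D *m invmx (p *m k) = p *m (k *m D *m invmx k) *m invmx p.
  by rewrite invmx_mulmx // !mulmxA.
apply/seteqP; split=> [_ [_ [B uB <-] <-]|_ [_ [B uB <-] <-]].
  exists (lam u + k *m B *m invmx k).
    exists (k *m B *m invmx k) => //.
    have := un0_Ad (Un1_V Uk) uB; by rewrite invmxK.
  by rewrite conj (mulmxDr k) lE mulmxDl mulmxK.
exists (lam (invmx k *m u) + invmx k *m B *m k).
  by exists (invmx k *m B *m k) => //; exact: un0_Ad.
have kk : k *m (invmx k *m B *m k) *m invmx k = B by rewrite !mulmxA mulmxV // mul1mx mulmxK.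
by rewrite conj (mulmxDr k) lE mulmxDl mulmxK // kk.
Qed.

(** The torsion and the curvature come from [frame_torsion] and
    [frame_curvature], and the inner torsion from [model_Lambda]; equivariance of
    the tensors passes from the frame S to all frames S g. *)
Theorem model_tensors : characteristic_tensors (@un0 R n) model T0 R0 I0.
Proof.
split=> //.
- split=> [u|c u v B C]; first by exists (lam u).
  rewrite !I0E lam_linear => EB EC.
  have mem D : gl_class (@un0 R n) D D by exists 0; [exact: un0_0|rewrite addr0].
  have [B' uB' <-] : gl_class (@un0 R n) (lam u) B by rewrite EB.
  have [C' uC' <-] : gl_class (@un0 R n) (lam v) C by rewrite EC.
  by rewrite scalerDr addrACA [RHS]gl_class_eq //; apply: un0D => //; exact: un0Z.
- move=> x _ u v X Y [g Ug <-] sX sY EX EY.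
  have cX : comps S X (set_val x) = g *m u.
    by rewrite comps_val EX -mulmxA mulKmx // unitS.
  have cY : comps S Y (set_val x) = g *m v.
    by rewrite comps_val EY -mulmxA mulKmx // unitS.
  have := frame_torsion (Wx0 := Wx0) sS uS Eq1 sX sY; rewrite /= cX cY -T0_equiv // => E.
  by rewrite -mulmxA; exact: E.
- move=> x _ u v w X Y Z [g Ug <-] sX sY sZ EX EY EZ.
  have cX : comps S X (set_val x) = g *m u.
    by rewrite comps_val EX -mulmxA mulKmx // unitS.
  have cY : comps S Y (set_val x) = g *m v.
    by rewrite comps_val EY -mulmxA mulKmx // unitS.
  have cZ : comps S Z (set_val x) = g *m w.
    by rewrite comps_val EZ -mulmxA mulKmx // unitS.
  have := frame_curvature (Wx0 := Wx0) sS uS linL sL Eq1 Eq2 sX sY sZ.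
  rewrite /= cX cY cZ (mulmxA _ g w) R0_equiv // => E.
  by rewrite -(mulmxA _ g) (mulmxA g); exact: E.
- move=> x p u Pp; have up := structure_frame frames_structure Pp.
  have key U s : local_section (structure model) U s -> U x ->
      Ad_set (s x) (gl_class (@un0 R n) (Lambda s x (invmx (s x) *m (p *m u))))
      = Ad_set p (I0 u).
    move=> ls Ux; have [B uB ->] := model_Lambda (invmx (s x) *m (p *m u)) ls Ux.
    rewrite gl_class_eq // I0E.
    have [_ Ps _] := ls.
    have [k Uk sE] := structure_transitive frames_structure Pp (Ps x Ux).
    have -> : invmx (s x) *m (p *m u) = invmx k *m u.
      by rewrite sE invmx_mulmx // ?Un1_unit // -mulmxA mulKmx.
    by rewrite sE Ad_lam.
  apply/seteqP; split=> [D [U [s [ls Ux]]]|D HD].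
    by rewrite (key U s ls Ux).
  have [U [s [ls Ux]]] := structure_section frames_structure x.
  by exists U, s; split=> //; rewrite (key U s ls Ux).
Qed.

End ModelManifold.

(** * Reduction of the existence problem to the unitary part *)

Section Equivariance.
Variables (R : realType) (n : nat) (a b alpha beta gamma delta mu nu sig k : R).
Local Notation H := 'cV[R]_(n + n).
Local Notation V := 'cV[R]_(n + n + 1).
Local Notation Mx := 'M[R]_(n + n + 1).
Local Notation lam := (@lam R n a b alpha beta gamma delta).
Local Notation Tm := (@Tm R n mu nu sig).
Local Notation Rm1 := (@Rm1 R n nu sig k).
Local Notation Rm := (@Rm R n a b alpha beta gamma delta mu nu sig k).

Lemma Kmx_Un (A : 'M[R]_(n + n)) X Y : @Un R n A -> A *m Kmx X Y = Kmx (A *m X) (A *m Y) *m A.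
Proof.
move=> UA; apply: mx_vec_eq => Z; rewrite -!mulmxA !KmxE /K.
rewrite !(Un_h0 _ _ UA) !(Un_omega0 _ _ UA) -!(Un_J _ UA).
by rewrite !(mulmxDr, mulmxN, =^~ scalemxAr).
Qed.

Lemma Rm1_Un1 g u v : @Un1 R n g -> g *m Rm1 u v = Rm1 (g *m u) (g *m v) *m g.
Proof.
move=> /Un1_act[A UA [tg bg]]; apply: mxV_eq => w; rewrite -!mulmxA; apply: V_eq.
  rewrite tg !top_Rm1 !tg (Un_omega0 _ _ UA) mulmxDr mulmxN -!scalemxAr -(Un_J _ UA).
  by rewrite !mulmxA (Kmx_Un _ _ UA).
by rewrite bg !bot_Rm1.
Qed.

Lemma Rm_Un1 g u v : @Un1 R n g -> Rm (g *m u) (g *m v) *m g = g *m Rm u v.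
Proof.
move=> Ug.
have E1 := Rm1_Un1 u v Ug; have ET := Tm_Un1 mu nu sig u v Ug.
have El w := lam_Un1 a b alpha beta gamma delta w Ug.
have aux (r r' t t' l l' m m' : Mx) : g *m r = r' *m g -> g *m t = t' *m g ->
    g *m l = l' *m g -> g *m m = m' *m g ->
    (r' + t' + (l' *m m' - m' *m l')) *m g = g *m (r + t + (l *m m - m *m l)).
  move=> Er Et El' Em; rewrite !(mulmxDl, mulmxDr, mulmxN, mulNmx) -Er -Et.
  by rewrite !mulmxA El' Em -!mulmxA El' Em !mulmxA.
apply: aux => //.
by rewrite El ET.
Qed.

Lemma Rm1_linear c u v w : Rm1 (c *: u + v) w = c *: Rm1 u w + Rm1 v w.
Proof.
have kK := @K_kahler R n.
have aux (t t' : R) (p q : 'M[R]_(n + n)) (x : H) :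
    k *: ((c *: p + q) *m x) - (sig * nu * (c * t + t')) *: (@J0 R n *m x) =
    c *: (k *: (p *m x) - (sig * nu * t) *: (@J0 R n *m x))
    + (k *: (q *m x) - (sig * nu * t') *: (@J0 R n *m x)).
  by rewrite mulmxDl -scalemxAl; mx_entries; ring.
apply: mxV_eq => x; rewrite mulmxDl -scalemxAl; apply: V_eq.
  rewrite [LHS]top_Rm1 [RHS]topD topZ; apply: etrans (esym (congr2 (fun s t => _ *: s + t)
    (top_Rm1 nu sig k u w x) (top_Rm1 nu sig k v w x))).
  apply: etrans (aux _ _ _ _ _).
  by rewrite topD topZ (kl_add kK) (kl_scale kK) omega0Dl omega0Zl.
rewrite [LHS]bot_block00 [RHS]botD botZ.
by apply: esym; apply: etrans (congr2 (fun s t => _ * s + t) (bot_block00 _ _ _) (bot_block00 _ _ _)) _; rewrite mulr0 addr0.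
Qed.

Lemma Rm1_anti u v : Rm1 u v = - Rm1 v u.
Proof.
have kK := @K_kahler R n; rewrite /Rm1 opp_block_mx !oppr0.
by rewrite (kl_anti kK) (omega0C (top u)) mulrN scalerN scaleNr opprB opprK addrC.
Qed.

Lemma Rm_form : alternating_bilinear Rm.
Proof.
split=> [c u u' v|u v]; rewrite /Rm.
  have aux (r r' t t' l l' m : Mx) : c *: r + r' + (c *: t + t')
      + ((c *: l + l') *m m - m *m (c *: l + l')) =
      c *: (r + t + (l *m m - m *m l)) + (r' + t' + (l' *m m - m *m l')).
    by rewrite mulmxDl mulmxDr -scalemxAl -scalemxAr; mx_entries; ring.
  apply: etrans (aux _ _ _ _ _ _ _).
  by rewrite Rm1_linear Tm_linear !lam_linear.
have aux (r t l m : Mx) : - r - t + (l *m m - m *m l) = - (r + t + (m *m l - l *m m)).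
  by mx_entries; ring.
apply: etrans (aux _ _ _ _).
by rewrite Rm1_anti Tm_anti lamN.
Qed.

(** The connection with coefficients lam + A in the frame S has torsion T0 and
    curvature Rm as soon as its unitary part A has torsion Tm and curvature Rm1: the
    mixed terms are those of the equivariance of lam. *)
Lemma model_from_frame (W : set V) (x0 : V) (S : V -> Mx) (A : V -> V -> Mx)
    (T0 : V -> V -> V) (R0 : V -> V -> Mx) (I0 : V -> set Mx) :
  open W -> W x0 -> C_infty W S -> (forall z, W z -> S z \in unitmx) ->
  (forall z c u v, W z -> A z (c *: u + v) = c *: A z u + A z v) ->
  (forall u, C_infty W (fun z => A z u)) ->
  (forall z u, W z -> @un0 R n (A z u)) ->
  (forall z u v, W z -> 'D_(S z *m u) S z *m v - 'D_(S z *m v) S z *m u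
    = S z *m (A z u *m v - A z v *m u - Tm u v)) ->
  (forall z u v, W z ->
    'D_(S z *m u) (fun p => A p v) z - 'D_(S z *m v) (fun p => A p u) z
    + (A z u *m A z v - A z v *m A z u)
    - A z (A z u *m v - A z v *m u - Tm u v) = Rm1 u v) ->
  alternating_bilinear T0 ->
  (forall u v, T0 u v = Tm u v + lam u *m v - lam v *m u) ->
  (forall u v, R0 u v = Rm u v) ->
  (forall u, I0 u = gl_class (@un0 R n) (lam u)) ->
  exists M : affine_manifold (@Un1 R n), characteristic_tensors (@un0 R n) M T0 R0 I0.
Proof.
move=> oW Wx0 sS uS linA sA uA E1 E2 T0f T0E R0E I0E.
have bracketE z u v : (lam u + A z u) *m v - (lam v + A z v) *m u - T0 u v
    = A z u *m v - A z v *m u - Tm u v.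
  have aux (lu lv x y t : V) : lu + x - (lv + y) - (t + lu - lv) = x - y - t.
    by mx_entries; ring.
  by rewrite T0E !mulmxDl aux.
eexists; apply: (@model_tensors R n a b alpha beta gamma delta W x0 oW Wx0 S A sS uS linA sA uA T0 R0 I0) => //.
- split=> [c u u' v|u v]; rewrite !R0E; first by rewrite Rm_form.1.
  by rewrite {1}Rm_form.2.
- move=> g u v Ug; rewrite !T0E !mulmxDr mulmxN (Tm_Un1 mu nu sig u v Ug).
  by rewrite !mulmxA !(lam_Un1 _ _ _ _ _ _ _ Ug).
- by move=> g u v Ug; rewrite !R0E Rm_Un1.
- by move=> z u v Wz; rewrite E1 // bracketE.
- move=> z u v Wz; rewrite bracketE R0E /Rm -(E2 z u v Wz).
  have D w x : 'D_x (fun p => lam w + A p w) z = 'D_x (fun p => A p w) z.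
    apply: etrans (derive_addmx x Wz (C_infty_cst _ oW) (sA w)) _.
    by rewrite (derive_cst (lam w)) add0r.
  apply: etrans (congr1 (fun t => t - _) (congr1 (fun t => t - _)
    (congr1 (fun t => t + _) (congr2 (fun s t => s - t) (D v _) (D u _))))) _.
  have F1 := lam_un0 a b alpha beta gamma delta v (uA z u Wz).
  have F2 := lam_un0 a b alpha beta gamma delta u (uA z v Wz).
  have F3 : lam (A z u *m v - A z v *m u - Tm u v)
    = lam (A z u *m v) - lam (A z v *m u) - lam (Tm u v) by rewrite !lamD !lamN.
  have aux (d1 d2 lu lv au av c x y t : Mx) (dc : Mx) :
      au *m lv - lv *m au = x -> av *m lu - lu *m av = y -> dc = x - y - t ->
      d1 - d2 + (lu + au) *m (lv + av) - (lv + av) *m (lu + au) - (dc + c) =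
      d1 - d2 + (au *m av - av *m au) - c + t + (lu *m lv - lv *m lu).
    move=> <- <- ->; rewrite !mulmxDl !mulmxDr.
    by mx_entries; ring.
  exact: aux F1 F2 F3.
Qed.
End Equivariance.

(** * Smooth maps with explicit derivatives *)

(** A smooth map together with a formula for its directional derivatives: the
    combinators below compute both at once. *)
Definition has_diff {R : realType} {m : nat} {E : normedModType R} (W : set 'cV[R]_m)
    (F : 'cV[R]_m -> E) (F' : 'cV[R]_m -> 'cV[R]_m -> E) : Prop :=
  C_infty W F /\ forall z v, W z -> 'D_v F z = F' z v.

Section HasDiff.
Variables (R : realType) (m : nat) (W : set 'cV[R]_m).
Hypothesis oW : open W.
Local Notation V := 'cV[R]_m.
Local Notation hd := (has_diff W).
Local Notation hdR := (has_diff (E := R^o) W).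

Lemma hd_cst {E : normedModType R} (c : E) : hd (fun _ => c) (fun _ _ => 0).
Proof. by split=> [|z v Wz]; [exact: C_infty_cst|exact: derive_cst]. Qed.

Lemma hd_add p q (F G : V -> 'M[R]_(p, q)) F' G' : hd F F' -> hd G G' ->
  hd (fun z => F z + G z) (fun z v => F' z v + G' z v).
Proof.
move=> [sF dF] [sG dG]; split=> [|z v Wz]; first exact: smooth_add.
by rewrite -dF // -dG //; exact: derive_addmx Wz sF sG.
Qed.

Lemma hd_opp p q (F : V -> 'M[R]_(p, q)) F' : hd F F' -> hd (fun z => - F z) (fun z v => - F' z v).
Proof.
move=> [sF dF]; split=> [|z v Wz]; first exact: smooth_opp.
by rewrite -dF //; exact: derive_oppmx Wz sF.
Qed.

Lemma hd_scale p q (f : V -> R) (F : V -> 'M[R]_(p, q)) f' F' : hdR f f' -> hd F F' ->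
  hd (fun z => f z *: F z) (fun z v => f' z v *: F z + f z *: F' z v).
Proof.
move=> [sf df] [sF dF]; split=> [|z v Wz]; first exact: smooth_scale.
by rewrite -df // -dF //; exact: derive_scalemx oW Wz sf sF.
Qed.

Lemma hd_mull p q r (B : 'M[R]_(p, q)) (F : V -> 'M[R]_(q, r)) F' : hd F F' ->
  hd (fun z => B *m F z) (fun z v => B *m F' z v).
Proof.
move=> [sF dF]; split=> [|z v Wz]; first exact: smooth_mulcmx.
by rewrite -dF //; exact: derive_mulcmx oW Wz sF.
Qed.

Lemma hd_id : hd (fun z => z) (fun _ v => v).
Proof.
split=> [|z v Wz]; first exact: smooth_id.
exact: derive_id.
Qed.

Lemma hd_entry p q (F : V -> 'M[R]_(p, q)) F' i j : hd F F' ->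
  hdR (fun z => F z i j) (fun z v => F' z v i j).
Proof.
move=> [sF dF]; split=> [|z v Wz]; first exact: smooth_entry.
by rewrite -dF // (derive_entry _ _ _ sF Wz).
Qed.

Lemma hdR_add f g f' g' : hdR f f' -> hdR g g' ->
  hdR (fun z => f z + g z) (fun z v => f' z v + g' z v).
Proof.
move=> [sf df] [sg dg]; split=> [|z v Wz]; first exact: smoothD.
rewrite -df // -dg //; apply: deriveD; exact: C_infty_derivable Wz.
Qed.

Lemma hdR_mul f g f' g' : hdR f f' -> hdR g g' ->
  hdR (fun z => f z * g z) (fun z v => f' z v * g z + f z * g' z v).
Proof.
move=> [sf df] [sg dg]; split=> [|z v Wz]; first exact: smoothM.
rewrite -df // -dg // addrC [X in _ = _ + X]mulrC; apply: deriveM; exact: C_infty_derivable Wz.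
Qed.

Lemma hdR_inv f f' : hdR f f' -> (forall z, W z -> f z != 0) ->
  hdR (fun z => (f z)^-1) (fun z v => - f' z v / f z ^+ 2).
Proof.
move=> [sf df] f0; split=> [|z v Wz]; first exact: smoothV.
rewrite -df // mulNr mulrC -mulNr; apply: deriveV; [exact: f0|exact: C_infty_derivable Wz].
Qed.

Lemma hd_h0 n (F G : V -> 'cV[R]_(n + n)) F' G' : hd F F' -> hd G G' ->
  hdR (fun z => h0 (F z) (G z)) (fun z v => h0 (F' z v) (G z) + h0 (F z) (G' z v)).
Proof.
move=> hF hG.
have h k := hdR_mul (hd_entry k 0 hF) (hd_entry k 0 hG).
have sk k := (h k).1.
have sh : C_infty W ((fun z => h0 (F z) (G z)) : V -> R^o).
  apply: (C_infty_eq_on (f := fun z => \sum_k F z k 0 * G z k 0)) => //.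
    by move=> z _; rewrite h0E.
  by apply: smooth_sum => // k _; exact: sk.
split=> // z v Wz.
apply: etrans (etrans (derive_sumR v Wz sk) _).
  by apply: (derive_eq_on _ oW Wz) => y _; rewrite h0E.
rewrite (eq_bigr _ (fun k _ => (h k).2 z v Wz)) big_split /=.
by rewrite !h0E.
Qed.

Lemma hd_omega0 n (F G : V -> 'cV[R]_(n + n)) F' G' : hd F F' -> hd G G' ->
  hdR (fun z => omega0 (F z) (G z)) (fun z v => omega0 (F' z v) (G z) + omega0 (F z) (G' z v)).
Proof. by move=> hF hG; exact: hd_h0 (hd_mull J0 hF) hG. Qed.

Lemma hd_eq {E : normedModType R} (F G : V -> E) F' G' : hd F F' -> (forall z, W z -> F z = G z) ->
  (forall z v, W z -> F' z v = G' z v) -> hd G G'.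
Proof.
move=> [sF dF] FG FG'; have FG1 : {in W, F =1 G} by move=> z; rewrite inE => /FG.
split=> [|z v Wz]; first exact: C_infty_eq_on sF.
by rewrite -FG' // -dF //; apply: esym; apply: (derive_eq_on _ oW Wz).
Qed.
End HasDiff.

Section Top.
Variables (R : realType) (n : nat) (W : set 'cV[R]_(n + n + 1)).
Hypothesis oW : open W.

Lemma hd_top : has_diff W (@top R n) (fun _ v => top v).
Proof.
have E z : row_mx 1%:M 0 *m z = @top R n z.
  by rewrite [in LHS](split_col z) mul_row_col mul1mx mul0mx addr0.
apply: (hd_eq oW (hd_mull oW (row_mx 1%:M 0) (hd_id oW))) => *; exact: E.
Qed.
Lemma hd_bot : has_diff (E := R^o) W (@bot R n) (fun _ v => bot v).
Proof.
apply: (hd_eq oW (hd_entry oW (rshift (n + n) 0) 0 (hd_id oW))) => *; by rewrite /bot mxE.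
Qed.
End Top.

(** * Identities for a unitary frame of a complex space form *)

Section ModelAlgebra.
Variables (R : realType) (n : nat) (q sig : R).
Local Notation H := 'cV[R]_(n + n).
Local Notation J := (@J0 R n).
Implicit Types (w P X Y v : H).

(** The functions rho, eps and the vectors coframe w X describe a unitary frame for
    the Fubini-Study metric, or for its hyperbolic or flat analogue according to the
    sign of q, on a ball in H0.  Say q > 0, and let phi be the distance from the origin,
    up to a factor.  The Fubini-Study metric scales the radial direction by 1, the
    direction J w by sin phi cos phi and the others by sin phi; the radial coordinate
    tan (phi / 2) = sqrt q |w| makes all these factors rational in w.  So rho is
    1 + tan^2 (phi / 2) and eps is 1 - tan^2 (phi / 2). *)
Definition rho w := 1 + q * h0 w w.
Definition eps w := 1 - q * h0 w w.
Definition theta w X := (eps w)^-1 * omega0 w X.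
Definition coframe w X := rho w *: (X + (2 * q * theta w X) *: (J *m w)).
(** The Levi-Civita connection coefficients of that metric in the frame coframe. *)
Definition conn w X v :=
  (2 * q) *: (h0 X v *: w + omega0 X v *: (J *m w) - h0 w v *: X - omega0 w v *: (J *m X)
    - (2 * theta w X) *: (q *: (h0 w v *: (J *m w) - omega0 w v *: w) + J *m v)).

(** The derivatives of theta, coframe and conn in the direction P ([hd_theta],
    [hd_coframe], [hd_conn]); they are kept as formulas so that the identities below
    are purely algebraic. *)
Definition dtheta w P X := 2 * q * h0 w P / eps w ^+ 2 * omega0 w X + (eps w)^-1 * omega0 P X.
Definition dcoframe w P X := (2 * q * h0 w P) *: (X + (2 * q * theta w X) *: (J *m w))
  + rho w *: ((2 * q * dtheta w P X) *: (J *m w) + (2 * q * theta w X) *: (J *m P)).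
Definition dconn w P X v :=
  (2 * q) *: (h0 X v *: P + omega0 X v *: (J *m P) - h0 P v *: X - omega0 P v *: (J *m X)
    - (2 * dtheta w P X) *: (q *: (h0 w v *: (J *m w) - omega0 w v *: w) + J *m v)
    - (2 * theta w X) *: (q *: (h0 P v *: (J *m w) + h0 w v *: (J *m P)
         - (omega0 P v *: w + omega0 w v *: P)))).

(** The frame is torsion-free for [conn]. *)
Lemma dcoframeE w X Y : eps w != 0 ->
  dcoframe w (coframe w X) Y - dcoframe w (coframe w Y) X
  = coframe w (conn w X Y - conn w Y X).
Proof.
rewrite /dcoframe /dtheta /coframe /conn /theta => e0.
rewrite !h0_simp ?(h0C X w) ?(h0C Y w) ?(omega0C X w) ?(omega0C Y w) ?(h0C Y X) ?(omega0C Y X).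
rewrite /rho /eps in e0 *.
rewrite ?(mulmxDr, mulmxN) -?scalemxAr ?mulmxDr ?mulmxN -?scalemxAr ?mulJJ.
by mx_entries; field.
Qed.

(** Up to a factor, theta is a primitive of the Kahler form: the connection form of
    the line bundle is built from it. *)
Lemma dthetaE w X Y : eps w != 0 ->
  dtheta w (coframe w X) Y - dtheta w (coframe w Y) X
  = 2 * omega0 X Y + theta w (conn w X Y - conn w Y X).
Proof.
rewrite /dtheta /coframe /conn /theta => e0.
rewrite !h0_simp ?(h0C X w) ?(h0C Y w) ?(omega0C X w) ?(omega0C Y w) ?(h0C Y X) ?(omega0C Y X).
rewrite /rho /eps in e0 *.
by field.
Qed.

Lemma conn_curvature w X Y v : eps w != 0 ->
  dconn w (coframe w X) Y v - dconn w (coframe w Y) X v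
  + (conn w X (conn w Y v) - conn w Y (conn w X v))
  - conn w (conn w X Y - conn w Y X) v = (16 * q) *: K X Y v.
Proof.
rewrite /dconn /dtheta /coframe /conn /theta /K => e0.
rewrite !h0_simp ?(h0C X w) ?(h0C Y w) ?(omega0C X w) ?(omega0C Y w) ?(h0C Y X) ?(omega0C Y X).
rewrite ?(h0C v w) ?(h0C v X) ?(h0C v Y) ?(omega0C v w) ?(omega0C v X) ?(omega0C v Y).
rewrite /rho /eps in e0 *.
rewrite ?(mulmxDr, mulmxN) -?scalemxAr ?mulmxDr ?mulmxN -?scalemxAr ?mulJJ.
do 3? rewrite ?mulmxDr ?mulmxN -?scalemxAr ?mulJJ.
move: (J *m w) (J *m X) (J *m Y) (J *m v) e0.
move: (h0 w w) (h0 w X) (h0 w Y) (h0 w v) (h0 X X) (h0 Y Y) (h0 X Y) (h0 X v) (h0 Y v).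
move: (omega0 w X) (omega0 w Y) (omega0 w v) (omega0 X Y) (omega0 X v) (omega0 Y v).
move=> a1 a2 a3 a4 a5 a6 b1 b2 b3 b4 b5 b6 b7 b8 b9 Jw JX JY Jv' e0.
apply/matrixP => i j; rewrite !(addmxE, oppmxE, scalemxE).
by field.
Qed.
End ModelAlgebra.

(** * The model for mu = 0 *)

Section Columns.
Variables (R : realType) (n : nat) (W : set 'cV[R]_(n + n + 1)).
Hypothesis oW : open W.
Local Notation V := 'cV[R]_(n + n + 1).
Local Notation H := 'cV[R]_(n + n).

Lemma smooth_columns m p q (U : set 'cV[R]_m) (F : 'cV[R]_m -> 'M[R]_(p, q)) : open U ->
  (forall v : 'cV[R]_q, C_infty U (fun z => F z *m v)) -> C_infty U F.
Proof.
move=> oU sF; apply/smooth_mxP => // i j.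
apply: C_infty_eq_on (smooth_entry i 0 oU (sF (delta_mx j 0))) => // z _.
by rewrite -colE mxE.
Qed.

Lemma col_mxE (X : H) (s : R) : col_mx X s%:M = col_mx 1%:M 0 *m X + s *: @e R n.
Proof.
apply: V_eq; rewrite ?top_col ?bot_col ?topD ?botD ?topZ ?botZ ?top_e ?bot_e.
  by rewrite /top mul_col_mx col_mxKu mul1mx scaler0 addr0.
by rewrite /bot mul_col_mx col_mxKd mul0mx mxE add0r mulr1.
Qed.

Lemma hd_col (F : V -> V) (F' : V -> V -> H) (f' : V -> V -> R) :
  has_diff W (fun z => top (F z)) F' -> has_diff (E := R^o) W (fun z => bot (F z)) f' ->
  has_diff W F (fun z v => col_mx (F' z v) (f' z v)%:M).
Proof.
move=> hF hf.
have h := hd_add oW (hd_mull oW (col_mx 1%:M 0) hF) (hd_scale oW hf (hd_cst oW (@e R n))).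
apply: hd_eq h _ _ => // [z _|z v _]; first by rewrite -col_mxE -split_col.
by rewrite scaler0 addr0 col_mxE.
Qed.
End Columns.

Section SpaceFormModel.
Variables (R : realType) (n : nat) (q nu sig : R).
Local Notation V := 'cV[R]_(n + n + 1).
Local Notation Mx := 'M[R]_(n + n + 1).
Local Notation H := 'cV[R]_(n + n).
Local Notation J := (@J0 R n).
Local Notation rho := (rho q).
Local Notation eps := (eps q).
Local Notation theta := (theta q).
Local Notation coframe := (coframe q).
Local Notation conn := (conn q).

(** The space form has the holomorphic sectional curvature parameter k = 16 q; the
    second coordinate of V is the fibre of the line bundle. *)
Definition sf_domain : set V := [set z | 0 < rho (top z) /\ 0 < eps (top z)].

(** The horizontal lift of coframe for the connection form sig / 2 * theta, and the
    vertical vector e. *)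
Definition sf_frame (z : V) : Mx :=
  block_mx (rho (top z) *: (1%:M + (2 * q / eps (top z)) *: (J *m top z *m (J *m top z)^T))) 0
           (flat ((- (sig / 2) / eps (top z)) *: (J *m top z))) 1%:M.

Definition conn_mx (w X : H) : 'M[R]_(n + n) :=
  (2 * q) *: (w *m X^T + J *m w *m (J *m X)^T - X *m w^T - J *m X *m (J *m w)^T
    - (2 * theta w X) *: (q *: (J *m w *m w^T - w *m (J *m w)^T) + J)).

(** The Levi-Civita connection of the base, with a twist by - nu J along the fibre that
    produces the torsion in the direction (H0, e). *)
Definition sf_conn (z u : V) : Mx :=
  block_mx (conn_mx (top z) (top u) - (nu * bot u) *: J) 0 0 0.

Lemma conn_mxE w X v : conn_mx w X *m v = conn w X v.
Proof.
rewrite /conn_mx /conn -scalemxAl !(mulmxDl, mulNmx) -(scalemxAl (2 * _)) !(mulmxDl, mulNmx).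
rewrite -(scalemxAl q) !(mulmxDl, mulNmx) !outerE.
by [].
Qed.

Lemma conn_mx_un w X : @un R n (conn_mx w X).
Proof.
split; last first.
  apply: mx_vec_eq => v; rewrite -!mulmxA !conn_mxE /conn !h0_simp.
  rewrite -scalemxAr !(mulmxDr, mulmxN, mulmxBr) -!scalemxAr !(mulmxDr, mulmxN, mulmxBr) -!scalemxAr !mulJJ.
  by rewrite !(mulmxDr, mulmxN, mulmxBr) -!scalemxAr !mulJJ; mx_entries; ring.
rewrite /conn_mx.
have tD (A B : 'M[R]_(n + n)) : (A + B)^T = A^T + B^T by exact: linearD.
have tN (A : 'M[R]_(n + n)) : (- A)^T = - A^T by exact: linearN.
have tZ c (A : 'M[R]_(n + n)) : (c *: A)^T = c *: A^T by exact: linearZ.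
have tt (X1 Y1 : H) : (X1 *m Y1^T)^T = Y1 *m X1^T by rewrite trmx_mul trmxK.
rewrite tZ !(tD, tN, tZ) !tt JT.
by mx_entries; ring.
Qed.

Lemma top_frame z u : top (sf_frame z *m u) = coframe (top z) (top u).
Proof.
rewrite /sf_frame top_block scaler0 addr0 -scalemxAl mulmxDl mul1mx -scalemxAl outerE.
by rewrite /coframe /theta scalerA mulrA.
Qed.

Lemma bot_frame z u : bot (sf_frame z *m u) = bot u - sig / 2 * theta (top z) (top u).
Proof. by rewrite /sf_frame bot_block mul1r h0Zl /theta /omega0; ring. Qed.

Lemma top_conn z u v :
  top (sf_conn z u *m v) = conn (top z) (top u) (top v) - (nu * bot u) *: (J *m top v).
Proof. by rewrite /sf_conn top_block scaler0 addr0 mulmxBl conn_mxE -scalemxAl. Qed.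

Lemma bot_conn z u v : bot (sf_conn z u *m v) = 0.
Proof. exact: bot_block00. Qed.

Local Notation c z u v := (sf_conn z u *m v - sf_conn z v *m u - @Tm R n 0 nu sig u v).

Lemma top_c z u v :
  top (c z u v) = conn (top z) (top u) (top v) - conn (top z) (top v) (top u).
Proof.
rewrite !topD !topN !top_conn top_Tm /Nl !scale0r !add0r.
by mx_entries; ring.
Qed.

Lemma bot_c z u v : bot (c z u v) = - (sig * omega0 (top u) (top v)).
Proof. by rewrite !botD !botN !bot_conn bot_Tm; ring. Qed.

Lemma sf_conn_un0 z u : @un0 R n (sf_conn z u).
Proof.
exists (conn_mx (top z) (top u) - (nu * bot u) *: J) => //.
have [AT AJ] := conn_mx_un (top z) (top u); split.
  have tB (A : 'M[R]_(n + n)) d : (A - d *: J)^T = A^T - d *: J^T by rewrite linearB linearZ.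
  by rewrite tB AT JT scalerN opprB opprK addrC.
by rewrite mulmxBl mulmxBr AJ -(scalemxAl _ J J) -(scalemxAr _ J J).
Qed.

Lemma conn_linear w d (X Y v : H) : conn w (d *: X + Y) v = d *: conn w X v + conn w Y v.
Proof.
by rewrite /conn /theta !h0_simp !mulmxDr -!scalemxAr; mx_entries; ring.
Qed.

Lemma sf_conn_linear z d u v : sf_conn z (d *: u + v) = d *: sf_conn z u + sf_conn z v.
Proof.
apply: mxV_eq => x; rewrite mulmxDl -scalemxAl; apply: V_eq.
  rewrite topD topZ !top_conn topD topZ botD botZ conn_linear.
  by mx_entries; ring.
by rewrite botD botZ !bot_conn mulr0 addr0.
Qed.

Local Notation hdR := (has_diff (E := R^o) sf_domain).

Let hd_sq : has_diff (E := R^o) setT (fun z : V => h0 (top z) (top z))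
  (fun z v => 2 * h0 (top z) (top v)).
Proof.
apply: (hd_eq openT (hd_h0 openT (hd_top openT) (hd_top openT))) => // z v _.
by rewrite (h0C (top v)); ring.
Qed.

Lemma open_sf : open sf_domain.
Proof.
have ct (d : R) : continuous (fun z : V => 1 + d * h0 (top z) (top z)).
  move=> z; have h := hdR_add openT (hd_cst (E := R^o) openT (1 : R))
    (hdR_mul openT (hd_cst (E := R^o) openT d) hd_sq).
  exact: (C_infty_continuous h.1 (I : setT z)).
have op (d : R) : open [set z : V | 0 < 1 + d * h0 (top z) (top z)].
  apply: (@open_comp _ _ (fun z : V => 1 + d * h0 (top z) (top z)) [set x : R | 0 < x]).
    by move=> z _; exact: ct.
  exact: open_gt.
rewrite (_ : sf_domain = [set z | 0 < 1 + q * h0 (top z) (top z)]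
   `&` [set z | 0 < 1 + (- q) * h0 (top z) (top z)]); first exact: openI.
by apply/seteqP; split=> z; rewrite /sf_domain /rho /eps /= mulNr.
Qed.

Lemma sf_domain0 : sf_domain 0.
Proof. by split; rewrite /rho /eps /top linear0 h00l mulr0 ?subr0 ?addr0 ltr01. Qed.

Let hsq : hdR (fun z => h0 (top z) (top z)) (fun z v => 2 * h0 (top z) (top v)).
Proof.
have [s d] := hd_sq; split=> [|z v _]; last exact: d.
by apply: C_infty_sub s => z.
Qed.

Let hd_rho : hdR (fun z => rho (top z)) (fun z v => 2 * q * h0 (top z) (top v)).
Proof.
apply: (hd_eq open_sf (hdR_add open_sf (hd_cst (E := R^o) open_sf (1 : R))
  (hdR_mul open_sf (hd_cst (E := R^o) open_sf q) hsq))) => // z v _.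
by ring.
Qed.

Let hd_eps : hdR (fun z => eps (top z)) (fun z v => - (2 * q * h0 (top z) (top v))).
Proof.
apply: (hd_eq open_sf (hdR_add open_sf (hd_cst (E := R^o) open_sf (1 : R))
  (hdR_mul open_sf (hd_cst (E := R^o) open_sf (- q)) hsq))) => // [z _|z v _].
  by rewrite /eps; ring.
by ring.
Qed.

Let eps_neq0 z : sf_domain z -> eps (top z) != 0.
Proof. by move=> [_ e0]; rewrite gt_eqF. Qed.

Let hd_theta X : hdR (fun z => theta (top z) X) (fun z v => dtheta q (top z) (top v) X).
Proof.
have hT := hd_top open_sf; have hX := hd_cst open_sf X.
apply: (hd_eq open_sf (hdR_mul open_sf (hdR_inv open_sf hd_eps eps_neq0)
  (hd_omega0 open_sf hT hX))) => // z v Wz.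
by rewrite /dtheta omega00r; field; exact: eps_neq0.
Qed.

Let hd_const_mul (d : R) f f' : hdR f f' -> hdR (fun z => d * f z) (fun z v => d * f' z v).
Proof.
move=> h; apply: (hd_eq open_sf (hdR_mul open_sf (hd_cst (E := R^o) open_sf d) h)) => // z v _.
by rewrite mul0r add0r.
Qed.

Lemma hd_coframe X : has_diff sf_domain (fun z => coframe (top z) X)
  (fun z v => dcoframe q (top z) (top v) X).
Proof.
have o := open_sf; have hT := hd_top o; have hX := hd_cst o X.
apply: (hd_eq o (hd_scale o hd_rho (hd_add o hX (hd_scale o (hd_const_mul (2 * q) (hd_theta X))
  (hd_mull o J hT))))) => // z v Wz.
by rewrite add0r.
Qed.

Lemma hd_conn X Y : has_diff sf_domain (fun z => conn (top z) X Y)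
  (fun z v => dconn q (top z) (top v) X Y).
Proof.
have o := open_sf; have hT := hd_top o; have hJT := hd_mull o J hT.
have hX := hd_cst o X; have hJX := hd_cst o (J *m X); have hY := hd_cst o Y.
have hJY := hd_cst o (J *m Y).
have hh := hd_h0 o hT hY; have hw := hd_omega0 o hT hY.
have hc (d : R) := hd_cst (E := R^o) o d.
apply: (hd_eq o (hd_scale o (hc (2 * q))
  (hd_add o (hd_add o (hd_add o (hd_add o (hd_scale o (hc (h0 X Y)) hT)
       (hd_scale o (hc (omega0 X Y)) hJT)) (hd_opp o (hd_scale o hh hX)))
       (hd_opp o (hd_scale o hw hJX)))
    (hd_opp o (hd_scale o (hd_const_mul 2 (hd_theta X))
      (hd_add o (hd_scale o (hc q) (hd_add o (hd_scale o hh hJT) (hd_opp o (hd_scale o hw hT))))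
         hJY)))))) => // z v Wz.
rewrite /dconn !h00r !omega00r.
by mx_entries; ring.
Qed.

Lemma hd_frame u : has_diff sf_domain (fun z => sf_frame z *m u)
  (fun z v => col_mx (dcoframe q (top z) (top v) (top u))
    (- (sig / 2) * dtheta q (top z) (top v) (top u))%:M).
Proof.
have o := open_sf; apply: hd_col => //.
  by apply: (hd_eq o (hd_coframe (top u))) => // z _; rewrite top_frame.
apply: (hd_eq o (hdR_add o (hd_cst (E := R^o) o (bot u))
  (hd_const_mul (- (sig / 2)) (hd_theta (top u))))) => // [z _|z v _].
  by rewrite bot_frame mulNr.
by rewrite add0r.
Qed.

Lemma hd_sf_conn u x : has_diff sf_domain (fun z => sf_conn z u *m x)
  (fun z v => col_mx (dconn q (top z) (top v) (top u) (top x)) 0%:M).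
Proof.
have o := open_sf; apply: hd_col => //.
  apply: (hd_eq o (hd_add o (hd_conn (top u) (top x))
    (hd_cst o (- ((nu * bot u) *: (J *m top x)))))) => // [z _|z v _].
    by rewrite top_conn.
  by rewrite addr0.
by apply: (hd_eq o (hd_cst (E := R^o) o (0 : R))) => // z _; rewrite bot_conn.
Qed.

Lemma sf_frame_smooth : C_infty sf_domain sf_frame.
Proof. by apply: (smooth_columns open_sf) => u; have [] := hd_frame u. Qed.

Lemma sf_conn_smooth u : C_infty sf_domain (fun z => sf_conn z u).
Proof. by apply: (smooth_columns open_sf) => x; have [] := hd_sf_conn u x. Qed.

(** A kernel vector u satisfies omega0 w u = 0, by pairing the horizontal
    equation with w, and then u = 0. *)
Lemma sf_frame_unit z : sf_domain z -> sf_frame z \in unitmx.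
Proof.
move=> Wz; have e0 := eps_neq0 Wz; have r0 : rho (top z) != 0 by have [r0 _] := Wz; rewrite gt_eqF.
apply: unitmx_inj => u Su.
have Et : coframe (top z) (top u) = 0 by rewrite -top_frame Su /top linear0.
have [w Ew] : exists w, w = top z by exists (top z).
rewrite -!Ew in Et r0 e0.
have Ot : omega0 w (top u) = 0.
  have := congr1 (omega0 w) Et; rewrite /coframe !h0_simp /theta => /eqP.
  rewrite (_ : rho w * _ = rho w ^+ 2 * (eps w)^-1 * omega0 w (top u)); last first.
    by rewrite /rho /eps in r0 e0 *; field.
  by rewrite !mulf_eq0 invr_eq0 (negPf r0) (negPf e0) => /eqP.
have Ht : top u = 0.
  move: Et; rewrite /coframe /theta Ot !mulr0 scale0r addr0 => /eqP.
  by rewrite scaler_eq0 (negPf r0) => /eqP.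
apply: V_eq; first by rewrite Ht /top linear0.
have := congr1 (@bot R n) Su; rewrite bot_frame Ht /theta omega00r !mulr0 subr0 => ->.
by rewrite bot0.
Qed.

Lemma sf_frame_torsion z u v : sf_domain z ->
  'D_(sf_frame z *m u) sf_frame z *m v - 'D_(sf_frame z *m v) sf_frame z *m u
  = sf_frame z *m c z u v.
Proof.
move=> Wz; have o := open_sf; have e0 := eps_neq0 Wz.
have D p x : 'D_p sf_frame z *m x = col_mx (dcoframe q (top z) (top p) (top x))
    (- (sig / 2) * dtheta q (top z) (top p) (top x))%:M.
  apply: etrans (esym (derive_mulmxc x p o Wz sf_frame_smooth)) _.
  by have [_ ->] := hd_frame x.
apply: etrans (congr2 (fun s t => s - t) (D _ _) (D _ _)) _.
apply: V_eq.
  by rewrite topD topN !top_col !top_frame top_c dcoframeE.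
rewrite botD botN !bot_col bot_frame !top_frame top_c bot_c.
have /eqP := dthetaE (top u) (top v) e0; rewrite [X in _ == X]addrC -subr_eq => /eqP <-.
by field.
Qed.

Lemma sf_conn_curvature z u v : sf_domain z ->
  'D_(sf_frame z *m u) (fun p => sf_conn p v) z - 'D_(sf_frame z *m v) (fun p => sf_conn p u) z
  + (sf_conn z u *m sf_conn z v - sf_conn z v *m sf_conn z u)
  - sf_conn z (c z u v) = @Rm1 R n nu sig (16 * q) u v.
Proof.
move=> Wz; have o := open_sf; have e0 := eps_neq0 Wz.
have D p y x : 'D_p (fun p => sf_conn p y) z *m x
    = col_mx (dconn q (top z) (top p) (top y) (top x)) 0%:M.
  apply: etrans (esym (derive_mulmxc x p o Wz (sf_conn_smooth y))) _.
  by have [_ ->] := hd_sf_conn y x.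
apply: mxV_eq => x; rewrite !(mulmxDl, mulNmx) -!mulmxA.
apply: etrans (congr1 (fun t => t - _) (congr1 (fun t => t + _)
  (congr2 (fun s t => s - t) (D _ _ _) (D _ _ _)))) _.
have bE (x1 x2 x3 x4 x5 : V) : bot x1 = 0 -> bot x2 = 0 -> bot x3 = 0 -> bot x4 = 0 ->
    bot x5 = 0 -> bot (x1 - x2 + (x3 - x4) - x5) = 0.
  by rewrite !(botD, botN) => -> -> -> -> ->; rewrite !subr0 addr0.
have tE (x1 x2 x3 x4 x5 : V) (y1 y2 y3 y4 y5 : H) : top x1 = y1 -> top x2 = y2 ->
    top x3 = y3 -> top x4 = y4 -> top x5 = y5 ->
    top (x1 - x2 + (x3 - x4) - x5) = y1 - y2 + (y3 - y4) - y5.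
  by rewrite !(topD, topN) => -> -> -> -> ->.
apply: V_eq; last first.
  by rewrite [RHS]bot_Rm1; apply: bE; rewrite ?bot_col ?bot_conn.
apply: (etrans (tE _ _ _ _ _ _ _ _ _ _ (top_col _ _) (top_col _ _) (top_conn _ _ _)
  (top_conn _ _ _) (top_conn _ _ _))).
rewrite !top_frame [top (sf_conn z v *m x)]top_conn [top (sf_conn z u *m x)]top_conn top_c bot_c [RHS]top_Rm1 KmxE.
have := conn_curvature (top u) (top v) (top x) e0.
have J1 X Y : conn (top z) X (J *m Y) = J *m conn (top z) X Y.
  by have := un_J Y (conn_mx_un (top z) X); rewrite !conn_mxE.
have B1 X Y Z d : conn (top z) X (Y - d *: (J *m Z)) = conn (top z) X Y - d *: (J *m conn (top z) X Z).
  by rewrite -!conn_mxE mulmxBr -scalemxAr (un_J Z (conn_mx_un _ _)).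
have E5 (d d' : R) (X Y : H) : d *: (J *m (X - d' *: (J *m Y))) = d *: (J *m X) + (d * d') *: Y.
  by rewrite mulmxBr -scalemxAr mulJJ scalerN opprK scalerDr scalerA.
rewrite !B1 !E5 => <-.
move: (dconn _ _ _ _ _) (dconn _ _ _ (top u) _) => d1 d2.
move: (conn _ (top u) (conn _ _ _)) (conn _ (top v) (conn _ _ _)) (conn _ (_ - _) _) => c1 c2 c3.
move: (J *m conn _ (top u) (top x)) (J *m conn _ (top v) (top x)) (J *m top x) => c4 c5 y.
by mx_entries; ring.
Qed.

End SpaceFormModel.

(** * The model for mu <> 0 *)

Section AffineModel.
Variables (R : realType) (n : nat) (mu nu : R).
Local Notation V := 'cV[R]_(n + n + 1).
Local Notation Mx := 'M[R]_(n + n + 1).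
Local Notation Jv := (@Jv R n).

(** For mu <> 0 the frame is rescaled along the fibre by a linear factor; its
    logarithmic derivative is the component mu of the torsion. *)
Definition cone_domain : set V := [set z | 0 < 1 + mu * bot z].
Definition cone_frame (z : V) : Mx := (1 + mu * bot z)%:M.
Definition cone_conn (u : V) : Mx := - ((nu * bot u) *: Jv).

Lemma top_cone_conn u v : top (cone_conn u *m v) = - ((nu * bot u) *: (J0 *m top v)).
Proof. by rewrite /cone_conn mulNmx -scalemxAl topN topZ /Jv top_block scaler0 addr0. Qed.
Lemma bot_cone_conn u v : bot (cone_conn u *m v) = 0.
Proof. by rewrite /cone_conn mulNmx -scalemxAl botN botZ /Jv bot_block00 mulr0 oppr0. Qed.

Let hd_factor (W : set V) : open W ->
  has_diff (E := R^o) W (fun z => 1 + mu * bot z) (fun _ v => mu * bot v).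
Proof.
move=> oW; apply: (hd_eq oW (hdR_add oW (hd_cst (E := R^o) oW (1 : R))
  (hdR_mul oW (hd_cst (E := R^o) oW mu) (hd_bot oW)))) => // z v _.
by rewrite mul0r !add0r.
Qed.

Lemma open_cone : open cone_domain.
Proof.
apply: (@open_comp _ _ (fun z : V => 1 + mu * bot z) [set x : R | 0 < x]).
  by move=> z _; exact: (C_infty_continuous (hd_factor openT).1 (I : setT z)).
exact: open_gt.
Qed.

Lemma cone_domain0 : cone_domain 0.
Proof. by rewrite /cone_domain /= bot0 mulr0 addr0 ltr01. Qed.

Let hd_cone (v : V) : has_diff cone_domain (fun z => cone_frame z *m v) (fun _ p => (mu * bot p) *: v).
Proof.
have o := open_cone.
apply: (hd_eq o (hd_scale o (hd_factor o) (hd_cst o v))) => // [z _|z p _].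
  by rewrite /cone_frame mul_scalar_mx.
by rewrite scaler0 addr0.
Qed.

Lemma cone_frame_smooth : C_infty cone_domain cone_frame.
Proof. by apply: (smooth_columns open_cone) => v; have [] := hd_cone v. Qed.

Lemma cone_frame_unit z : cone_domain z -> cone_frame z \in unitmx.
Proof.
move=> Wz; rewrite /cone_frame -scalemx1 unitmxZ ?unitmx1 // unitfE gt_eqF //.
Qed.

Lemma Jv_un0 : @un0 R n Jv.
Proof. by exists J0 => //; split=> //; rewrite JT. Qed.

Lemma cone_conn_un0 u : @un0 R n (cone_conn u).
Proof. by apply: un0N; apply: un0Z; exact: Jv_un0. Qed.

Lemma cone_conn_linear c u v : cone_conn (c *: u + v) = c *: cone_conn u + cone_conn v.
Proof. by rewrite /cone_conn botD botZ; mx_entries; ring. Qed.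

Local Notation c u v := (cone_conn u *m v - cone_conn v *m u - @Tm R n mu nu 0 u v).

Lemma bot_cone_defect u v : bot (c u v) = 0.
Proof. by rewrite !(botD, botN) !bot_cone_conn bot_Tm mul0r !subr0. Qed.

Lemma cone_frame_torsion z u v : cone_domain z ->
  'D_(cone_frame z *m u) cone_frame z *m v - 'D_(cone_frame z *m v) cone_frame z *m u
  = cone_frame z *m c u v.
Proof.
move=> Wz; have o := open_cone.
have D p (x : V) : 'D_p cone_frame z *m x = (mu * bot p) *: x.
  apply: etrans (esym (derive_mulmxc x p o Wz cone_frame_smooth)) _.
  by have [_ ->] := hd_cone x.
apply: etrans (congr2 (fun s t => s - t) (D _ _) (D _ _)) _.
have tc : top (c u v) = bot u *: (mu *: top v) - bot v *: (mu *: top u).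
  by rewrite !(topD, topN) !top_cone_conn top_Tm /Nl; mx_entries; ring.
rewrite /cone_frame !mul_scalar_mx !botZ.
apply: V_eq.
  by rewrite topD topN !topZ tc; mx_entries; ring.
by rewrite botD botN !botZ bot_cone_defect; ring.
Qed.

Lemma cone_conn_curvature z u v : cone_domain z ->
  'D_(cone_frame z *m u) (fun=> cone_conn v) z - 'D_(cone_frame z *m v) (fun=> cone_conn u) z
  + (cone_conn u *m cone_conn v - cone_conn v *m cone_conn u)
  - cone_conn (c u v) = @Rm1 R n nu 0 0 u v.
Proof.
move=> _.
have D (B : Mx) p : 'D_p (fun=> B) z = 0 by exact: derive_cst.
apply: etrans (congr1 (fun t => t - _) (congr1 (fun t => t + _)
  (congr2 (fun s t => s - t) (D _ _) (D _ _)))) _.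
have -> : Rm1 nu 0 0 u v = 0.
  by rewrite /Rm1 !mul0r !scale0r subr0 block_mx0.
have -> : cone_conn (c u v) = 0.
  by rewrite {1}/cone_conn bot_cone_defect mulr0 scale0r oppr0.
rewrite !subr0 add0r /cone_conn !mulNmx !mulmxN !opprK.
have E (x y : R) : (x *: Jv) *m (y *: Jv) = (x * y) *: (Jv *m Jv).
  by rewrite -scalemxAl -scalemxAr scalerA.
by rewrite !E [X in X *: _ - _]mulrC subrr.
Qed.
End AffineModel.

Section Sufficiency.
Variables (R : realType) (n : nat) (a b alpha beta gamma delta mu nu sig k : R).
Local Notation V := 'cV[R]_(n + n + 1).
Local Notation lam := (@lam R n a b alpha beta gamma delta).
Local Notation Tm := (@Tm R n mu nu sig).
Local Notation Rm := (@Rm R n a b alpha beta gamma delta mu nu sig k).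

(** Either mu = 0, or sig = k = 0. *)
Lemma sufficiency (T0 : V -> V -> V) (R0 : V -> V -> 'M[R]_(n + n + 1)) (I0 : V -> set 'M[R]_(n + n + 1)) :
  sig * mu = 0 -> k * mu = 0 ->
  alternating_bilinear T0 ->
  (forall u v, T0 u v = Tm u v + lam u *m v - lam v *m u) ->
  (forall u v, R0 u v = Rm u v) ->
  (forall u, I0 u = gl_class (@un0 R n) (lam u)) ->
  exists M : affine_manifold (@Un1 R n), characteristic_tensors (@un0 R n) M T0 R0 I0.
Proof.
move=> smu kmu T0f T0E R0E I0E.
have [mu0|mu0] := eqVneq mu 0.
  (* the curvature in [conn_curvature] is 16 q K *)
  have [q Ek] : exists q, k = 16 * q by exists (k / 16); field.
  rewrite Ek in R0E; rewrite mu0 in R0E T0E.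
  apply: (model_from_frame (W := @sf_domain R n q) (x0 := 0) (S := sf_frame q sig)
    (A := sf_conn q nu) _ _ _ _ _ _ _ _ _ T0f T0E R0E I0E).
  - exact: open_sf.
  - exact: sf_domain0.
  - exact: sf_frame_smooth.
  - exact: sf_frame_unit.
  - by move=> z c u v _; exact: sf_conn_linear.
  - exact: sf_conn_smooth.
  - by move=> z u _; exact: sf_conn_un0.
  - exact: sf_frame_torsion.
  - exact: sf_conn_curvature.
have sig0 : sig = 0 by move/eqP: smu; rewrite mulf_eq0 (negPf mu0) orbF => /eqP.
have k0 : k = 0 by move/eqP: kmu; rewrite mulf_eq0 (negPf mu0) orbF => /eqP.
rewrite sig0 k0 in R0E; rewrite sig0 in T0E.
apply: (model_from_frame (W := @cone_domain R n mu) (x0 := 0) (S := @cone_frame R n mu)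
    (A := fun=> cone_conn nu) _ _ _ _ _ _ _ _ _ T0f T0E R0E I0E).
- exact: open_cone.
- exact: cone_domain0.
- exact: cone_frame_smooth.
- exact: cone_frame_unit.
- by move=> z c u v _; exact: cone_conn_linear.
- by move=> u; apply: C_infty_cst; exact: open_cone.
- by move=> z u _; exact: cone_conn_un0.
- by move=> z u v; exact: cone_frame_torsion.
- by move=> z u v; exact: cone_conn_curvature.
Qed.
End Sufficiency.

(** * The blocks of the curvature tensor *)

Section CurvatureForm.
Variables (R : realType) (n : nat) (a b alpha beta gamma delta mu nu sig k : R).
Local Notation H := 'cV[R]_(n + n).
Local Notation V := 'cV[R]_(n + n + 1).
Local Notation Mx := 'M[R]_(n + n + 1).
Local Notation J := (@J0 R n).
Local Notation lam := (@lam R n a b alpha beta gamma delta).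
Local Notation Tm := (@Tm R n mu nu sig).
Local Notation Pl := (@Pl R n alpha beta).
Local Notation Ql := (@Ql R n gamma delta).
Local Notation Rm := (@Rm R n a b alpha beta gamma delta mu nu sig k).

(** Expand along V = H0 + R e. *)
Lemma alternating_eq (F G : V -> V -> Mx) : alternating_bilinear F -> alternating_bilinear G ->
  (forall X, F (inH X) e = G (inH X) e) -> (forall X Y, F (inH X) (inH Y) = G (inH X) (inH Y)) ->
  forall u v, F u v = G u v.
Proof.
have expand (E : V -> V -> Mx) u v : alternating_bilinear E -> E u v =
    bot v *: E (inH (top u)) e - bot u *: E (inH (top v)) e + E (inH (top u)) (inH (top v)).
  move=> [lin anti].
  have linr c x y z : E x (c *: y + z) = c *: E x y + E x z.
    by rewrite anti lin opprD -scalerN -!anti.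
  have ee : E e e = 0.
    have := anti e e => /matrixP A; apply/matrixP => i j; move: (A i j).
    by rewrite oppmxE zeromxE; lra.
  rewrite [in LHS](inH_e u) [in LHS](inH_e v) ![inH _ + _ *: e]addrC lin !linr ee.
  rewrite (anti e (inH _)).
  by mx_entries; ring.
by move=> aF aG E1 E2 u v; rewrite (expand _ u v aF) (expand _ u v aG) !E1 E2.
Qed.

(** The block of Rm (X, Y) on H0. *)
Definition Bm (X Y : H) : 'M[R]_(n + n) :=
  k *: Kmx X Y - (sig * nu * omega0 X Y) *: J + (a * (sig * omega0 X Y))%:M
  + (Pl X *m (Ql Y)^T - Pl Y *m (Ql X)^T).

Lemma Rm_inH_e X : Rm (inH X) e =
  block_mx 0 ((alpha * mu - beta * nu + (b - a) * alpha) *: X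
              + (alpha * nu + beta * mu + (b - a) * beta) *: (J *m X))
    (flat ((gamma * mu - delta * nu + (a - b) * gamma) *: X
           + (gamma * nu + delta * mu + (a - b) * delta) *: (J *m X))) 0.
Proof.
have -> : Rm (inH X) e = Rm1 nu sig k (inH X) e + lam (Tm (inH X) e)
  + (lam (inH X) *m lam e - lam e *m lam (inH X)) by [].
have -> : Rm1 nu sig k (inH X) e = 0.
  rewrite /Rm1 top_e omega00r mulr0 scale0r subr0.
  rewrite (_ : Kmx _ 0 = 0) ?scaler0 ?block_mx0 //.
  by rewrite (kl_anti (@K_kahler R n)) -(scale0r 0) (kl_scale (@K_kahler R n)) scale0r oppr0.
have -> : Tm (inH X) e = inH (mu *: X + nu *: (J *m X)).
  apply: V_eq; rewrite ?top_Tm ?bot_Tm ?top_inH ?bot_inH top_e ?bot_e.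
    by rewrite scale1r scale0r subr0.
  by rewrite omega00r mulr0.
have tE (x y z : V) : top (x + (y - z)) = top x + (top y - top z) by rewrite !(topD, topN).
have bE (x y z : V) : bot (x + (y - z)) = bot x + (bot y - bot z) by rewrite !(botD, botN).
apply: mxV_eq => v; rewrite add0r mulmxDl mulmxBl -!mulmxA; apply: V_eq.
  rewrite [RHS]top_block tE !top_lam !bot_lam !top_inH !bot_inH !top_e !bot_e.
  rewrite /Pl /Ql mul0mx !mulmx0 !h0_simp.
  rewrite !(mulmxDr, =^~ scalemxAr) !mulJJ.
  by mx_entries; rewrite ?zeromxE; ring.
rewrite (_ : (0 : 'M[R]_1) = 0%:M) ?[RHS]bot_block; last by rewrite -scalemx1 scale0r.
rewrite bE !bot_lam !top_lam !top_inH !bot_inH !top_e !bot_e.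
rewrite /Ql /Pl !mulmx0 !h0_simp ?h0_simp.
by ring.
Qed.

Lemma Rm_inH X Y : Rm (inH X) (inH Y) =
  block_mx (Bm X Y) 0 0 ((b * sig + 2 * (delta * alpha - gamma * beta)) * omega0 X Y)%:M.
Proof.
have -> : Rm (inH X) (inH Y) = Rm1 nu sig k (inH X) (inH Y) + lam (Tm (inH X) (inH Y))
  + (lam (inH X) *m lam (inH Y) - lam (inH Y) *m lam (inH X)) by [].
have -> : Tm (inH X) (inH Y) = (sig * omega0 X Y) *: e.
  apply: V_eq; rewrite ?top_Tm ?bot_Tm ?topZ ?botZ !top_inH ?bot_inH ?top_e ?bot_e.
    by rewrite !scale0r subr0 scaler0.
  by rewrite mulr1.
have tE (x y z t : V) : top (x + y + (z - t)) = top x + top y + (top z - top t).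
  by rewrite !(topD, topN).
have bE (x y z t : V) : bot (x + y + (z - t)) = bot x + bot y + (bot z - bot t).
  by rewrite !(botD, botN).
apply: mxV_eq => v; rewrite mulmxDl mulmxBl mulmxDl -!mulmxA; apply: V_eq.
  rewrite [RHS]top_block tE !top_lam !bot_lam top_Rm1 topZ botZ !top_inH !bot_inH top_e bot_e.
  rewrite /Bm !(mulmxDl, mulNmx) -(scalemxAl k) -(scalemxAl _ J) !outerE mul_scalar_mx.
  rewrite /Pl /Ql !h0_simp scaler0 mulmx0.
  by mx_entries; rewrite ?zeromxE; ring.
rewrite [RHS]bot_block0 bE !bot_lam !top_lam bot_Rm1 topZ botZ !top_inH !bot_inH top_e bot_e.
rewrite /Ql /Pl ?scaler0 ?mulmx0 !h0_simp (h0C Y X) (omega0C Y X).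
by ring.
Qed.

Lemma curvature_formP R0 c0 c1 c2 c3 c4 :
  c1 = alpha * mu - beta * nu + (b - a) * alpha ->
  c2 = alpha * nu + beta * mu + (b - a) * beta ->
  c3 = gamma * mu - delta * nu + (a - b) * gamma ->
  c4 = gamma * nu + delta * mu + (a - b) * delta ->
  c0 = b * sig + 2 * (delta * alpha - gamma * beta) ->
  (forall u v, R0 u v = Rm u v) <-> has_curvature_form R0 c0 c1 c2 c3 c4 Bm.
Proof.
move=> E1 E2 E3 E4 E0; split=> [RE|[aR0 Re RH]].
  split=> [|X|X Y]; rewrite ?RE ?Rm_inH_e ?Rm_inH ?E1 ?E2 ?E3 ?E4 ?E0 //.
  have [lin anti] := @Rm_form R n a b alpha beta gamma delta mu nu sig k.
  by split=> *; rewrite !RE ?lin // {1}anti.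
apply: alternating_eq aR0 (@Rm_form R n _ _ _ _ _ _ _ _ _ _) _ _ => [X|X Y].
  by rewrite Rm_inH_e Re E1 E2 E3 E4.
by rewrite Rm_inH RH E0.
Qed.

Lemma Bm_act X Y Z : Bm X Y *m Z =
  h0 (Ql Y) Z *: Pl X - h0 (Ql X) Z *: Pl Y + (a * sig * omega0 X Y) *: Z
  - (sig * nu * omega0 X Y) *: (J *m Z) + k *: K X Y Z.
Proof.
rewrite /Bm !(mulmxDl, mulNmx) -(scalemxAl k) -(scalemxAl _ J) !outerE mul_scalar_mx KmxE.
have aux (x1 x2 x3 x4 x5 : H) : x1 - x2 + x3 + (x4 - x5) = x4 - x5 + x3 - x2 + x1.
  by mx_entries; ring.
by rewrite aux /Pl !scalerDr -[a * sig * _]mulrA.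
Qed.
End CurvatureForm.

(** * The classification *)

Section Classification.
Variables (R : realType) (n : nat) (a b alpha beta gamma delta mu nu sig : R).
Local Notation V := 'cV[R]_(n + n + 1).
Local Notation lam := (@lam R n a b alpha beta gamma delta).
Local Notation Tm := (@Tm R n mu nu sig).

Lemma realizedP (T0 : V -> V -> V) (R0 : V -> V -> 'M[R]_(n + n + 1))
    (I0 : V -> set 'M[R]_(n + n + 1)) :
  (0 < n)%N -> alternating_bilinear T0 ->
  (forall u v, T0 u v = Tm u v + lam u *m v - lam v *m u) ->
  (forall u, I0 u = gl_class (@un0 R n) (lam u)) ->
  (exists M : affine_manifold (@Un1 R n), characteristic_tensors (@un0 R n) M T0 R0 I0) <->
  sig * mu = 0 /\ exists2 k : R, k * mu = 0 &
    forall u v, R0 u v = Rm a b alpha beta gamma delta mu nu sig k u v.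
Proof.
move=> n0 T0f T0E I0E; split=> [[M ct]|[smu [k kmu R0E]]].
  exact: necessity n0 ct T0E I0E.
exact: sufficiency smu kmu T0f T0E R0E I0E.
Qed.
End Classification.

Theorem corollary4p14 (R : realType) (n : nat)
    (tau1 tau2 tau3 a b alpha beta gamma delta : R)
    (T0 : 'cV[R]_(n + n + 1) -> 'cV[R]_(n + n + 1) -> 'cV[R]_(n + n + 1))
    (I0 : 'cV[R]_(n + n + 1) -> set 'M[R]_(n + n + 1)) :
  (1 <= n)%N ->
  alternating_bilinear T0 ->
  (forall X Y : 'cV[R]_(n + n),
     T0 (inH X) (inH Y) = (tau3 * omega0 X Y) *: e) ->
  (forall X : 'cV[R]_(n + n),
     T0 (inH X) e = inH (tau1 *: X + tau2 *: (J0 *m X))) ->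
  (forall (X : 'cV[R]_(n + n)) (s : R),
     I0 (inH X + s *: e) =
       gl_class (@un0 R n)
         (block_mx (a * s)%:M (alpha *: X + beta *: (J0 *m X))
                   (flat (gamma *: X + delta *: (J0 *m X))) (b * s)%:M)) ->
  let realized
      (R0 : 'cV[R]_(n + n + 1) -> 'cV[R]_(n + n + 1) -> 'M[R]_(n + n + 1)) :=
    exists M : affine_manifold (@Un1 R n),
      characteristic_tensors (@un0 R n) M T0 R0 I0 in
  let aS := a + tau1 / 2 in
  let bS := b in
  let alphaS := alpha - tau1 / 2 in
  let betaS := beta - tau2 / 2 in
  let gammaS := gamma in
  let deltaS := delta - tau3 / 2 in
  let P (X : 'cV[R]_(n + n)) := alpha *: X + beta *: (J0 *m X) in
  let Q (X : 'cV[R]_(n + n)) := gamma *: X + delta *: (J0 *m X) in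
  ((exists R0, realized R0) <->
     (2 * delta - tau3) * (alpha - a - tau1) = 0) /\
  ((2 * delta - tau3) * (alpha - a - tau1) = 0 ->
     (alpha - a = tau1 ->
        let c1 := aS * (bS - aS) + betaS ^+ 2 + 2^-1 * bS * tau1
                  + 4^-1 * (tau1 ^+ 2 - tau2 ^+ 2) in
        let c2 := betaS * (bS - 2 * aS) + 2^-1 * bS * tau2
                  + 2^-1 * tau1 * tau2 in
        let c3 := (aS - bS) * gammaS + betaS * deltaS - 2^-1 * gammaS * tau1
                  - 2^-1 * deltaS * tau2 + 2^-1 * betaS * tau3
                  - 4^-1 * tau2 * tau3 in
        let c4 := (aS - bS) * deltaS - betaS * gammaS - 2^-1 * deltaS * tau1
                  + 2^-1 * gammaS * tau2 + 2^-1 * (aS - bS) * tau3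
                  - 4^-1 * tau1 * tau3 in
        let c0 := 2 * ((aS - bS) * deltaS - betaS * gammaS) + deltaS * tau1
                  - gammaS * tau2 + aS * tau3 + 2^-1 * tau1 * tau3 in
        forall R0, realized R0 <->
          exists (kappa : R)
                 (B : 'cV[R]_(n + n) -> 'cV[R]_(n + n) -> 'M[R]_(n + n)),
            has_curvature_form R0 c0 c1 c2 c3 c4 B /\
            forall X Y Z : 'cV[R]_(n + n),
              B X Y *m Z =
                h0 (Q Y) Z *: P X - h0 (Q X) Z *: P Y
                - (2 * a * deltaS * omega0 X Y) *: Z
                + (deltaS * (tau2 - 2 * betaS) * omega0 X Y) *: (J0 *m Z)
                + kappa *: K X Y Z) /\
     (alpha - a <> tau1 ->
        let c1 := - alphaS ^+ 2 + bS * alphaS + betaS ^+ 2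
                  + 2^-1 * bS * tau1 + 4^-1 * (tau1 ^+ 2 - tau2 ^+ 2) in
        let c2 := betaS * (bS - 2 * alphaS) + 2^-1 * bS * tau2
                  + 2^-1 * tau1 * tau2 in
        let c3 := (2 * aS - alphaS - bS) * gammaS - 2^-1 * gammaS * tau1
                  + 2^-1 * betaS * tau3 - 4^-1 * tau2 * tau3 in
        let c4 := - betaS * gammaS + 2^-1 * gammaS * tau2
                  + (aS - (alphaS + bS) / 2) * tau3 - 4^-1 * tau1 * tau3 in
        let c0 := - 2 * betaS * gammaS - gammaS * tau2 + alphaS * tau3
                  + 2^-1 * tau1 * tau3 in
        deltaS = 0 /\
        forall R0, realized R0 <->
          exists B : 'cV[R]_(n + n) -> 'cV[R]_(n + n) -> 'M[R]_(n + n),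
            has_curvature_form R0 c0 c1 c2 c3 c4 B /\
            forall X Y Z : 'cV[R]_(n + n),
              B X Y *m Z = h0 (Q Y) Z *: P X - h0 (Q X) Z *: P Y)).
Proof.
move=> n1 T0f TXY TXe I0E realized aS bS alphaS betaS gammaS deltaS P Q.
have [mu Emu] : exists mu, mu = tau1 - alpha + a by exists (tau1 - alpha + a).
have [nu Enu] : exists nu, nu = tau2 - beta by exists (tau2 - beta).
have [sig Esig] : exists sig, sig = tau3 - 2 * delta by exists (tau3 - 2 * delta).
have T0E := Tm_of_T0 b gamma Emu Enu Esig T0f TXY TXe.
have I0E' u : I0 u = gl_class (@un0 R n) (lam a b alpha beta gamma delta u).
  by rewrite {1}(inH_e u) I0E.
have cond : (2 * delta - tau3) * (alpha - a - tau1) = sig * mu by rewrite Emu Esig; ring.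
have RP R0 : realized R0 <-> sig * mu = 0 /\ exists2 k : R, k * mu = 0 &
    forall u v, R0 u v = Rm a b alpha beta gamma delta mu nu sig k u v.
  exact: realizedP n1 T0f T0E I0E'.
rewrite cond; split; first split.
- by move=> [R0 /RP[]].
- move=> smu; exists (Rm a b alpha beta gamma delta mu nu sig 0); apply/RP.
  by split=> //; exists 0; rewrite ?mul0r.
move=> smu; split=> [Ea|Ea].
  have mu0 : mu = 0 by rewrite Emu -Ea; ring.
  have E1 : tau1 = alpha - a by [].
  move=> c1 c2 c3 c4 c0 R0.
  have FP k := @curvature_formP R n a b alpha beta gamma delta mu nu sig k R0 c0 c1 c2 c3 c4.
  have BE k X Y Z : Bm a alpha beta gamma delta nu sig k X Y *m Z =
      h0 (Q Y) Z *: P X - h0 (Q X) Z *: P Y - (2 * a * deltaS * omega0 X Y) *: Z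
      + (deltaS * (tau2 - 2 * betaS) * omega0 X Y) *: (J0 *m Z) + k *: K X Y Z.
    rewrite Bm_act; congr (_ + _ + _ + _); rewrite -scaleNr; congr (_ *: _);
      by rewrite /deltaS /betaS Esig ?Enu; field.
  have form k : (forall u v, R0 u v = Rm a b alpha beta gamma delta mu nu sig k u v) <->
      has_curvature_form R0 c0 c1 c2 c3 c4 (Bm a alpha beta gamma delta nu sig k).
    by apply: FP; rewrite /c1 /c2 /c3 /c4 /c0 /aS /bS /alphaS /betaS /gammaS /deltaS
      ?Emu ?Enu ?Esig ?E1; field.
  split=> [/RP[_ [k _ /form Rk]]|[k [B [RB BZ]]]].
    by exists k, (Bm a alpha beta gamma delta nu sig k).
  have EB : B = Bm a alpha beta gamma delta nu sig k.
    by apply/funext => X; apply/funext => Y; apply: mx_vec_eq => Z; rewrite BZ BE.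
  apply/RP; split=> //; exists k; first by rewrite mu0 mulr0.
  by apply/form; rewrite -EB.
have mu0 : mu != 0.
  by apply/eqP => mu0; apply: Ea; move: mu0; rewrite Emu; lra.
have sig0 : sig = 0 by move/eqP: smu; rewrite mulf_eq0 (negPf mu0) orbF => /eqP.
have dE : delta = tau3 / 2 by move: sig0; rewrite Esig; lra.
move=> c1 c2 c3 c4 c0; split=> [|R0]; first by rewrite /deltaS dE subrr.
have BE X Y Z : Bm a alpha beta gamma delta nu sig 0 X Y *m Z =
    h0 (Q Y) Z *: P X - h0 (Q X) Z *: P Y.
  by rewrite Bm_act sig0 mulr0 !mul0r !scale0r subr0 !addr0.
have form : (forall u v, R0 u v = Rm a b alpha beta gamma delta mu nu sig 0 u v) <->
    has_curvature_form R0 c0 c1 c2 c3 c4 (Bm a alpha beta gamma delta nu sig 0).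
  by apply: curvature_formP; rewrite /c1 /c2 /c3 /c4 /c0 /aS /bS /alphaS /betaS /gammaS
    ?Emu ?Enu ?sig0 ?dE; field.
split=> [/RP[_ [k /eqP]]|[B [RB BZ]]].
  rewrite mulf_eq0 (negPf mu0) orbF => /eqP -> /form Rk.
  by exists (Bm a alpha beta gamma delta nu sig 0).
have EB : B = Bm a alpha beta gamma delta nu sig 0.
  by apply/funext => X; apply/funext => Y; apply: mx_vec_eq => Z; rewrite BZ BE.
apply/RP; split=> //; exists 0; first by rewrite mul0r.
by apply/form; rewrite -EB.
Qed.
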